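(* Let $R=K[x_0,\dots,x_n]$ with $K$ an infinite field, and let $I\subset R$ be a homogeneous ideal of height at least two. Then the algorithm described in the context, applied to $I$, terminates after finitely many steps, and the resulting ideal is numerically ACM.
   Context: Basic double link: given a nonzero homogeneous ideal $I\subset R$, a nonzero homogeneous form $F\in I$ of degree $d$, and a general form $G\in R$ of degree $a$, the ideal $J=G\cdot I+(F)$ is called a basic double link of $I$ of type $(d,a)$. Numerically ACM: a homogeneous ideal $J\subset R$ is numerically ACM if $R/J$ has the same Hilbert function as $R/I_Y$ for some arithmetically Cohen-Macaulay codimension two subscheme $Y\subset\mathbb P^n$ (i.e. $R/I_Y$ is Cohen-Macaulay). The algorithm. Input: a homogeneous ideal $I\subset R$ of height $\ge 2$. Take a minimal graded free resolution $0\to F_{n+1}\to\cdots\to F_1\to R\to R/I\to 0$ with $F_p=\bigoplus_k R(-c_{p,k})$. (1) Let $\underline s=\{s_i\}$ be the multiset of all $c_{p,k}$ with $p\ge 2$ even and $\underline r=\{r_j\}$ the multiset of all $c_{p,k}$ with $p$ odd, each listed in non-increasing order (then $\sum s_i=\sum r_j$, and $\underline r$ has one more element than $\underline s$). (2) Remove equal elements $r_j=s_i$ pairwise, one pair at a time, until the two multisets are disjoint; still call them $\underline s=\{s_1\ge\dots\ge s_{\nu-1}\}$ and $\underline r=\{r_1\ge\dots\ge r_\nu\}$. (3) Form the $(\nu-1)\times\nu$ matrix $A=(s_i-r_j)$. Let $-d_1,\dots,-d_\ell$ be the negative entries on its main diagonal, i.e. the negative numbers among $s_i-r_i$, $1\le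 i\le\nu-1$, ordered according to non-decreasing $r_i$ (starting from the bottom right and moving up and left). (4) If there is a negative diagonal entry, write $-d_1=s_{i_1}-r_{i_1}$ and, using general polynomials, let $J$ be a basic double link of $I$ of type $(r_{i_1},d_1)$. (5) Repeat steps (1)–(4) with $J$ in place of $I$, until there are no negative entries on the main diagonal. The last ideal obtained is the result (called the numerical Macaulification of the original ideal).
   Formalization: The ideal I is taken proper; for n = 1, where codimension two subschemes of P^1 are empty and I = (x_0, x_1) would be a counterexample, ''numerically ACM'' is read with homogeneous height-two ideals having Artinian quotient in place of saturated ideals I_Y. *)

(* Defs.v *)
From mathcomp Require Import all_boot all_order all_algebra.
From mathcomp Require Import mpoly.

Set Implicit Arguments.
Unset Strict Implicit.
Unset Printing Implicit Defensive.

Import Order.TTheory GRing.Theory Num.Theory.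
Local Open Scope ring_scope.

Definition infinite_type (T : eqType) : Prop :=
  forall s : seq T, exists x, x \notin s.

(* Ideals of R = K[x_0, ..., x_n] are Prop-valued predicates satisfying
   [is_ideal]. *)
Notation polyset K n := ({mpoly K[n.+1]} -> Prop).

Definition is_ideal (K : fieldType) (n : nat) (I : polyset K n) : Prop :=
  [/\ I 0,
      (forall f g, I f -> I g -> I (f + g))
    & (forall f g, I g -> I (f * g))].

Definition homogeneous (K : fieldType) (n : nat) (I : polyset K n) : Prop :=
  forall f d, I f -> I (pihomog mdeg d f).

Definition is_prime (K : fieldType) (n : nat) (P : polyset K n) : Prop :=
  [/\ is_ideal P, ~ P 1 & forall f g, P (f * g) -> P f \/ P g].

Definition sub_ideal (K : fieldType) (n : nat) (I J : polyset K n) : Prop :=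
  forall f, I f -> J f.

(* C 0 < C 1 < ... < C k is a strict chain of primes, of length k. *)
Definition prime_chain (K : fieldType) (n : nat) (k : nat)
    (C : nat -> polyset K n) : Prop :=
  (forall i, (i <= k)%N -> is_prime (C i)) /\
  (forall i, (i < k)%N -> sub_ideal (C i) (C i.+1) /\
                          ~ sub_ideal (C i.+1) (C i)).

Definition prime_height_ge (K : fieldType) (n : nat) (P : polyset K n)
    (k : nat) : Prop :=
  exists2 C, prime_chain k C & forall f, C k f <-> P f.

(* The unit ideal has infinite height with this convention. *)
Definition height_ge (K : fieldType) (n : nat) (I : polyset K n)
    (k : nat) : Prop :=
  forall P, is_prime P -> sub_ideal I P -> prime_height_ge P k.

Definition has_height (K : fieldType) (n : nat) (I : polyset K n)
    (k : nat) : Prop :=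
  height_ge I k /\ ~ height_ge I k.+1.

(* Primes of R/I are the primes of R containing I. *)
Definition quotient_dim_ge (K : fieldType) (n : nat) (I : polyset K n)
    (k : nat) : Prop :=
  exists2 C, prime_chain k C & sub_ideal I (C 0%N).

Definition quotient_dim (K : fieldType) (n : nat) (I : polyset K n)
    (k : nat) : Prop :=
  quotient_dim_ge I k /\ ~ quotient_dim_ge I k.+1.

Definition add_principal (K : fieldType) (n : nat) (I : polyset K n)
    (f : {mpoly K[n.+1]}) : polyset K n :=
  fun h => exists g q, I g /\ h = g + q * f.

(* rs is a regular sequence on R/I. *)
Fixpoint regular_sequence (K : fieldType) (n : nat) (I : polyset K n)
    (rs : seq {mpoly K[n.+1]}) : Prop :=
  if rs is f :: rs' then
    (forall g, I (f * g) -> I g) /\ regular_sequence (add_principal I f) rs'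
  else ~ I 1.

(* Depth of R/I with respect to the irrelevant ideal (x_0, ..., x_n). *)
Definition quotient_depth_ge (K : fieldType) (n : nat) (I : polyset K n)
    (k : nat) : Prop :=
  exists rs : seq {mpoly K[n.+1]},
    [/\ size rs = k, forall f, f \in rs -> f@_0%MM = 0
      & regular_sequence I rs].

Definition quotient_depth (K : fieldType) (n : nat) (I : polyset K n)
    (k : nat) : Prop :=
  quotient_depth_ge I k /\ forall l, quotient_depth_ge I l -> (l <= k)%N.

(* R/I is Cohen-Macaulay, for a proper homogeneous ideal I. *)
Definition cohen_macaulay (K : fieldType) (n : nat) (I : polyset K n) : Prop :=
  exists k, quotient_dim I k /\ quotient_depth I k.

Definition saturated (K : fieldType) (n : nat) (I : polyset K n) : Prop :=
  forall f, (exists k, forall g : {mpoly K[n.+1]},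
               g \is k.-homog -> I (g * f)) -> I f.

(* I = I_Y for an arithmetically Cohen-Macaulay subscheme Y of P^n of
   codimension two.  Subschemes of P^n correspond to saturated homogeneous
   ideals.  A codimension two subscheme of P^1 is empty, so for n = 1 the
   homogeneous ideals of height two with Artinian quotient are meant, and these
   are not saturated. *)
Definition acm_codim2_ideal (K : fieldType) (n : nat)
    (I : polyset K n) : Prop :=
  [/\ is_ideal I, homogeneous I, has_height I 2, cohen_macaulay I
    & ((1 < n)%N -> saturated I)].

(* h = dim_K [R/I]_t. *)
Definition hilbert_function (K : fieldType) (n : nat) (I : polyset K n)
    (t h : nat) : Prop :=
  exists2 U : {vspace dhomog n.+1 K t},
    (forall f : dhomog n.+1 K t, f \in U <-> I (val f))
    & h = (\dim {:dhomog n.+1 K t} - \dim U)%N.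

Definition same_hilbert_function (K : fieldType) (n : nat)
    (I J : polyset K n) : Prop :=
  forall t, exists2 h, hilbert_function I t h & hilbert_function J t h.

Definition numerically_ACM (K : fieldType) (n : nat) (J : polyset K n) : Prop :=
  [/\ is_ideal J, homogeneous J
    & exists2 IY, acm_codim2_ideal IY & same_hilbert_function J IY].

(* Zariski open subsets of a finite-dimensional K-vector space: unions of
   non-vanishing loci of polynomials in the coordinates. *)
Definition zariski_open (K : fieldType) (V : vectType K)
    (U : V -> Prop) : Prop :=
  exists S : {mpoly K[\dim {:V}]} -> Prop,
    forall v, U v <->
      exists2 phi, S phi & phi.@[fun i => coord (vbasis {:V}) i v] != 0.

Definition general (K : fieldType) (V : vectType K) (Q : V -> Prop) : Prop :=
  exists U : V -> Prop,
    [/\ zariski_open U, exists v, U v & forall v, U v -> Q v].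

Definition form_in (K : fieldType) (n : nat) (I : polyset K n) (d : nat)
    (F : {mpoly K[n.+1]}) : Prop :=
  [/\ I F, F != 0 & F \is d.-homog].

(* The ideal G I + (F). *)
Definition basic_double_link (K : fieldType) (n : nat) (I : polyset K n)
    (F G : {mpoly K[n.+1]}) : polyset K n :=
  fun h => exists g q, I g /\ h = G * g + q * F.

(* 0 -> F_{n+1} -> ... -> F_1 -> F_0 = R -> R/I -> 0 is a minimal graded free
   resolution, with F_p the sum of the R(-k), k in c p.  The map
   M p : F_{p+1} -> F_p acts on row vectors by right multiplication; an entry
   (M p) i j is a form of degree (c p.+1)_i - (c p)_j, and minimality says that
   all entries lie in (x_0, ..., x_n).  For p = 0, const_mx f is the 1 x 1
   matrix f, as c 0 has size one. *)
Definition minimal_free_resolution (K : fieldType) (n : nat) (I : polyset K n)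
    (c : nat -> seq nat)
    (M : forall p, 'M[{mpoly K[n.+1]}]_(size (c p.+1), size (c p))) : Prop :=
  [/\ c 0%N = [:: 0%N] /\ (forall p, (n.+1 < p)%N -> c p = [::]),
      (forall p i j m, m \in msupp (M p i j) ->
         (mdeg m + nth 0 (c p) j)%N = nth 0%N (c p.+1) i),
      (forall p i j, (M p i j)@_0%MM = 0),
      (forall f, I f <->
         exists w : 'rV_(size (c 1%N)), w *m M 0%N = const_mx f)
    & (forall p (v : 'rV_(size (c p.+1))), v *m M p = 0 <->
         exists w : 'rV_(size (c p.+2)), v = w *m M p.+1)].

Definition resolution_shifts (K : fieldType) (n : nat) (I : polyset K n)
    (c : nat -> seq nat) : Prop :=
  exists M, @minimal_free_resolution K n I c M.

Definition even_shifts (n : nat) (c : nat -> seq nat) : seq nat :=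
  flatten [seq c p | p <- iota 1 n.+1 & ~~ odd p].

Definition odd_shifts (n : nat) (c : nat -> seq nat) : seq nat :=
  flatten [seq c p | p <- iota 1 n.+1 & odd p].

(* Multiset difference: [rem x] deletes one occurrence of x, if any. *)
Definition mset_diff (u v : seq nat) : seq nat := foldl (fun w x => rem x w) u v.

(* Removing equal elements pairwise until the multisets are disjoint leaves the
   two multiset differences. *)
Definition reduced_s (n : nat) (c : nat -> seq nat) : seq nat :=
  sort geq (mset_diff (even_shifts n c) (odd_shifts n c)).

Definition reduced_r (n : nat) (c : nat -> seq nat) : seq nat :=
  sort geq (mset_diff (odd_shifts n c) (even_shifts n c)).

(* Indices of the matrix A start at 0 here. *)
Definition degree_matrix (s r : seq nat) (i j : nat) : int :=
  (nth 0%N s i)%:Z - (nth 0%N r j)%:Z.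

(* The indices of the negative diagonal entries of A, from the bottom right. *)
Definition negative_diagonal (s r : seq nat) : seq nat :=
  [seq i <- rev (iota 0 (size s)) | degree_matrix s r i i < 0].

(* The type (r_{i_1}, d_1) of the basic double link to perform, or None if the
   diagonal of A has no negative entry. *)
Definition next_link_type (n : nat) (c : nat -> seq nat) : option (nat * nat) :=
  let s := reduced_s n c in
  let r := reduced_r n c in
  if negative_diagonal s r is i :: _
  then Some (nth 0%N r i, `|degree_matrix s r i i|%N)
  else None.

(* Run on I, with any choice of minimal free resolutions and of nonzero forms F,
   and with general forms G, the algorithm can be carried out, stops after
   finitely many steps, and returns an ideal satisfying Q.  Finiteness is the
   well-foundedness of the inductive definition. *)
Inductive algorithm_terminates_with (K : fieldType) (n : nat)
    (Q : polyset K n -> Prop) (I : polyset K n) : Prop :=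
| AlgorithmTerminatesWith :
    (exists c, resolution_shifts I c) ->
    (forall c, resolution_shifts I c -> next_link_type n c = None -> Q I) ->
    (forall c d a, resolution_shifts I c -> next_link_type n c = Some (d, a) ->
       exists F, form_in I d F) ->
    (forall c d a, resolution_shifts I c -> next_link_type n c = Some (d, a) ->
       forall F, form_in I d F ->
       general (fun G : dhomog n.+1 K a =>
         algorithm_terminates_with Q (basic_double_link I F (val G)))) ->
    algorithm_terminates_with Q I.

(* Main.v *)
(* Write the Hilbert function of R/I through the K-polynomial
   E = 1 + sum z^(s_i) - sum z^(r_j), read off a minimal free resolution; cancelling
   common terms leaves the disjoint multisets s and r, so these depend on the
   Hilbert function only. Since I has height at least two, (1 - z)^2 divides E, that
   is, r has one element more than s and both have the same sum. If G is a nonzero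
   divisor modulo F, the Koszul relation between G and F gives the Hilbert function
   of J = G I + (F): for the type (r_i, r_i - s_i) the pair s_i, r_i disappears and
   all remaining degrees are shifted by r_i - s_i. Hence the algorithm stops after
   at most the initial number of elements of s many steps. When no diagonal entry is
   negative, s_i > r_i for all i, and the monomial ideal of maximal minors of the
   bidiagonal matrix with entries x_0^(s_i - r_i) and x_1^(s_i - r_(i+1)) is an
   arithmetically Cohen-Macaulay ideal of codimension two with the same Hilbert
   function.
   Dimension theory enters only through the growth of the dimensions of the spaces
   of polynomials of degree at most t modulo an ideal: the growth exponent drops
   whenever an element regular modulo the ideal is added, hence along chains of
   primes and along regular sequences. *)
Require Import Defs.
From mathcomp Require Import all_boot all_order all_algebra.
From mathcomp Require Import zify ring mpoly.
From Stdlib Require Import Classical ClassicalEpsilon.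
From Stdlib Require Import FunctionalExtensionality PropExtensionality.

Set Implicit Arguments.
Unset Strict Implicit.
Unset Printing Implicit Defensive.

Import Order.TTheory GRing.Theory Num.Theory.
Local Open Scope ring_scope.

(** The height of I is used once, to bound the growth of I. From there on the induction carries
    properness, homogeneity and numerical data: disjoint s and r describing the Hilbert function,
    with one more r than s and equal sums. These data pass to J by arithmetic alone, so neither the
    height nor the resolution of J has to be computed from that of I. A resolution must nevertheless
    exist for every ideal that the algorithm meets, and its length must be at most n + 1; this is
    why minimal resolutions are constructed and the syzygy theorem is proved. The form F of degree
    r_i exists because r_i is not among the s: an ideal with no form up to that degree would have
    equally many r and s there. Ideals are arbitrary predicates, so Noetherian arguments are run
    classically with choice, and dimensions are those of predicates on the infinite-dimensional
    space of polynomials. *)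

Lemma choice_dfun (A : Type) (B : A -> Type) (P : forall x, B x -> Prop) :
  (forall x, exists y, P x y) -> exists f : forall x, B x, forall x, P x (f x).
Proof.
move=> h; exists (fun x => proj1_sig (constructive_indefinite_description _ (h x))).
by move=> x; case: constructive_indefinite_description.
Qed.

Lemma choice_fun (A B : Type) (P : A -> B -> Prop) :
  (forall x, exists y, P x y) -> exists f, forall x, P x (f x).
Proof. exact: choice_dfun. Qed.

Lemma ex_max_prop (P : nat -> Prop) d :
  P 0%N -> (forall k, P k -> (k <= d)%N) ->
  exists2 k, P k & forall j, P j -> (j <= k)%N.
Proof.
move=> P0; elim: d => [|d IH] hd; first by exists 0%N.
have [Pd|nPd] := classic (P d.+1); first by exists d.+1.
apply: IH => k Pk; have := hd k Pk; rewrite leq_eqVlt => /orP[/eqP e|//].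
by rewrite e in Pk.
Qed.

Lemma ex_min_prop (P : nat -> Prop) :
  (exists k, P k) -> exists2 k, P k & forall j, P j -> (k <= j)%N.
Proof.
case=> k; elim: k {-2}k (leqnn k) => [|k IH] m hm Pm.
  by exists m => // j _; rewrite (leq_trans hm).
have [[j ljm Pj]|h] := classic (exists2 j, (j < m)%N & P j).
  by apply: (IH j) => //; rewrite -ltnS (leq_trans ljm).
by exists m => // j Pj; rewrite leqNgt; apply/negP => lj; apply: h; exists j.
Qed.

(** * Dimension of subspaces given by predicates *)

Section Dimension.
Variable K : fieldType.

Definition subspace (V : lmodType K) (A : V -> Prop) :=
  [/\ A 0, forall u v, A u -> A v -> A (u + v) & forall c v, A v -> A (c *: v)].

Definition free_fam (V : lmodType K) (T : finType) (b : T -> V) :=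
  forall u : T -> K, \sum_x u x *: b x = 0 -> forall x, u x = 0.

Definition has_dim (V : lmodType K) (A : V -> Prop) (d : nat) :=
  exists (T : finType) (b : T -> V),
    [/\ #|T| = d, forall v, A v <-> exists u : T -> K, v = \sum_x u x *: b x
      & free_fam b].

Definition fin_dim (V : lmodType K) (A : V -> Prop) := exists d, has_dim A d.

(** The value carries information only under [fin_dim]; elsewhere it is arbitrary. *)
Definition dimv (V : lmodType K) (A : V -> Prop) : nat :=
  epsilon (inhabits 0%N) (has_dim A).

Definition is_lin (V W : lmodType K) (f : V -> W) :=
  forall c u v, f (c *: u + v) = c *: f u + f v.

Lemma subspace_sum (V : lmodType K) (A : V -> Prop) (T : finType) (b : T -> V)
    (u : T -> K) :
  subspace A -> (forall x, A (b x)) -> A (\sum_x u x *: b x).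
Proof.
by case=> A0 AD AZ hb; apply: (big_ind A) => // x _; apply: AZ.
Qed.

Lemma is_lin0 (V W : lmodType K) (f : V -> W) : is_lin f -> f 0 = 0.
Proof.
by move=> hf; have := hf (-1) 0 0; rewrite scaler0 addr0 scaleN1r addNr.
Qed.

Lemma is_linD (V W : lmodType K) (f : V -> W) u v :
  is_lin f -> f (u + v) = f u + f v.
Proof. by move=> hf; have := hf 1 u v; rewrite !scale1r. Qed.

Lemma is_linZ (V W : lmodType K) (f : V -> W) c u :
  is_lin f -> f (c *: u) = c *: f u.
Proof. by move=> hf; have := hf c u 0; rewrite !addr0 is_lin0 // addr0. Qed.

Lemma is_lin_sum (V W : lmodType K) (f : V -> W) (T : finType) (b : T -> V) u :
  is_lin f -> f (\sum_(x : T) u x *: b x) = \sum_x u x *: f (b x).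
Proof.
move=> hf; rewrite (big_morph f (fun u v => is_linD u v hf) (is_lin0 hf)).
by apply: eq_bigr => x _; rewrite is_linZ.
Qed.

(** The coefficients of [b'] in terms of [b] form a matrix; freeness of [b'] makes its left kernel
    trivial, so its rank, at most the number of columns, is the number of rows. *)
Lemma free_fam_le (V : lmodType K) (T T' : finType) (b : T -> V) (b' : T' -> V) :
  (forall x, exists u : T -> K, b' x = \sum_y u y *: b y) -> free_fam b' ->
  (#|T'| <= #|T|)%N.
Proof.
move=> /choice_fun[C hC] fb.
pose M : 'M[K]_(#|T'|, #|T|) := \matrix_(i, j) C (enum_val i) (enum_val j).
suff /eqP <- : row_free M by exact: rank_leq_col.
apply: inj_row_free => v hv; apply/rowP => i; rewrite mxE.
have -> : v 0 i = (fun x => v 0 (enum_rank x)) (enum_val i) by rewrite /= enum_valK.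
apply: (fb (fun x => v 0 (enum_rank x))).
under eq_bigr => x _ do rewrite hC scaler_sumr.
rewrite exchange_big /= big1 // => y _.
under eq_bigr => x _ do rewrite scalerA.
rewrite -scaler_suml; have /rowP/(_ (enum_rank y)) := hv; rewrite !mxE => hy.
rewrite (_ : \sum_(i0 : T') _ = 0) ?scale0r // -[RHS]hy.
rewrite (reindex (@enum_val T' T')) /=; last by apply: onW_bij; apply: enum_val_bij.
by apply: eq_bigr => j _; rewrite !mxE enum_valK enum_rankK.
Qed.

Lemma has_dim_mem (V : lmodType K) (A : V -> Prop) (T : finType) (b : T -> V) x :
  (forall v, A v <-> exists u : T -> K, v = \sum_x u x *: b x) -> A (b x).
Proof.
move=> hA; apply/hA; exists (fun y => (y == x)%:R).
by rewrite (bigD1 x) //= eqxx scale1r big1 ?addr0 // => y /negPf->; rewrite scale0r.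
Qed.

Lemma has_dim_le (V : lmodType K) (A B : V -> Prop) d e :
  (forall v, A v -> B v) -> has_dim A d -> has_dim B e -> (d <= e)%N.
Proof.
move=> sAB [T [b [<- hA fb]]] [T' [b' [<- hB fb']]].
by apply: free_fam_le fb => x; apply/hB/sAB; apply: has_dim_mem hA.
Qed.

Lemma has_dim_ext (V : lmodType K) (A B : V -> Prop) d :
  (forall v, A v <-> B v) -> has_dim A d -> has_dim B d.
Proof.
move=> e [T [b [hT hA fb]]]; exists T, b; split=> // v.
by split=> [/e/hA//|/hA/e].
Qed.

Lemma dimvE (V : lmodType K) (A : V -> Prop) d : has_dim A d -> dimv A = d.
Proof.
move=> h; have h' : has_dim A (dimv A) by apply: epsilon_spec; exists d.
by apply/eqP; rewrite eqn_leq (has_dim_le _ h' h) ?(has_dim_le _ h h').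
Qed.

Lemma dimvP (V : lmodType K) (A : V -> Prop) : fin_dim A -> has_dim A (dimv A).
Proof. by case=> d h; rewrite (dimvE h). Qed.

Lemma dimv_ext (V : lmodType K) (A B : V -> Prop) :
  (forall v, A v <-> B v) -> dimv A = dimv B.
Proof.
move=> e; rewrite /dimv; congr (epsilon _ _).
apply: functional_extensionality => d; apply: propositional_extensionality.
by split; apply: has_dim_ext => v; split=> /e.
Qed.

(** A free family in [A] of the largest possible size spans [A], since a vector outside its span
    would extend it. *)
Lemma fin_dim_bound (V : lmodType K) (A : V -> Prop) d :
  subspace A ->
  (forall (T : finType) (b : T -> V), (forall x, A (b x)) -> free_fam b ->
     (#|T| <= d)%N) ->
  fin_dim A.
Proof.
move=> sA hd.
pose P k := exists (T : finType) (b : T -> V),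
  [/\ #|T| = k, forall x, A (b x) & free_fam b].
have P0 : P 0%N.
  exists 'I_0, (fun=> 0); split; first by rewrite card_ord.
    by case.
  by move=> u _ [].
have [|k [T [b [<- Ab fb]]] hk] := ex_max_prop P0 (d := d).
  by move=> k [T [b [<- Ab fb]]]; apply: hd Ab fb.
exists #|T|, T, b; split=> // v; split=> [Av|[u ->]]; last exact: subspace_sum.
apply: NNPP => nv.
pose b' (x : T + unit) : V := if x is inl y then b y else v.
suff : (#|{: T + unit}| <= #|T|)%N by rewrite card_sum card_unit addn1 ltnn.
apply: hk; exists ((T + unit)%type : finType), b'; split=> // [[]//|u].
rewrite big_sumType /= (big_pred1 tt); last by case.
move=> h; have uv : u (inr tt) = 0.
  apply: NNPP => /eqP nz; apply: nv.
  exists (fun x => - (u (inr tt))^-1 * u (inl x)).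
  under eq_bigr => x _ do rewrite -scalerA.
  rewrite -scaler_sumr; move/eqP: h; rewrite addr_eq0 => /eqP->.
  by rewrite scalerN scaleNr opprK scalerA mulVf // scale1r.
move: h; rewrite uv scale0r addr0 => h [x|[]//]; exact: (fb _ h).
Qed.

Lemma fin_dim_sub (V : lmodType K) (A B : V -> Prop) :
  subspace A -> (forall v, A v -> B v) -> fin_dim B -> fin_dim A.
Proof.
move=> sA sAB [d [T [b [_ hB _]]]]; apply: (fin_dim_bound (d := #|T|)) => //.
by move=> T' b' Ab' fb'; apply: free_fam_le fb' => x; apply/hB/sAB.
Qed.

(** A basis of the kernel and lifts of a basis of the image together form a basis of [A]. *)
Lemma has_dim_sum (V W : lmodType K) (A : V -> Prop) (f : V -> W) k r :
  subspace A -> is_lin f ->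
  has_dim (fun v => A v /\ f v = 0) k ->
  has_dim (fun w => exists2 v, A v & w = f v) r ->
  has_dim A (k + r).
Proof.
move=> sA lf [T1 [b1 [<- h1 f1]]] [T2 [b2 [<- h2 f2]]].
have /choice_fun[g hg] : forall x, exists v, A v /\ b2 x = f v.
  by move=> x; have [v] := has_dim_mem x h2; exists v.
pose b (x : T1 + T2) : V := match x with inl y => b1 y | inr y => g y end.
have Ab x : A (b x).
  by case: x => x /=; [case: (has_dim_mem x h1)|case: (hg x)].
have fsum u : f (\sum_x u x *: b x) = \sum_x u (inr x) *: b2 x.
  rewrite is_lin_sum // big_sumType /= big1 ?add0r => [|x _].
    by apply: eq_bigr => x _; case: (hg x) => _ ->.
  by case: (has_dim_mem x h1) => _ ->; rewrite scaler0.
exists ((T1 + T2)%type : finType), b; rewrite card_sum; split=> // [v|u hu].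
  split=> [Av|[u ->]]; last exact: subspace_sum.
  have /h2[u hu] : exists2 v', A v' & f v = f v' by exists v.
  have /h1[u' hu'] : A (v - \sum_x u x *: g x) /\ f (v - \sum_x u x *: g x) = 0.
    split.
      case: (sA) => _ AD AZ; apply: AD => //; rewrite -scaleN1r; apply: AZ.
      by apply: subspace_sum => // x; case: (hg x).
    rewrite is_linD // -scaleN1r is_linZ // is_lin_sum // hu scaleN1r.
    by apply/eqP; rewrite subr_eq0; apply/eqP/eq_bigr => x _; case: (hg x) => _ ->.
  exists (fun x => match x with inl y => u' y | inr y => u y end).
  by rewrite big_sumType /= -hu' subrK.
have u2 x : u (inr x) = 0.
  by apply: (f2 (fun x => u (inr x))); rewrite -fsum hu is_lin0.
have u1 x : u (inl x) = 0.
  apply: (f1 (fun x => u (inl x))); rewrite -[RHS]hu big_sumType /=.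
  by rewrite [X in _ = _ + X]big1 ?addr0 // => y _; rewrite u2 scale0r.
by case.
Qed.

Lemma ker_subspace (V W : lmodType K) (A : V -> Prop) (f : V -> W) :
  subspace A -> is_lin f -> subspace (fun v => A v /\ f v = 0).
Proof.
move=> [A0 AD AZ] lf; split=> [|u v [Au fu] [Av fv]|c v [Av fv]].
- by rewrite is_lin0.
- by rewrite is_linD // fu fv addr0; split=> //; apply: AD.
- by rewrite is_linZ // fv scaler0; split=> //; apply: AZ.
Qed.

Lemma im_subspace (V W : lmodType K) (A : V -> Prop) (f : V -> W) :
  subspace A -> is_lin f -> subspace (fun w => exists2 v, A v & w = f v).
Proof.
move=> [A0 AD AZ] lf; split=> [|_ _ [u Au ->] [v Av ->]|c _ [v Av ->]].
- by exists 0; rewrite ?is_lin0.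
- by exists (u + v); rewrite ?is_linD //; apply: AD.
- by exists (c *: v); rewrite ?is_linZ //; apply: AZ.
Qed.

Lemma rank_nullity (V W : lmodType K) (A : V -> Prop) (f : V -> W) :
  subspace A -> is_lin f -> fin_dim A ->
  [/\ fin_dim (fun v => A v /\ f v = 0%R),
      fin_dim (fun w => exists2 v, A v & w = f v)
    & dimv A = (dimv (fun v => A v /\ f v = 0%R)
                + dimv (fun w => exists2 v, A v & w = f v))%N].
Proof.
move=> sA lf fA.
have fk : fin_dim (fun v => A v /\ f v = 0%R).
  by apply: fin_dim_sub fA; [exact: ker_subspace|move=> v []].
have fi : fin_dim (fun w => exists2 v, A v & w = f v).
  case: fA => d [T [b [_ hA _]]].
  apply: (@fin_dim_bound _ _ #|T|); first exact: im_subspace.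
  move=> T' b' hb' fb'; have /choice_fun[g hg] : forall x, exists v, A v /\ b' x = f v.
    by move=> x; have [v] := hb' x; exists v.
  apply: (@free_fam_le _ _ _ b g) => [x|u hu]; first by apply/hA; case: (hg x).
  apply: fb'; under eq_bigr => x _ do rewrite (hg x).2.
  by rewrite -is_lin_sum // hu is_lin0.
by split=> //; apply/dimvE/(has_dim_sum sA lf); apply: dimvP.
Qed.

Lemma dimv_le (V : lmodType K) (A B : V -> Prop) :
  subspace A -> (forall v, A v -> B v) -> fin_dim B -> (dimv A <= dimv B)%N.
Proof.
move=> sA sAB fB; apply: (has_dim_le sAB); apply: dimvP => //.
exact: fin_dim_sub fB.
Qed.

Lemma dimv_inj_image (V W : lmodType K) (A : V -> Prop) (f : V -> W) :
  subspace A -> is_lin f -> fin_dim A -> (forall v, A v -> f v = 0 -> v = 0) ->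
  dimv (fun w => exists2 v, A v & w = f v) = dimv A.
Proof.
move=> sA lf fA hf; have [_ _ ->] := rank_nullity sA lf fA.
suff /dimvE -> : has_dim (fun v => A v /\ f v = 0) 0 by [].
exists 'I_0, (fun=> 0); split=> [|v|u _ []//]; first by rewrite card_ord.
split=> [[Av /(hf _ Av)->]|[u ->]]; first by exists (fun=> 0); rewrite big_ord0.
by rewrite big_ord0 is_lin0 //; case: sA.
Qed.

Lemma dimv_eq (V : lmodType K) (A B : V -> Prop) :
  subspace A -> (forall v, A v -> B v) -> fin_dim B -> dimv A = dimv B ->
  forall v, B v -> A v.
Proof.
move=> sA sAB fB eAB v Bv; apply: NNPP => nAv.
have [d [T [b [cT hA fb]]]] := fin_dim_sub sA sAB fB.
have [e [T' [b' [cT' hB fb']]]] := fB.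
have eA : dimv A = #|T| by apply: dimvE; exists T, b.
have eB : dimv B = #|T'| by apply: dimvE; exists T', b'.
pose c (x : T + unit) : V := if x is inl y then b y else v.
suff : (#|{: T + unit}| <= #|T'|)%N.
  by rewrite card_sum card_unit addn1 -eA eAB eB ltnn.
apply: (@free_fam_le _ _ _ b' c) => [[x|[]]|u].
- exact/hB/sAB/(has_dim_mem _ hA).
- exact/hB.
rewrite big_sumType /= (big_pred1 tt); last by case.
move=> h; have uv : u (inr tt) = 0.
  apply: NNPP => /eqP nz; apply: nAv; apply/hA.
  exists (fun x => - (u (inr tt))^-1 * u (inl x)).
  under eq_bigr => x _ do rewrite -scalerA.
  rewrite -scaler_sumr; move/eqP: h; rewrite addr_eq0 => /eqP->.
  by rewrite scalerN scaleNr opprK scalerA mulVf // scale1r.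
move: h; rewrite uv scale0r addr0 => h [x|[]//]; exact: (fb _ h).
Qed.
End Dimension.

(** * Dimension of sums and intersections *)

Section DimensionSum.
Variables (K : fieldType) (V : lmodType K).

Lemma add_subspace (A B : V -> Prop) : subspace A -> subspace B ->
  subspace (fun w => exists u v, [/\ A u, B v & w = u + v]).
Proof.
move=> [A0 AD AZ] [B0 BD BZ].
split=> [|_ _ [u [v [Au Bv ->]]] [u' [v' [Au' Bv' ->]]]|c _ [u [v [Au Bv ->]]]].
- by exists 0, 0; rewrite addr0.
- by exists (u + u'), (v + v'); rewrite addrACA; split; [exact: AD|exact: BD|].
- by exists (c *: u), (c *: v); rewrite scalerDr; split; [exact: AZ|exact: BZ|].
Qed.

(** Rank-nullity for the addition map on the product of [A] and [B]: its image is the sum, and its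
    kernel is the intersection embedded as the pairs (v, -v). *)
Lemma dimv_add (A B : V -> Prop) :
  subspace A -> subspace B -> fin_dim A -> fin_dim B ->
  fin_dim (fun w => exists u v, [/\ A u, B v & w = u + v]) /\
  (dimv (fun w => exists u v, [/\ A u, B v & w = (u + v)%R])
   + dimv (fun v => A v /\ B v) = dimv A + dimv B)%N.
Proof.
move=> sA sB fA fB; have [A0 AD AZ] := sA; have [B0 BD BZ] := sB.
pose P (w : V * V) := A w.1 /\ B w.2.
have sP : subspace P.
  split=> // [[u v] [u' v'] [/= ? ?] [/= ? ?]|c [u v] [/= ? ?]]; split=> /=; auto.
have l1 : is_lin (fst : V * V -> V) by [].
have l2 : is_lin (fun v : V => (0, v) : V * V).
  by move=> c u v; congr pair; rewrite /= scaler0 addr0.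
have l3 : is_lin (fun w : V * V => w.1 + w.2).
  by move=> c [u v] [u' v']; rewrite /= scalerDr addrACA.
have l4 : is_lin (fun v : V => (v, - v) : V * V).
  by move=> c u v; congr pair; rewrite /= opprD scalerN.
have dP : has_dim P (dimv B + dimv A).
  apply: (has_dim_sum sP l1).
    have h := dimv_inj_image sB l2 fB; rewrite -h; last by move=> v _ [].
    apply: (@has_dim_ext _ _ (fun w : V * V => exists2 v, B v & w = (0, v))).
      move=> [u v] /=; split=> [[v' Bv' [-> ->]]//|[[_ Bv] /= ->]].
      by exists v.
    apply: dimvP; have [_ + _] := rank_nullity sB l2 fB; exact.
  apply: has_dim_ext (dimvP fA) => v; split=> [Av|[[u w] [/= Au _] ->]//].
  by exists (v, 0).
have [fk fi e] := rank_nullity sP l3 (ex_intro _ _ dP).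
have eq1 w : (exists2 v, P v & w = v.1 + v.2) <->
             (exists u v, [/\ A u, B v & w = u + v]).
  split=> [[[u v] [/= ? ?] ->]|[u [v [? ? ->]]]]; first by exists u, v.
  by exists (u, v).
split; first by case: fi => d /(has_dim_ext eq1); exists d.
have sI : subspace (fun v => A v /\ B v).
  by split=> // [u v [? ?] [? ?]|c v [? ?]]; split; auto.
have fI : fin_dim (fun v => A v /\ B v) by apply: fin_dim_sub fA => // v [].
have h := dimv_inj_image sI l4 fI; rewrite -h; last by move=> v _ [].
have eq2 (w : V * V) : (P w /\ w.1 + w.2 = 0) <->
    (exists2 v, A v /\ B v & w = (v, - v)).
  case: w => u v; split=> [[[/= Au Bv] /eqP]|[w [Aw Bw] [-> ->]]] /=.
    rewrite addr_eq0 => /eqP eu; exists u; last by rewrite eu opprK.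
    by split=> //; rewrite eu -scaleN1r; apply: BZ.
  by rewrite subrr; split=> //; split=> //=; rewrite -scaleN1r; apply: BZ.
move: e; rewrite (dimvE dP) (dimv_ext eq1) (dimv_ext eq2). move=> e'.
by rewrite [RHS]addnC e' addnC.
Qed.
End DimensionSum.

(** * Monomials, graded pieces of ideals, and monomial ideals *)

Section Monomials.
Variables (K : fieldType) (n : nat).
Local Notation R := {mpoly K[n.+1]}.
Local Notation mon := 'X_{1..n.+1}.
Implicit Types (m : mon) (f g : R) (U : pred mon).

Definition mons t : seq mon :=
  [seq s2m (val u) | u : t.-tuple 'I_n.+1 <- enum (basis n.+1 t)].

Lemma mem_mons t m : (m \in mons t) = (mdeg m == t).
Proof. by rewrite basis_cover. Qed.

Lemma size_mons t : size (mons t) = 'C(t + n, n).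
Proof. by rewrite size_basis -bin_sub ?leq_addr // addKn. Qed.

Lemma uniq_mons t : uniq (mons t).
Proof. exact: uniq_basis. Qed.

(* The dimension of the degree t piece of R(-d). *)
Definition hs (d t : nat) : nat := if (d <= t)%N then 'C(t - d + n, n) else 0.

Lemma count_multiples (g : mon) t : count (fun m => (g <= m)%MM) (mons t) = hs (mdeg g) t.
Proof.
rewrite /hs; case: ifP => [h|h].
  rewrite -size_mons -(size_map (fun m => (m + g)%MM)) -size_filter.
  apply/perm_size/uniq_perm.
  - by rewrite filter_uniq // uniq_mons.
  - by rewrite map_inj_uniq ?uniq_mons // => x y; apply: addIm.
  move=> m; rewrite mem_filter mem_mons; apply/andP/mapP => [[gm /eqP dm]|[x hx ->]].
    exists (m - g)%MM; last by rewrite submK.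
    by rewrite mem_mons -dm -{2}(submK gm) mdegD addnK.
  move: hx; rewrite mem_mons lem_addl mdegD => /eqP->.
  by rewrite subnK.
apply/eqP; rewrite -leqn0 leqNgt -has_count; apply/hasP => -[m].
rewrite mem_mons => /eqP dm gm; move/negP: h; apply.
by rewrite -dm -(submK gm) mdegD leq_addl.
Qed.

Lemma has_dim_monomials (L : seq mon) :
  uniq L -> has_dim (fun f : R => {subset msupp f <= L}) (size L).
Proof.
move=> uL; pose b (i : 'I_(size L)) : R := 'X_[tnth (in_tuple L) i].
have cb u i : (\sum_j u j *: b j)@_(tnth (in_tuple L) i) = u i.
  rewrite raddf_sum /= (bigD1 i) //= mcoeffZ mcoeffX eqxx mulr1 big1 ?addr0 //.
  move=> j ij; rewrite mcoeffZ mcoeffX !(tnth_nth 0%MM) nth_uniq //.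
  by rewrite (inj_eq val_inj) (negPf ij) mulr0.
exists 'I_(size L), b; split=> [|f|u hu i]; first by rewrite card_ord.
  split=> [hf|[u ->] m].
    exists (fun i => f@_(tnth (in_tuple L) i)).
    rewrite -(big_tnth _ _ L xpredT (fun m => f@_m *: 'X_[m])).
    apply/mpolyP=> m; rewrite raddf_sum /=.
    have [mL|mL] := boolP (m \in L).
      rewrite (bigD1_seq m) //= mcoeffZ mcoeffX eqxx mulr1 big1 ?addr0 //.
      by move=> j /negPf jm; rewrite mcoeffZ mcoeffX jm mulr0.
    rewrite big_seq big1 => [|j jL]; last first.
      rewrite mcoeffZ mcoeffX; case: eqP => [e|]; last by rewrite mulr0.
      by rewrite e (negPf mL) in jL.
    by apply: memN_msupp_eq0; apply: contra mL => /hf.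
  apply: contraLR => mL; rewrite mcoeff_msupp negbK raddf_sum /= big1 // => i _.
  rewrite mcoeffZ mcoeffX; case: eqP => [e|]; last by rewrite mulr0.
  by rewrite -e mem_tnth in mL.
by rewrite -(cb u) hu mcoeff0.
Qed.

Definition hpart (I : R -> Prop) (t : nat) (f : R) := I f /\ f \is t.-homog.

Definition idim (I : R -> Prop) (t : nat) := dimv (hpart I t).

Lemma ideal0 (I : R -> Prop) : is_ideal I -> I 0.
Proof. by case. Qed.

Lemma idealD (I : R -> Prop) f g : is_ideal I -> I f -> I g -> I (f + g).
Proof. by case=> _ h _; apply: h. Qed.

Lemma idealM (I : R -> Prop) f g : is_ideal I -> I g -> I (f * g).
Proof. by case=> _ _ h; apply: h. Qed.

Lemma idealZ (I : R -> Prop) c f : is_ideal I -> I f -> I (c *: f).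
Proof. by move=> hI If; rewrite -mul_mpolyC; apply: idealM. Qed.

Lemma idealN (I : R -> Prop) f : is_ideal I -> I f -> I (- f).
Proof. by move=> hI If; rewrite -scaleN1r; apply: idealZ. Qed.

Lemma idealB (I : R -> Prop) f g : is_ideal I -> I f -> I g -> I (f - g).
Proof. by move=> hI If Ig; apply: idealD => //; apply: idealN. Qed.

Lemma ideal_sum (I : R -> Prop) (T : Type) (r : seq T) (P : pred T) (F : T -> R) :
  is_ideal I -> (forall x, P x -> I (F x)) -> I (\sum_(x <- r | P x) F x).
Proof.
by move=> hI h; apply: (big_ind I) => //; [exact: ideal0|move=> *; exact: idealD].
Qed.

Lemma ideal1 (I : R -> Prop) f : is_ideal I -> I 1 -> I f.
Proof. by move=> hI h; rewrite -[f]mulr1; apply: idealM. Qed.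

Lemma hpart_subspace (I : R -> Prop) t : is_ideal I -> subspace (hpart I t).
Proof.
move=> hI; split=> [|u v [? ?] [? ?]|c v [? ?]].
- by split; [exact: ideal0|exact: rpred0].
- by split; [exact: idealD|exact: rpredD].
- by split; [exact: idealZ|exact: rpredZ].
Qed.

Lemma has_dim_homog t : has_dim (fun f : R => f \is t.-homog) 'C(t + n, n).
Proof.
rewrite -size_mons; apply: has_dim_ext (has_dim_monomials (uniq_mons t)) => f.
split=> [h|/dhomogP h m /h /= <-]; last by rewrite mem_mons.
by apply/dhomogP => m /h; rewrite mem_mons => /eqP.
Qed.

Lemma fin_dim_hpart (I : R -> Prop) t : is_ideal I -> fin_dim (hpart I t).
Proof.
move=> hI; apply: fin_dim_sub (ex_intro _ _ (has_dim_homog t)).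
  exact: hpart_subspace.
by move=> v [].
Qed.

Lemma lin_mull f : is_lin (fun g : R => f * g).
Proof. by move=> c u v; rewrite mulrDr scalerAr. Qed.

Lemma idim_le (I : R -> Prop) t : is_ideal I -> (idim I t <= 'C(t + n, n))%N.
Proof.
move=> hI; rewrite -(dimvE (has_dim_homog t)); apply: dimv_le.
- exact: hpart_subspace.
- by move=> v [].
- by exists 'C(t + n, n); apply: has_dim_homog.
Qed.

(** Multiplication by the form [f] sends the degree e component of [g] to the degree d + e component
    of [f * g]. As [f] is a nonzero divisor, every component of [g] outside degree [t] vanishes. *)
Lemma mulr_homog f g d t : f != 0 -> f \is d.-homog -> f * g \is (d + t).-homog ->
  g \is t.-homog.
Proof.
move=> nz hf hfg; have [->|nzg] := eqVneq g 0; first exact: rpred0.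
pose c e := pihomog mdeg e g.
have key e : e != t -> c e = 0.
  move=> et; apply/eqP; apply/negPn/negP => nzc.
  have hfc : f * c e \is (d + e).-homog by apply: dhomogM => //; exact: pihomogP.
  have := @pihomog_partitionE _ _ mdeg _ g (leqnn _) => eg.
  have : pihomog mdeg (d + e) (f * g) = f * c e.
    rewrite eg mulr_sumr raddf_sum /=.
    have hj (j : nat) : pihomog mdeg (d + e) (f * pihomog mdeg j g) =
                if j == e then f * c e else 0.
      have hh : f * pihomog mdeg j g \is (d + j).-homog.
        by apply: dhomogM => //; exact: pihomogP.
      case: eqP => [je|/eqP je]; first by rewrite pihomog_dE // je.
      by rewrite (pihomog_ne0 _ hh) // eqn_add2l.
    have [le|ge] := ltnP e (msize g).
      rewrite (bigD1 (Ordinal le)) //= hj eqxx big1 ?addr0 // => j je.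
      by rewrite hj; case: eqP => // ej; case/eqP: je; apply: val_inj.
    rewrite big1 => [|j _]; last first.
      by rewrite hj; case: eqP => // ej; move: ge; rewrite -ej leqNgt ltn_ord.
    rewrite /c pihomogE big_seq_cond big_pred0 ?mulr0 // => m.
    apply/negP => /andP[/msize_mdeg_lt h /eqP em]; move: ge; rewrite leqNgt.
    by rewrite em in h; rewrite h.
  rewrite (pihomog_ne0 _ hfg) ?eqn_add2l 1?eq_sym // => /esym/eqP.
  by rewrite mulf_eq0 (negPf nz) (negPf nzc).
suff -> : g = c t by exact: pihomogP.
rewrite {1}(@pihomog_partitionE _ _ mdeg _ g (leqnn _)).
have [lt|ge] := ltnP t (msize g).
  rewrite (bigD1 (Ordinal lt)) //= big1 ?addr0 // => j jt.
  by apply: key; apply: contra jt => /eqP jt; apply/eqP/val_inj.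
rewrite big1 => [|j _]; last first.
  by apply: key; apply/eqP => jt; move: ge; rewrite -jt leqNgt ltn_ord.
rewrite /c pihomogE big_seq_cond big_pred0 // => m.
apply/negP => /andP[/msize_mdeg_lt h /eqP em]; move: ge; rewrite leqNgt.
by rewrite em in h; rewrite h.
Qed.

(** The linear span of the monomials in [U]; for an [upset] it is the monomial ideal with these
    monomials. *)
Definition mono U f := forall m, m \in msupp f -> U m.

Definition upset U := forall m m', U m -> U (m + m')%MM.

Lemma mono_ideal U : upset U -> is_ideal (mono U).
Proof.
move=> hU; split=> [m|f g hf hg m|f g hg m]; first by rewrite msupp0.
  by move/msuppD_le; rewrite mem_cat => /orP[/hf|/hg].
case/msuppM_le/allpairsP => -[m1 m2] [/= _ h2 ->].
by rewrite addmC; apply/hU/hg.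
Qed.

Lemma mcoeff_pihomog d f m : (pihomog mdeg d f)@_m = if mdeg m == d then f@_m else 0.
Proof.
have [h|h] := boolP (mdeg m == d); last first.
  by apply: (dhomog_nemf_coeff (pihomogP mdeg d f)).
rewrite pihomogE raddf_sum /= big_mkcond /=.
have [ms|ms] := boolP (m \in msupp f).
  rewrite (bigD1_seq m) ?msupp_uniq //= !h mcoeffZ mcoeffX eqxx mulr1 big1 ?addr0 //.
  by move=> j /negPf jm; case: ifP; rewrite ?mcoeff0 // mcoeffZ mcoeffX jm mulr0.
rewrite (memN_msupp_eq0 ms) big_seq big1 // => j jf; case: ifP => _; rewrite ?mcoeff0 //.
rewrite mcoeffZ mcoeffX; case: eqP => [e|]; last by rewrite mulr0.
by rewrite e (negPf ms) in jf.
Qed.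

Lemma mono_homogeneous U : homogeneous (mono U).
Proof.
move=> f d hf m; rewrite mcoeff_msupp mcoeff_pihomog.
by case: ifP => [_ h|_]; [apply: hf; rewrite mcoeff_msupp|rewrite eqxx].
Qed.

Lemma idim_mono U t : idim (mono U) t = count U (mons t).
Proof.
rewrite -size_filter; apply: dimvE.
apply: has_dim_ext (has_dim_monomials (filter_uniq U (uniq_mons t))) => f.
split=> [h|[h /dhomogP h'] m hm].
  split=> [m /h|]; first by rewrite mem_filter => /andP[].
  by apply/dhomogP => m /h; rewrite mem_filter mem_mons => /andP[_ /eqP].
by rewrite mem_filter mem_mons h // h' //= eqxx.
Qed.

Lemma mcoeff_XM m f m' : ('X_[m] * f)@_(m' + m) = f@_m'.
Proof. by rewrite mulrC addmC mcoeffMX. Qed.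

(** Multiplication by a monomial permutes no coefficients into each other, so its regularity modulo
    [mono U] can be tested on monomials. *)
Lemma mono_Xmul U m f :
  (forall m', U (m' + m)%MM -> U m') -> mono U ('X_[m] * f) -> mono U f.
Proof.
move=> h hf m' hm'; apply/h/hf.
by rewrite mcoeff_msupp mcoeff_XM -mcoeff_msupp.
Qed.

Lemma mono_X U m : mono U 'X_[m] <-> U m.
Proof.
split=> [h|h m' /mem_msuppXP <-//]; apply: h.
by rewrite msuppX inE.
Qed.

Lemma mono_add_principal U (i : 'I_n.+1) f :
  upset U ->
  add_principal (mono U) 'X_i f <-> mono (fun m => U m || (m i != 0%N)) f.
Proof.
move=> hU; split=> [[g [q [hg ->]]] m|hf].
  move/msuppD_le; rewrite mem_cat => /orP[/hg->//|].
  case/msuppM_le/allpairsP => -[m1 m2] [/= _ /mem_msuppXP <- ->].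
  by rewrite mnmDE mnm1E eqxx addn1 orbT.
exists (\sum_(m <- msupp f | U m) f@_m *: 'X_[m]).
exists (\sum_(m <- msupp f | ~~ U m) f@_m *: 'X_[(m - U_(i))]).
split.
  apply: ideal_sum; first exact: mono_ideal.
  move=> m Um; apply: (@idealZ (mono U)); first exact: mono_ideal.
  exact/mono_X.
rewrite {1}(mpolyE f) (bigID U) /=; congr (_ + _); rewrite mulr_suml.
rewrite big_seq_cond [RHS]big_seq_cond; apply: eq_bigr => m /andP[ms Um].
rewrite -scalerAl -mpolyXD submK //.
by rewrite lep1mP; have := hf _ ms; rewrite (negPf Um).
Qed.
End Monomials.

(** * Dickson's lemma, Hilbert's basis theorem, and Noetherian modules *)

Section Noetherian.
Variables (K : fieldType) (n : nat).
Local Notation R := {mpoly K[n.+1]}.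
Local Notation mon := 'X_{1..n.+1}.

(** Induction on the number [k] of coordinates in which domination is required. *)
Lemma dickson N (L : 'X_{1..N} -> Prop) :
  exists2 ms : seq 'X_{1..N}, forall m, m \in ms -> L m
    & forall m, L m -> exists2 m', m' \in ms & (m' <= m)%MM.
Proof.
suff h k : (k <= N)%N -> forall L : 'X_{1..N} -> Prop,
    exists2 ms : seq 'X_{1..N}, forall m, m \in ms -> L m
      & forall m, L m -> exists2 m', m' \in ms &
          forall i : 'I_N, (i < k)%N -> (m' i <= m i)%N.
  have [ms h1 h2] := h N (leqnn N) L.
  exists ms => // m /h2[m' ? hm']; exists m' => //.
  by apply/mnm_lepP => i; apply: hm'.
elim: k => [|k IH] hk {}L.
  have [[m Lm]|nL] := classic (exists m, L m).
    by exists [:: m] => [m'|m' _]; [rewrite inE => /eqP->|exists m; rewrite ?inE].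
  by exists [::] => // m Lm; case: nL; exists m.
have [ms h1 h2] := IH (ltnW hk) L.
(* Monomials whose new coordinate is at least [B] are dominated by the old list [ms]. The others lie
   in finitely many slices where that coordinate is a constant v < B, and each slice gets a list of
   its own. *)
pose ik := Ordinal hk; pose B := (\max_(x <- ms) (x : 'X_{1..N}) ik)%N.
have /choice_fun[mv hv] : forall v, exists ms : seq 'X_{1..N},
    (forall m, m \in ms -> L m /\ m ik = v) /\
    forall m, L m /\ m ik = v -> exists2 m', m' \in ms &
          forall i : 'I_N, (i < k)%N -> (m' i <= m i)%N.
  by move=> v; have [ms' ? ?] := IH (ltnW hk) (fun m => L m /\ m ik = v); exists ms'.
exists (ms ++ flatten [seq mv v | v <- iota 0 B]) => [m|m Lm].
  rewrite mem_cat => /orP[/h1//|/flattenP[s /mapP[v _ ->]]].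
  by case: (hv v) => + _ => h /h[].
have [hB|hB] := ltnP (m ik) B.
  have [_ /(_ m (conj Lm erefl))[m' m'in hm']] := hv (m ik).
  exists m' => [|i].
    rewrite mem_cat; apply/orP; right; apply/flattenP; exists (mv (m ik)) => //.
    by apply: map_f; rewrite mem_iota.
  rewrite ltnS leq_eqVlt => /orP[/eqP ei|]; last exact: hm'.
  have -> : i = ik by apply: val_inj.
  by have [/(_ _ m'in)[_ ->]] := hv (m ik).
have [m' m'in hm'] := h2 m Lm; exists m' => [|i]; first by rewrite mem_cat m'in.
rewrite ltnS leq_eqVlt => /orP[/eqP ei|]; last exact: hm'.
have -> : i = ik by apply: val_inj.
by apply: leq_trans hB; apply: (@leq_bigmax_seq _ ms xpredT (fun x : multinom N => x ik)).
Qed.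

Definition spanp k (g : 'I_k -> R) (f : R) := exists w : 'I_k -> R, f = \sum_i w i * g i.

Lemma spanp_ideal k (g : 'I_k -> R) : is_ideal (spanp g).
Proof.
split=> [|_ _ [w ->] [w' ->]|f _ [w ->]].
- by exists (fun=> 0); rewrite big1 // => i _; rewrite mul0r.
- exists (fun i => w i + w' i); rewrite -big_split /=.
  by apply: eq_bigr => i _; rewrite mulrDl.
- exists (fun i => f * w i); rewrite mulr_sumr.
  by apply: eq_bigr => i _; rewrite mulrA.
Qed.

Lemma mem_spanp k (g : 'I_k -> R) i : spanp g (g i).
Proof.
exists (fun j => (j == i)%:R); rewrite (bigD1 i) //= eqxx mul1r big1 ?addr0 //.
by move=> j /negPf->; rewrite mul0r.
Qed.

(** Dickson's lemma selects finitely many leading monomials; dividing by polynomials of [I] that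
    have them lowers the leading monomial, which is well-founded. *)
Lemma ideal_fg (I : R -> Prop) : is_ideal I ->
  exists k (g : 'I_k -> R), (forall i, I (g i)) /\ forall f, I f -> spanp g f.
Proof.
move=> hI; pose L (m : mon) := exists f, [/\ I f, f != 0 & mlead f = m].
have [ms h1 h2] := dickson L.
have /choice_fun[F hF] : forall m, exists f : R, L m -> [/\ I f, f != 0 & mlead f = m].
  move=> m; have [[f hf]|nL] := classic (L m); first by exists f.
  by exists 0.
pose g (i : 'I_(size ms)) := F (tnth (in_tuple ms) i).
exists (size ms), g; split=> [i|].
  by case: (hF (tnth (in_tuple ms) i)) => //; apply/h1/mem_tnth.
suff h m f : I f -> mlead f = m -> spanp g f by move=> f If; apply: h If erefl.
elim/(@ltmwf n.+1): m f => m IH f If mf.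
have sI := spanp_ideal g.
have [->|nz] := eqVneq f 0; first exact: ideal0.
have [m' m'in le] : exists2 m', m' \in ms & (m' <= m)%MM by apply: h2; exists f.
have [IF nzF mF] := hF m' (h1 _ m'in).
pose c := mleadc f / mleadc (F m').
have nzc : c != 0 by rewrite mulf_neq0 ?invr_eq0 ?mleadc_eq0.
pose h := (c *: 'X_[(m - m')]) * F m'.
have mh : mlead h = m.
  rewrite mleadM ?mleadZ ?mleadXm ?mF ?submK // scaler_eq0 (negPf nzc) /=.
  by rewrite -msize_poly_eq0 msizeX.
have ch : h@_m = f@_m.
  rewrite -{1}mh mleadcM_proper; last first.
    rewrite mleadZ // mleadXm mcoeffZ mcoeffX eqxx mulr1 mulf_neq0 //.
    by rewrite mleadc_eq0.
  by rewrite mleadZ // mleadXm mcoeffZ mcoeffX eqxx mulr1 /c mf divfK ?mleadc_eq0.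
have sh : spanp g h.
  apply: idealM => //.
  have /tnthP[i ->] : m' \in in_tuple ms by [].
  exact: mem_spanp.
rewrite -(subrK h f); apply: idealD => //.
have [->|nz'] := eqVneq (f - h) 0; first exact: ideal0.
apply: (IH (mlead (f - h))) => //; last first.
  by apply: idealB => //; apply: idealM.
rewrite lt_neqAle; apply/andP; split.
  apply: contra nz' => /eqP e; rewrite -mleadc_eq0 e mcoeffB ch subrr //.
apply: le_trans (mleadB_le _ _) _.
by rewrite mf mh joinxx.
Qed.

(** Without a maximal member, choice yields a strictly increasing chain in [F]. The union of the
    chain is finitely generated, so it is already reached at a finite index. *)
Lemma ideal_maximal (F : (R -> Prop) -> Prop) :
  (forall P, F P -> is_ideal P) -> (exists P, F P) ->
  exists2 P, F P & forall Q, F Q -> sub_ideal P Q -> sub_ideal Q P.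
Proof.
move=> hF [P0 FP0]; apply: NNPP => nmax.
have /choice_fun[nx hnx] : forall P : {P | F P}, exists Q : {P | F P},
    sub_ideal (sval P) (sval Q) /\ exists2 f, sval Q f & ~ sval P f.
  move=> [P FP]; apply: NNPP => nP; apply: nmax; exists P => // Q FQ sPQ f Qf.
  by apply: NNPP => nPf; apply: nP; exists (exist _ Q FQ); split=> //; exists f.
pose s i := sval (iter i nx (exist _ P0 FP0)).
have hs i : is_ideal (s i) by apply: hF; apply: svalP.
have ms i j : (i <= j)%N -> sub_ideal (s i) (s j).
  move/subnK <-; elim: (j - i)%N => [|k IH] f hf //.
  by apply: (hnx (iter (k + i) nx (exist _ P0 FP0))).1; apply: IH.
have hU : is_ideal (fun f => exists i, s i f).
  split=> [|f g [i fi] [j gj]|f g [i gi]]; first by exists 0%N; apply: ideal0.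
    exists (maxn i j); apply: idealD => //.
      by apply: (ms i) => //; apply: leq_maxl.
    by apply: (ms j) => //; apply: leq_maxr.
  by exists i; apply: idealM.
have [k [g [/choice_fun[ix hix] hg]]] := ideal_fg hU.
pose B := (\max_i ix i)%N.
have [_ [f sf]] := hnx (iter B nx (exist _ P0 FP0)); apply.
have [|w ->] := hg f; first by exists B.+1.
change (s B (\sum_i w i * g i)).
apply: ideal_sum => // i _; apply: idealM => //; apply: (ms (ix i)) => //.
exact: leq_bigmax.
Qed.

Definition submod m (N : 'rV[R]_m -> Prop) :=
  [/\ N 0, forall u v, N u -> N v -> N (u + v) & forall f v, N v -> N (f *: v)].

Lemma submod_sum m (N : 'rV[R]_m -> Prop) (T : finType) (w : T -> R) b :
  submod N -> (forall x, N (b x)) -> N (\sum_x w x *: b x).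
Proof. by case=> N0 ND NZ hb; apply: (big_ind N) => // x _; apply: NZ. Qed.

(** Filter [N] by the vectors whose first j coordinates vanish. The entries at coordinate j of the
    j-th step form an ideal; lifts of its generators, together with generators of the next step,
    generate the j-th step. *)
Lemma submod_fg m (N : 'rV[R]_m -> Prop) : submod N ->
  exists k (M : 'M[R]_(k, m)), forall v, N v <-> exists w, v = w *m M.
Proof.
move=> sN; have [N0 ND NZ] := sN.
pose Nj j v := N v /\ forall i : 'I_m, (i < j)%N -> v 0 i = 0.
have sNj j : submod (Nj j).
  split=> [|u v [Nu u0] [Nv v0]|f v [Nv v0]].
  - by split=> // i _; rewrite mxE.
  - by split=> [|i ij]; [exact: ND|rewrite mxE u0 // v0 // addr0].
  - by split=> [|i ij]; [exact: NZ|rewrite mxE v0 // mulr0].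
suff h d : (d <= m)%N -> exists k (M : 'M[R]_(k, m)),
    forall v, Nj (m - d)%N v <-> exists w, v = w *m M.
  have [k [M hM]] := h m (leqnn m); exists k, M => v; rewrite -hM subnn /Nj.
  by split=> [|[]].
elim: d => [|d IH] hd.
  exists 0%N, 0 => v; rewrite subn0; split=> [[_ hv]|[w ->]].
    by exists 0; apply/rowP => i; rewrite mulmx0 mxE hv.
  by rewrite mulmx0; case: (sNj m).
have [k [M hM]] := IH (ltnW hd).
have jm : (m - d.+1 < m)%N by lia.
pose j := Ordinal jm.
have hI : is_ideal (fun f => exists2 v, Nj j v & f = v 0 j).
  have [Nj0 NjD NjZ] := sNj j.
  split=> [|_ _ [u Nu ->] [v Nv ->]|f _ [v Nv ->]].
  - by exists 0 => //; rewrite mxE.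
  - by exists (u + v); [exact: NjD|rewrite mxE].
  - by exists (f *: v); [exact: NjZ|rewrite mxE].
have [k' [g [hg sg]]] := ideal_fg hI.
have /choice_fun[b hb] : forall i, exists v, Nj j v /\ g i = v 0 j.
  by move=> i; have [v] := hg i; exists v.
pose M' : 'M[R]_(k', m) := \matrix_i b i.
have wM' (w : 'rV_k') : w *m M' = \sum_i w 0 i *: b i.
  by rewrite mulmx_sum_row; apply: eq_bigr => i _; rewrite rowK.
exists (k + k')%N, (col_mx M M') => v; split=> [Nv|[w ->]].
  have [|w hw] := sg (v 0 j); first by exists v.
  pose w' : 'rV[R]_k' := \row_i w i.
  have : Nj (m - d)%N (v - w' *m M').
    have [_ NjD NjZ] := sNj j.
    have [Nu u0] : Nj j (v - w' *m M').
      apply: NjD => //; rewrite -scaleN1r; apply: NjZ; rewrite wM'.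
      by apply: submod_sum => // i; case: (hb i).
    split=> // i; rewrite (_ : (m - d = j.+1)%N); last by rewrite /=; lia.
    rewrite ltnS leq_eqVlt => /orP[/eqP ij|]; last exact: u0.
    have -> : i = j by apply: val_inj.
    rewrite !mxE hw; apply/eqP; rewrite subr_eq0; apply/eqP/eq_bigr => x _.
    by rewrite !mxE; case: (hb x) => _ ->.
  move/hM => [u hu]; exists (row_mx u w').
  by rewrite mul_row_col -hu subrK.
rewrite -[w]hsubmxK mul_row_col; have [_ NjD _] := sNj j; apply: NjD.
  have [|h1 h2] := (hM (lsubmx w *m M)).2; first by exists (lsubmx w).
  by split=> // i ij; apply: h2; move: ij => /=; lia.
by rewrite wM'; apply: submod_sum => // i; case: (hb i).
Qed.
End Noetherian.

(** * Graded submodules of free modules and minimal generators *)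

Section GradedSubmodules.
Variables (K : fieldType) (n : nat).
Local Notation R := {mpoly K[n.+1]}.
Local Notation mon := 'X_{1..n.+1}.

(* The degree e component of f in the twisted module R(-k). *)
Definition hcomp (k e : nat) (f : R) : R :=
  if (k <= e)%N then pihomog mdeg (e - k) f else 0.

Lemma mcoeff_hcomp k e f m :
  (hcomp k e f)@_m = if (mdeg m + k == e)%N then f@_m else 0.
Proof.
rewrite /hcomp; case: leqP => h; last first.
  by rewrite mcoeff0; case: eqP => // e1; move: h; rewrite -e1; lia.
by rewrite mcoeff_pihomog; congr (if _ then _ else _); apply/eqP/eqP; lia.
Qed.

Lemma hcomp_lin k e : is_lin (hcomp k e).
Proof.
move=> c f g; apply/mpolyP => m.
rewrite mcoeffD mcoeffZ !mcoeff_hcomp mcoeffD mcoeffZ.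
by case: ifP => // _; rewrite mulr0 addr0.
Qed.

Lemma hcomp_sum k e (T : finType) (F : T -> R) :
  hcomp k e (\sum_x F x) = \sum_x hcomp k e (F x).
Proof.
apply: (big_morph (hcomp k e)) => [f g|]; first exact: is_linD (hcomp_lin k e).
exact: is_lin0 (hcomp_lin k e).
Qed.

Lemma sum_hcomp k E f : (msize f + k <= E)%N -> f = \sum_(e < E) hcomp k e f.
Proof.
move=> hE; apply/mpolyP => m; rewrite raddf_sum /=.
under eq_bigr => e _ do rewrite mcoeff_hcomp.
have [ms|ms] := boolP (m \in msupp f); last first.
  by rewrite big1 ?(memN_msupp_eq0 ms) // => e _; rewrite if_same.
have lt : (mdeg m + k < E)%N by have := msize_mdeg_lt ms; lia.
rewrite (bigD1 (Ordinal lt)) //= eqxx big1 ?addr0 // => e /eqP he.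
by case: eqP => // he'; case: he; apply: val_inj.
Qed.

(** The hypothesis says that multiplication by [g] is a degree zero map from R(-k') to R(-k), so it
    commutes with taking components. *)
Lemma hcompM k k' e f g : (forall m, m \in msupp g -> (mdeg m + k)%N = k') ->
  hcomp k e (f * g) = hcomp k' e f * g.
Proof.
move=> hg; elim/mpolyind: f => [|c m f _ _ IH].
  by rewrite mul0r !(is_lin0 (hcomp_lin _ _)) mul0r.
rewrite mulrDl -scalerAl !(hcomp_lin _ _) IH mulrDl -scalerAl; congr (_ *: _ + _).
apply/mpolyP => m'; rewrite mcoeff_hcomp.
have [ms|ms] := boolP (m' \in msupp ('X_[m] * g)).
  have hm : (mdeg m' + k)%N = (mdeg m + k')%N.
    have [/= [m1 m2]] := allpairsP (msuppM_le ms).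
    move=> [/= /mem_msuppXP <- /hg <- ->]; rewrite mdegD; lia.
  rewrite hm /hcomp; case: leqP => le; last first.
    by rewrite mul0r mcoeff0; case: eqP => //; lia.
  rewrite pihomogX (_ : (mdeg m == e - k')%N = (mdeg m + k' == e)%N); last first.
    by apply/eqP/eqP; lia.
  by case: ifP => //; rewrite mul0r mcoeff0.
rewrite (memN_msupp_eq0 ms) if_same /hcomp; case: leqP => le; last first.
  by rewrite mul0r mcoeff0.
by rewrite pihomogX; case: ifP => _; rewrite ?(memN_msupp_eq0 ms) // mul0r mcoeff0.
Qed.

Definition rcomp m (cs : 'I_m -> nat) e (v : 'rV[R]_m) : 'rV[R]_m :=
  \row_j hcomp (cs j) e (v 0 j).

Definition graded m (cs : 'I_m -> nat) (N : 'rV[R]_m -> Prop) :=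
  forall v e, N v -> N (rcomp cs e v).

Definition homog_mx k m (cr : 'I_k -> nat) (cs : 'I_m -> nat) (M : 'M[R]_(k, m)) :=
  forall i j x, x \in msupp (M i j) -> (mdeg x + cs j)%N = cr i.

Lemma rcomp_mul k m (cr : 'I_k -> nat) (cs : 'I_m -> nat) M e (w : 'rV_k) :
  homog_mx cr cs M -> rcomp cs e (w *m M) = rcomp cr e w *m M.
Proof.
move=> hM; apply/rowP => j; rewrite !mxE hcomp_sum; apply: eq_bigr => i _.
by rewrite !mxE; apply: hcompM => x /hM.
Qed.

Lemma rcomp0 m (cs : 'I_m -> nat) e : rcomp cs e 0 = 0.
Proof. by apply/rowP => j; rewrite !mxE (is_lin0 (hcomp_lin _ _)). Qed.

Lemma sum_rcomp m (cs : 'I_m -> nat) E (v : 'rV[R]_m) :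
  (forall j, msize (v 0%R j) + cs j <= E)%N -> v = \sum_(e < E) rcomp cs e v.
Proof.
move=> hE; apply/rowP => j; rewrite summxE {1}(sum_hcomp (hE j)).
by apply: eq_bigr => e _; rewrite mxE.
Qed.

Definition hgens m (cs : 'I_m -> nat) (N : 'rV[R]_m -> Prop) k :=
  exists (cr : 'I_k -> nat) (M : 'M[R]_(k, m)), homog_mx cr cs M /\
    forall v, N v <-> exists w, v = w *m M.

Lemma ex_hgens m (cs : 'I_m -> nat) N : submod N -> graded cs N -> exists k, hgens cs N k.
Proof.
move=> sN gN; have [k [M hM]] := submod_fg sN.
have NM i : N (row i M) by apply/hM; exists (delta_mx 0 i); rewrite rowE.
(* [msize] exceeds the degree by one, so the components of degree less than [E] add up to each row;
   all of these components serve as homogeneous generators. *)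
pose E := (\max_i \max_j (msize (M i j) + cs j))%N.
pose T : finType := ('I_k * 'I_E)%type.
pose ev (x : 'I_#|T|) : T := enum_val x.
pose M' : 'M[R]_(#|T|, m) := \matrix_x rcomp cs (ev x).2 (row (ev x).1 M).
exists #|T|, (fun x => val (ev x).2), M'; split.
  move=> x j y; rewrite !mxE mcoeff_msupp mcoeff_hcomp.
  by case: ifP => [/eqP //|_]; rewrite eqxx.
move=> v; split=> [/hM[w ->]|[w ->]]; last first.
  rewrite mulmx_sum_row; apply: submod_sum => // x.
  by rewrite rowK; apply: gN.
exists (\row_x w 0 (ev x).1).
rewrite !mulmx_sum_row.
transitivity (\sum_(p : T) w 0 p.1 *: rcomp cs p.2 (row p.1 M)).
  rewrite -(pair_bigA _ (fun i (e : 'I_E) => w 0 i *: rcomp cs e (row i M))) /=.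
  apply: eq_bigr => i _.
  rewrite -scaler_sumr; congr (_ *: _); apply: sum_rcomp => j.
  rewrite mxE /E; apply: leq_trans (leq_bigmax i).
  exact: (@leq_bigmax _ (fun j => msize (M i j) + cs j)%N).
rewrite (reindex (@enum_val T T)) /=; last by apply: onW_bij; exact: enum_val_bij.
by apply: eq_bigr => x _; rewrite mxE rowK.
Qed.

(* A relation with a nonzero constant coefficient makes one generator redundant. *)
Lemma min_hgens_ker m (cs : 'I_m -> nat) N k (cr : 'I_k -> nat) (M : 'M[R]_(k, m)) :
  homog_mx cr cs M -> (forall v, N v <-> exists w, v = w *m M) ->
  (forall k', hgens cs N k' -> (k <= k')%N) ->
  forall w : 'rV_k, w *m M = 0 -> forall j, (w 0 j)@_0%MM = 0.
Proof.
case: k cr M => [|k] cr M hM hN kmin w hw j; first by case: j.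
apply/eqP/negPn/negP => nz.
(* In the component of degree [cr j] of the relation, the j-th entry is reduced to its constant
   coefficient, which is invertible. *)
pose w' := rcomp cr (cr j) w; pose a := (w 0 j)@_0%MM.
have hw' : w' *m M = 0 by rewrite -(rcomp_mul _ _ hM) hw rcomp0.
have w'j : w' 0 j = a%:MP.
  rewrite mxE; apply/mpolyP => x; rewrite mcoeff_hcomp mcoeffC.
  rewrite -{2}[cr j]add0n eqn_add2r mdeg_eq0.
  by case: eqP => [->|_]; rewrite ?mulr1 ?mulr0.
have rj : row j M = - \sum_(i < k) (a^-1)%:MP * w' 0 (lift j i) *: row (lift j i) M.
  move: hw'; rewrite mulmx_sum_row (bigD1_ord j) //= w'j => /eqP.
  rewrite addr_eq0 => /eqP h.
  rewrite -[LHS]scale1r -(mpolyC1 _ K) -(mulVf nz) mpolyCM -scalerA h scalerN.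
  by rewrite scaler_sumr; congr (- _); apply: eq_bigr => i _; rewrite scalerA.
suff : (k.+1 <= k)%N by rewrite ltnn.
apply: kmin; exists (cr \o lift j), (row' j M); split.
  by move=> i x y; rewrite mxE; apply: hM.
move=> v; rewrite hN; split=> [[u ->]|[u ->]].
  exists (\row_i (u 0 (lift j i) - u 0 j * ((a^-1)%:MP * w' 0 (lift j i)))).
  rewrite !mulmx_sum_row (bigD1_ord j) //= rj scalerN scaler_sumr -sumrN -big_split /=.
  apply: eq_bigr => i _; rewrite mxE scalerBl scalerA addrC; congr (_ *: _ - _ *: _);
    by apply/rowP => x; rewrite !mxE.
exists (\row_i oapp (u 0) 0 (unlift j i)).
rewrite !mulmx_sum_row (bigD1_ord j) //= mxE unlift_none scale0r add0r.
by apply: eq_bigr => i _; rewrite mxE liftK /=; congr (_ *: _); apply/rowP => x; rewrite !mxE.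
Qed.

(** The last conclusion is minimality in the form in which it is passed on: it puts the entries of
    the next map of the resolution into the irrelevant ideal. *)
Lemma graded_min_gens (cs : seq nat) (N : 'rV[R]_(size cs) -> Prop) :
  submod N -> graded (fun j => nth 0%N cs j) N ->
  exists (cr : seq nat) (M : 'M[R]_(size cr, size cs)),
    [/\ homog_mx (fun i => nth 0%N cr i) (fun j => nth 0%N cs j) M,
        forall v, N v <-> exists w, v = w *m M
      & forall w : 'rV_(size cr), w *m M = 0 -> forall j, (w 0 j)@_0%MM = 0].
Proof.
move=> sN gN; have [k [cr [M [hM hN]]] kmin] := ex_min_prop (ex_hgens sN gN).
have ker := min_hgens_ker hM hN kmin.
have [cr' [sz hcr]] : exists cr', size cr' = k /\ forall i : 'I_k, nth 0%N cr' i = cr i.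
  exists [seq cr i | i <- enum 'I_k]; split; first by rewrite size_map size_enum_ord.
  by move=> i; rewrite (nth_map i) ?size_enum_ord // nth_ord_enum.
subst k; exists cr', M; split=> // i j x; rewrite hcr; exact: hM.
Qed.

Lemma ker_submod k m (M : 'M[R]_(k, m)) : submod (fun w : 'rV_k => w *m M = 0).
Proof.
split=> [|u v hu hv|f v hv]; first by rewrite mul0mx.
  by rewrite mulmxDl hu hv addr0.
by rewrite -scalemxAl hv scaler0.
Qed.

Lemma ker_graded k m (cr : 'I_k -> nat) (cs : 'I_m -> nat) (M : 'M[R]_(k, m)) :
  homog_mx cr cs M -> graded cr (fun w : 'rV_k => w *m M = 0).
Proof. by move=> hM v e hv; rewrite -(rcomp_mul _ _ hM) hv rcomp0. Qed.
End GradedSubmodules.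

(** * The syzygy theorem and existence of minimal free resolutions *)

Section Syzygies.
Variables (K : fieldType) (n : nat).
Local Notation R := {mpoly K[n.+1]}.
Local Notation mon := 'X_{1..n.+1}.

Definition vset k (m : mon) := [exists x : 'I_n.+1, (x < k)%N && (m x != 0%N)].

(* The ideal (x_0, ..., x_(k-1)). *)
Definition var_ideal k : R -> Prop := mono (vset k).

Lemma vset_upset k : upset (vset k).
Proof.
move=> m m' /existsP[x /andP[xk nz]]; apply/existsP; exists x.
by rewrite xk mnmDE addn_eq0 negb_and nz.
Qed.

Lemma var_ideal_ideal k : is_ideal (var_ideal k).
Proof. exact/mono_ideal/vset_upset. Qed.

Lemma var_ideal0 f : var_ideal 0 f <-> f = 0.
Proof.
split=> [h|->]; last exact: ideal0 (var_ideal_ideal 0).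
apply/eqP/negPn/negP => nz; have /h/existsP[x] := mlead_supp nz.
by rewrite ltn0.
Qed.

Lemma vsetS k (hk : (k < n.+1)%N) m : vset k.+1 m = vset k m || (m (Ordinal hk) != 0%N).
Proof.
apply/existsP/orP => [[x]|[/existsP[x /andP[xk nz]]|nz]].
- rewrite ltnS leq_eqVlt => /andP[/orP[/eqP xk|xk] nz].
    by right; rewrite (_ : Ordinal hk = x) //; apply: val_inj.
  by left; apply/existsP; exists x; rewrite xk.
- by exists x; rewrite (ltn_trans xk).
- by exists (Ordinal hk); rewrite ltnSn.
Qed.

Lemma var_idealS k (hk : (k < n.+1)%N) f :
  var_ideal k.+1 f <-> exists g q, var_ideal k g /\ f = g + q * 'X_(Ordinal hk).
Proof.
rewrite -[exists g, _]/(add_principal (var_ideal k) 'X_(Ordinal hk) f).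
rewrite (mono_add_principal _ _ (vset_upset (k := k))).
by split=> h m /h; rewrite vsetS.
Qed.

Lemma var_ideal_nzd k (hk : (k < n.+1)%N) f :
  var_ideal k ('X_(Ordinal hk) * f) -> var_ideal k f.
Proof.
apply: mono_Xmul => m /existsP[x /andP[xk]]; rewrite mnmDE mnm1E.
rewrite (_ : (_ == x) = false) ?addn0 => [nz|].
  by apply/existsP; exists x; rewrite xk.
by apply/eqP => e; move: xk; rewrite -e /= ltnn.
Qed.

Lemma var_idealX k (x : 'I_n.+1) : var_ideal k 'X_x <-> (x < k)%N.
Proof.
rewrite /var_ideal mono_X; split=> [/existsP[y /andP[yk]]|xk].
  by rewrite mnm1E; case: (x =P y) => // ->.
by apply/existsP; exists x; rewrite xk mnm1E eqxx.
Qed.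

Lemma var_idealN f : var_ideal n.+1 f <-> f@_0%MM = 0.
Proof.
split=> [h|f0 m].
  apply/eqP/negPn/negP; rewrite -mcoeff_msupp => /h/existsP[x].
  by rewrite mnm0E andbF.
move=> ms; have nz : ~ m = 0%MM by move=> e; rewrite mcoeff_msupp e f0 eqxx in ms.
apply/existsP; apply: NNPP => h; apply: nz; apply/mnmP => x; rewrite mnm0E.
by apply/eqP/negPn/negP => nz; apply: h; exists x; rewrite ltn_ord.
Qed.

Lemma var_ideal_leq j k f : (j <= k)%N -> var_ideal j f -> var_ideal k f.
Proof.
move=> jk h m /h/existsP[x /andP[xk nz]].
by apply/existsP; exists x; rewrite (leq_trans xk).
Qed.

Definition row_in (I : R -> Prop) m (v : 'rV[R]_m) := forall j, I (v 0 j).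

Lemma row_in_mul I m p (v : 'rV[R]_m) (M : 'M[R]_(m, p)) :
  is_ideal I -> row_in I v -> row_in I (v *m M).
Proof.
move=> hI hv j; rewrite mxE; apply: ideal_sum => // i _.
by rewrite mulrC; apply: idealM.
Qed.

Lemma row_inD I m (u v : 'rV[R]_m) :
  is_ideal I -> row_in I u -> row_in I v -> row_in I (u + v).
Proof. by move=> hI hu hv j; rewrite mxE; apply: idealD. Qed.

Lemma row_inZ I m f (v : 'rV[R]_m) :
  is_ideal I -> row_in I v -> row_in I (f *: v).
Proof. by move=> hI hv j; rewrite mxE; apply: idealM. Qed.

(* Exactness at the p-th spot survives modulo x_0, ..., x_(i-1) as long as
   i <= p, each variable being regular on the image of the previous map. *)
Lemma exact_mod_vars (k : nat -> nat) (M : forall p, 'M[R]_(k p.+1, k p)) i :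
  (forall p (v : 'rV_(k p.+1)), v *m M p = 0 <-> exists w, v = w *m M p.+1) ->
  (i <= n.+1)%N -> forall p, (i <= p)%N -> forall v : 'rV_(k p.+1),
  row_in (var_ideal i) (v *m M p) -> exists w, row_in (var_ideal i) (v - w *m M p.+1).
Proof.
move=> ex; elim: i => [|i IH] hi p hp v hv.
  have /ex[w hw] : v *m M p = 0.
    by apply/rowP => j; rewrite [RHS]mxE; apply/var_ideal0/hv.
  by exists w => j; rewrite -hw subrr mxE; apply/var_ideal0.
case: p hp v hv => // p hp v hv; pose x : R := 'X_(Ordinal hi).
have hI := var_ideal_ideal i.
have /choice_fun[gq hgq] : forall j, exists gq : R * R,
    var_ideal i gq.1 /\ (v *m M p.+1) 0 j = gq.1 + gq.2 * x.
  by move=> j; have /(var_idealS hi)[g [q [h1 h2]]] := hv j; exists (g, q).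
pose u : 'rV[R]_(k p.+1) := \row_j (gq j).2.
pose h : 'rV[R]_(k p.+1) := \row_j (gq j).1.
have hin : row_in (var_ideal i) h by move=> j; rewrite mxE; case: (hgq j).
have e : v *m M p.+1 = x *: u + h.
  by apply/rowP => j; rewrite (hgq j).2 !mxE addrC mulrC.
have comp : v *m M p.+1 *m M p = 0 by apply/ex; exists v.
(* Composing two maps gives x u M_p = - h M_p, with entries in (x_0, ..., x_(i-1)). As x is regular
   modulo these variables, u is a cycle modulo them at spot p. *)
have [||w hw] := IH (ltnW hi) p _ u; first by [].
  move=> j; apply: (var_ideal_nzd (hk := hi)); rewrite -/x.
  have : (x *: u + h) *m M p = 0 by rewrite -e.
  rewrite mulmxDl -scalemxAl => /eqP; rewrite addr_eq0 => /eqP/rowP/(_ j).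
  rewrite mxE => ->; rewrite mxE; apply: (idealN hI).
  exact: (row_in_mul _ hI hin j).
(* Subtracting x w turns v into a cycle modulo one variable fewer, and the correction vanishes
   modulo x. *)
have [||w2 hw2] := IH (ltnW hi) p.+1 _ (v - x *: w); first exact: ltnW.
  rewrite mulmxBl e -scalemxAl addrAC -scalerBr; apply: row_inD => //.
  exact: row_inZ.
exists w2 => j.
have -> : v - w2 *m M p.+2 = (v - x *: w - w2 *m M p.+2) + x *: w.
  by rewrite addrAC subrK.
rewrite mxE; apply: (idealD (var_ideal_ideal i.+1)).
  by apply: var_ideal_leq (hw2 j); apply: leqnSn.
rewrite mxE mulrC; apply: (idealM _ (var_ideal_ideal i.+1)).
exact/var_idealX/ltnSn.
Qed.

(* At i = n + 1 everything modulo (x_0, ..., x_n) is constant, the maps vanish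
   by minimality, and exactness leaves no room for a nonzero free module. *)
Lemma hilbert_syzygy (k : nat -> nat) (M : forall p, 'M[R]_(k p.+1, k p)) :
  (forall p i j, (M p i j)@_0%MM = 0) ->
  (forall p (v : 'rV_(k p.+1)), v *m M p = 0 <-> exists w, v = w *m M p.+1) ->
  forall p, (n.+1 < p)%N -> k p = 0%N.
Proof.
move=> hM ex [|p] // hp; apply/eqP/negPn/negP; rewrite -lt0n => kp.
have hI := var_ideal_ideal n.+1.
have inM q (w : 'rV_(k q.+1)) : row_in (var_ideal n.+1) (w *m M q).
  move=> j; rewrite mxE; apply: (ideal_sum _ hI) => i _; apply: (idealM _ hI).
  exact/var_idealN.
(* The all-ones row is a cycle modulo (x_0, ..., x_n), hence congruent to a boundary; boundaries
   have entries in that ideal, and 1 would follow. *)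
have [w /(_ (Ordinal kp))] := @exact_mod_vars k M n.+1 ex (leqnn _) p hp (const_mx 1) (inM _ _).
rewrite !mxE => h; have := idealD hI h (inM _ w (Ordinal kp)).
by rewrite mxE subrK => /var_idealN/eqP; rewrite mcoeff1 eqxx oner_eq0.
Qed.

(** The degree zero component of [f] lies in [I]; a nonzero constant there would be a unit. *)
Lemma proper_const0 (I : R -> Prop) f :
  is_ideal I -> homogeneous I -> ~ I 1 -> I f -> f@_0%MM = 0.
Proof.
move=> hI gI nI If; apply/eqP/negPn/negP => nz; apply: nI.
have := gI _ 0%N If.
have -> : pihomog mdeg 0 f = (f@_0%MM)%:MP.
  by apply/mpolyP => m; rewrite mcoeff_pihomog mcoeffC mdeg_eq0; case: eqP => [->|_];
    rewrite ?mulr1 ?mulr0.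
by move=> /(idealM (f@_0%MM)^-1%:MP hI); rewrite -mpolyCM mulVf // mpolyC1.
Qed.

(** One map of a resolution under construction. As the matrix sizes vary with the step, the shifts
    are stored along with the matrix; the target of [next_state] is by definition the source of the
    previous state, so consecutive maps compose without casts. *)
Record rstate := RState
  { st_tgt : seq nat; st_src : seq nat; st_mx : 'M[R]_(size st_src, size st_tgt) }.

Definition good_state (s : rstate) :=
  homog_mx (fun i => nth 0%N (st_src s) i) (fun j => nth 0%N (st_tgt s) j) (st_mx s) /\
  forall w : 'rV_(size (st_src s)), w *m st_mx s = 0 -> forall j, (w 0 j)@_0%MM = 0.

Definition next_state (s : rstate) (p : {cr : seq nat & 'M[R]_(size cr, size (st_src s))}) :=
  RState (projT2 p).

(** Conditional on [good_state], so that a step exists from every state and can be chosen as a total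
    function. *)
Definition state_step s p := good_state s ->
  [/\ good_state (@next_state s p),
      forall v : 'rV_(size (st_src s)),
        v *m st_mx s = 0 <-> exists w, v = w *m projT2 p
    & forall i j, (projT2 p i j)@_0%MM = 0].

Lemma ex_state_step s : exists p, @state_step s p.
Proof.
have [gs|ngs] := classic (good_state s); last by exists (existT (fun cr : seq nat => 'M_(size cr, size (st_src s))) [::] (const_mx 0)).
have [hM hk] := gs; have [cr [M [h1 h2 h3]]] := graded_min_gens (ker_submod _) (ker_graded hM).
exists (existT _ cr M) => _; split=> //= i j.
have -> : M i j = ((delta_mx 0 i : 'rV_(size cr)) *m M) 0 j by rewrite -rowE mxE.
by apply: hk; apply/h2; exists (delta_mx 0 i).
Qed.

(** Iterated minimal generators of kernels. The first map has entries without constant term because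
    [I] is proper, the later ones because the preceding generators are minimal; the syzygy theorem
    bounds the length. *)
Lemma ex_resolution (I : R -> Prop) :
  is_ideal I -> homogeneous I -> ~ I 1 -> exists c, resolution_shifts I c.
Proof.
move=> hI gI nI; pose N0 (v : 'rV[R]_(size [:: 0%N])) := I (v 0 0).
have sN : submod N0.
  split=> [|u v hu hv|f v hv]; rewrite /N0 mxE; [exact: ideal0|exact: idealD|exact: idealM].
have gN : graded (fun j => nth 0%N [:: 0%N] j) N0.
  by move=> v e hv; rewrite /N0 mxE /hcomp /= subn0; apply: gI.
have [c1 [M0 [hM hN hk]]] := graded_min_gens sN gN.
pose st0 := RState M0.
pose nx s := next_state (proj1_sig (constructive_indefinite_description _ (ex_state_step s))).
pose st p := iter p nx st0.
have hst p : good_state (st p) by elim: p => [|p IH]; [|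
  rewrite /st /= /nx; case: constructive_indefinite_description => q /= /(_ IH)[]].
pose c p := st_tgt (st p).
pose M p : 'M[R]_(size (c p.+1), size (c p)) := st_mx (st p).
have exM p (v : 'rV_(size (c p.+1))) :
    v *m M p = 0 <-> exists w : 'rV_(size (c p.+2)), v = w *m M p.+1.
  move: v; rewrite /M /c /st /= -/(st p) /nx.
  by case: constructive_indefinite_description => q /= /(_ (hst p))[_ +] _.
have cM p i j : (M p i j)@_0%MM = 0.
  case: p i j => [|p].
    move=> i j; apply: (proper_const0 hI) => //.
    have : N0 (row i M0) by apply/hN; exists (delta_mx 0 i); rewrite rowE.
    by rewrite /N0 mxE [j]ord1.
  rewrite /M /c /st /= -/(st p) /nx.
  by case: constructive_indefinite_description => q /= /(_ (hst p))[_ _].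
exists c, M; split=> //.
- split=> // p hp; apply: size0nil.
  exact: (hilbert_syzygy (k := fun p => size (c p)) cM exM).
- by move=> p i j m; case: (hst p) => h _; apply: h.
- move=> f; have := hN (const_mx f); rewrite /N0 mxE => ->.
  by split=> -[w hw]; exists w.
Qed.
End Syzygies.

(** * The Hilbert function read off a resolution *)

Section ResolutionDimension.
Variables (K : fieldType) (n : nat).
Local Notation R := {mpoly K[n.+1]}.
Local Notation mon := 'X_{1..n.+1}.

Lemma has_dim_prod (V : lmodType K) s (A : 'I_s -> V -> Prop) (d : 'I_s -> nat) :
  (forall i, has_dim (A i) (d i)) ->
  has_dim (fun v : {ffun 'I_s -> V} => forall i, A i (v i)) (\sum_i d i).
Proof.
move=> hA.
have /choice_fun[Tb hTb] : forall i, exists Tb : {T : finType & T -> V},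
    [/\ #|projT1 Tb| = d i,
        forall v, A i v <-> exists u : projT1 Tb -> K, v = \sum_x u x *: projT2 Tb x
      & free_fam (projT2 Tb)].
  by move=> i; have [T [b h]] := hA i; exists (existT _ T b).
pose T i : finType := projT1 (Tb i); pose b i : T i -> V := projT2 (Tb i).
pose TT : finType := {i : 'I_s & T i}.
pose B (x : TT) : {ffun 'I_s -> V} := [ffun j => if j == tag x then b _ (tagged x) else 0].
have BE (u : TT -> K) j : (\sum_x u x *: B x) j = \sum_(x : T j) u (Tagged T x) *: b j x.
  rewrite sum_ffunE.
  transitivity (\sum_i \sum_(x : T i) (u (Tagged T x) *: B (Tagged T x)) j).
    by rewrite sig_big_dep /=; apply: eq_bigr => -[i x].
  rewrite (bigD1 j) //= [X in _ + X]big1 ?addr0; last first.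
    move=> i ij; apply: big1 => x _; rewrite !ffunE /= eq_sym (negPf ij) scaler0 //.
  by apply: eq_bigr => x _; rewrite !ffunE /= eqxx.
exists TT, B; split.
- rewrite card_tagged sumnE big_map big_enum /=.
  by apply: eq_bigr => i _; case: (hTb i).
- move=> v; split=> [hv|[u ->] i]; last first.
    rewrite BE; case: (hTb i) => _ h _; apply/h.
    by exists (fun x => u (Tagged T x)).
  have [u hu] : exists u : forall i, T i -> K, forall i, v i = \sum_x u i x *: b i x.
    apply: (@choice_dfun _ _ (fun i u => v i = \sum_x u x *: b i x)) => i.
    by case: (hTb i) => _ h _; apply/h.
  exists (fun x : TT => u (tag x) (tagged x)); apply/ffunP => j.
  by rewrite BE hu.
move=> u hu [i x]; case: (hTb i) => _ _ /(_ (fun x => u (Tagged T x))); apply.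
by rewrite -BE hu ffunE.
Qed.

(** The degree t piece of the sum of the R(-c). Finite functions replace row vectors because the
    dimension count needs a vector space over K, while rows over R are modules over R. *)
Definition free_piece (cs : seq nat) t (v : {ffun 'I_(size cs) -> R}) :=
  forall i m, m \in msupp (v i) -> (mdeg m + nth 0%N cs i)%N = t.

Lemma has_dim_free_piece (cs : seq nat) t :
  has_dim (@free_piece cs t) (\sum_(x <- cs) hs n x t).
Proof.
rewrite (big_nth 0%N) big_mkord.
apply: (@has_dim_prod R _
  (fun i f => forall m, m \in msupp f -> (mdeg m + nth 0%N cs i)%N = t)
  (fun i => hs n (nth 0%N cs i) t)) => i; set d := nth 0%N cs i; rewrite /hs; case: leqP => h.
  apply: has_dim_ext (has_dim_homog K n (t - d)) => f.
  split=> [/dhomogP hf m /hf /= ->|hf]; first by rewrite subnK.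
  by apply/dhomogP => m /hf <- /=; rewrite addnK.
exists 'I_0, (fun=> 0); split=> [|f|u _ []//]; first by rewrite card_ord.
split=> [hf|[u ->] m]; last by rewrite big_ord0 msupp0.
exists (fun=> 0); rewrite big_ord0; apply/eqP/negPn/negP => nz.
by have := hf _ (mlead_supp nz); lia.
Qed.

Lemma free_piece_subspace (cs : seq nat) t : subspace (@free_piece cs t).
Proof.
split=> [i m|u v hu hv i m|a v hv i m]; rewrite ffunE ?msupp0 //.
  by move/msuppD_le; rewrite mem_cat => /orP[/hu|/hv].
by move/msuppZ_le => /hv.
Qed.

Definition ffun_row k (v : {ffun 'I_k -> R}) : 'rV[R]_k := \row_i v i.
Definition row_ffun k (v : 'rV[R]_k) : {ffun 'I_k -> R} := [ffun i => v 0 i].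

Lemma ffun_rowK k : cancel (@ffun_row k) (@row_ffun k).
Proof. by move=> v; apply/ffunP => i; rewrite ffunE mxE. Qed.

Lemma row_ffunK k : cancel (@row_ffun k) (@ffun_row k).
Proof. by move=> v; apply/rowP => i; rewrite mxE ffunE. Qed.

Definition ffun_mul k m (M : 'M[R]_(k, m)) (v : {ffun 'I_k -> R}) : {ffun 'I_m -> R} :=
  row_ffun (ffun_row v *m M).

Lemma ffun_mul_lin k m (M : 'M[R]_(k, m)) : is_lin (ffun_mul M).
Proof.
move=> c u v; apply/ffunP => j; rewrite !ffunE !mxE scaler_sumr -big_split /=.
by apply: eq_bigr => i _; rewrite !mxE !ffunE mulrDl -scalerAl.
Qed.

Lemma rcomp_free_piece (cs : seq nat) t (w : 'rV[R]_(size cs)) :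
  free_piece t (row_ffun (rcomp (fun i => nth 0%N cs i) t w)).
Proof.
move=> i m; rewrite ffunE mxE mcoeff_msupp mcoeff_hcomp.
by case: ifP => [/eqP|]; rewrite ?eqxx.
Qed.

Lemma rcomp_id (cs : seq nat) t (v : 'rV[R]_(size cs)) :
  free_piece t (row_ffun v) -> rcomp (fun i => nth 0%N cs i) t v = v.
Proof.
move=> hv; apply/rowP => i; rewrite mxE; apply/mpolyP => m; rewrite mcoeff_hcomp.
case: ifP => // h; apply/esym/memN_msupp_eq0/negP => ms.
by have := hv i m; rewrite ffunE => /(_ ms)/eqP; rewrite h.
Qed.

(** The Euler characteristic of the degree t strand, written without subtraction. *)
Lemma resolution_dim (I : R -> Prop) (c : nat -> seq nat) t :
  is_ideal I -> resolution_shifts I c ->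
  (idim I t + \sum_(x <- even_shifts n c) hs n x t = \sum_(x <- odd_shifts n c) hs n x t)%N.
Proof.
move=> hI [M [[c0 cbig] hM _ hI0 ex]].
pose f p := (\sum_(x <- c p) hs n x t)%N.
pose F p := @free_piece (c p) t.
pose D p := ffun_mul (M p).
pose im p := dimv (fun w => exists2 v, F p.+1 v & w = D p v).
have hh p : homog_mx (fun i => nth 0%N (c p.+1) i) (fun j => nth 0%N (c p) j) (M p).
  by move=> i j m; apply: hM.
have DF p v : F p.+1 v -> F p (D p v).
  move=> hv; rewrite /D /ffun_mul -[ffun_row v](@rcomp_id _ t) ?ffun_rowK //.
  by rewrite -(rcomp_mul _ _ (hh p)); exact: rcomp_free_piece.
have dF p : dimv (F p) = f p by apply/dimvE/has_dim_free_piece.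
have fF p : fin_dim (F p) by exists (f p); apply: has_dim_free_piece.
have sF p : subspace (F p) by apply: free_piece_subspace.
have fS p : f p.+1 = (im p.+1 + im p)%N.
  have [_ _ e] := rank_nullity (sF p.+1) (ffun_mul_lin (M p)) (fF p.+1).
  rewrite -dF e; congr (_ + _)%N; apply: dimv_ext => v; split.
    move=> [Fv Dv]; have /ex[w hw] : ffun_row v *m M p = 0.
      by rewrite -[LHS]row_ffunK -/(ffun_mul _ _) Dv; apply/rowP => i; rewrite mxE ffunE mxE.
    exists (row_ffun (rcomp (fun i => nth 0%N (c p.+2) i) t w)).
      exact: rcomp_free_piece.
    rewrite /D /ffun_mul row_ffunK -(rcomp_mul _ _ (hh p.+1)) -hw.
    by rewrite rcomp_id ffun_rowK.
  move=> [w Fw ->]; split; first exact: DF.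
  rewrite /D /ffun_mul row_ffunK (_ : _ *m M p = 0); last by apply/ex; eexists.
  by apply/ffunP => i; rewrite !ffunE mxE.
have im0 : im 0%N = idim I t.
  have i0 : 'I_(size (c 0%N)) by rewrite c0; exact: ord0.
  have hi (i : 'I_(size (c 0%N))) : i = i0.
    by apply: val_inj; move: i i0; rewrite c0 => -[[]//] ? [[]//].
  have li : is_lin (fun v : {ffun 'I_(size (c 0%N)) -> R} => v i0).
    by move=> a u v; rewrite !ffunE.
  have sD := im_subspace (sF 1%N) (ffun_mul_lin (M 0%N)).
  have [_ fD _] := rank_nullity (sF 1%N) (ffun_mul_lin (M 0%N)) (fF 1%N).
  rewrite /im -(dimv_inj_image sD li fD); last first.
    by move=> v _ v0; apply/ffunP => i; rewrite (hi i) v0 ffunE.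
  have n0 (i : 'I_(size (c 0%N))) : nth 0%N (c 0%N) i = 0%N.
    by move: i; rewrite c0 => -[[]//].
  apply: dimv_ext => g; split=> [[_ [v Fv ->] ->]|[Ig hg]].
    split.
      apply/hI0; exists (ffun_row v); apply/rowP => i.
      by rewrite ffunE !mxE (hi i).
    apply/dhomogP => m /(DF _ _ Fv); rewrite n0 addn0 => h; exact: h.
  have [w hw] := (hI0 g).1 Ig.
  pose w' := rcomp (fun i => nth 0%N (c 1%N) i) t w.
  exists (D 0%N (row_ffun w')).
    by exists (row_ffun w') => //; apply: rcomp_free_piece.
  rewrite /D /ffun_mul row_ffunK -(rcomp_mul _ _ (hh 0%N)) hw ffunE !mxE n0.
  by rewrite /hcomp /= subn0 pihomog_dE.
have imn : im n.+1 = 0%N.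
  by have := fS n.+1; rewrite /f cbig // big_nil => /esym/eqP; rewrite addn_eq0 => /andP[_ /eqP].
(* The Euler characteristic truncated after m modules: the image of the m-th map remains as an error
   term, on a side that depends on the parity of m. *)
have key m : (im 0%N + \sum_(1 <= p < m.+1) (if ~~ odd p then f p else 0)
     + (if odd m then im m else 0) =
   \sum_(1 <= p < m.+1) (if odd p then f p else 0) + (if odd m then 0 else im m))%N.
  elim: m => [|m IH]; first by rewrite !big_geq //= !addn0.
  rewrite [in LHS]big_nat_recr //= [in RHS]big_nat_recr //= fS.
  by case: (odd m) IH => /=; lia.
have := key n.+1; rewrite imn !if_same !addn0 im0.
rewrite /even_shifts /odd_shifts !big_flatten !big_map !big_filter.
by rewrite -!big_mkcond.
Qed.
End ResolutionDimension.

(** * Multisets of shifts and their generating series *)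

Section ShiftMultisets.
Local Open Scope nat_scope.

(** Summation multiplies the series z^x / (1 - z)^(k+1) by 1 / (1 - z). *)
Lemma hsS k x t : \sum_(u < t.+1) hs k x u = hs k.+1 x t.
Proof.
elim: t => [|t IH].
  rewrite big_ord1 /hs; case: x => [|x] //=.
  by rewrite subn0 !add0n !binn.
rewrite big_ord_recr /= IH /hs.
have [xt|xt] := leqP x t.
  by rewrite (leqW xt) (subSn xt) !addSn !addnS [in RHS]binS.
case: leqP => [h|h] //; have -> : x = t.+1 by lia.
by rewrite subnn !add0n !binn.
Qed.

(** The functions [hs n x] are triangular: they vanish before degree x and equal 1 at x. The bound
    [T] allows comparing shifts when the series agree in low degrees only. *)
Lemma eq_hs_count n T (A B : seq nat) :
  (forall t, t <= T -> \sum_(x <- A) hs n x t = \sum_(x <- B) hs n x t) ->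
  forall k, k <= T -> count_mem k A = count_mem k B.
Proof.
move=> h k; elim/ltn_ind: k => k IH kT.
have split_sum (S : seq nat) :
    \sum_(x <- S) hs n x k = \sum_(x <- S | x < k) hs n x k + count_mem k S.
  rewrite (bigID (fun x => x < k)) /=; congr (_ + _).
  rewrite -sum1_count [RHS]big_mkcond [LHS]big_mkcond /=.
  apply: eq_bigr => x _; rewrite /hs; case: ltngtP => //= ->.
  by rewrite subnn add0n binn.
have := h k kT; rewrite !split_sum -!(big_filter _ (fun x => x < k)).
rewrite (perm_big (filter (fun x => x < k) B)) /=; first by move/addnI.
apply/allP => x _ /=; apply/eqP; rewrite !count_filter.
have [xk|xk] := ltnP x k.
  by rewrite !(eq_count (a2 := pred1 x)) ?IH // ?(leq_trans (ltnW xk)) // => y /=; case: eqP => // ->.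
by rewrite !(eq_count (a2 := pred0)) ?count_pred0 // => y /=; case: eqP => // ->;
  rewrite ltnNge xk.
Qed.

Lemma eq_hs_perm n (A B : seq nat) :
  (forall t, \sum_(x <- A) hs n x t = \sum_(x <- B) hs n x t) -> perm_eq A B.
Proof.
by move=> h; apply/allP => k _ /=; rewrite (@eq_hs_count n k A B).
Qed.

Lemma count_mset_diff x (u v : seq nat) :
  count_mem x (mset_diff u v) = count_mem x u - count_mem x v.
Proof.
rewrite /mset_diff; elim: v u => [|y v IH] u /=; first by rewrite subn0.
rewrite IH; have [yu|yu] := boolP (y \in u).
  have /permP/(_ (pred1 x)) /= -> := perm_to_rem yu.
  by rewrite addnC subnDA [(_ + (y == x))%N]addnC addKn.
rewrite rem_id //; case: (eqVneq y x) => [e|] //.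
by move: yu; rewrite e => /count_memPn ->; rewrite !sub0n.
Qed.

Lemma sort_geq_perm (u v : seq nat) : perm_eq u v -> sort geq u = sort geq v.
Proof.
by move/perm_sortP; apply=> [x y|y x z|x y]; rewrite /geq /=; lia.
Qed.

(** Equality of series makes the even shifts with [r] a rearrangement of the odd shifts with [s]. As
    [s] and [r] are disjoint, they are what cancellation leaves, for whichever resolution is
    chosen. *)
Lemma reduced_shifts n (a : nat -> nat) (c : nat -> seq nat) (s r : seq nat) :
  (forall t, a t + \sum_(x <- even_shifts n c) hs n x t = \sum_(x <- odd_shifts n c) hs n x t) ->
  (forall t, a t + \sum_(x <- s) hs n x t = \sum_(x <- r) hs n x t) ->
  (forall x, x \in s -> x \notin r) ->
  reduced_s n c = sort geq s /\ reduced_r n c = sort geq r.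
Proof.
rewrite /reduced_s /reduced_r; move: (even_shifts n c) (odd_shifts n c) => E O h1 h2 dis.
have /permP hp : perm_eq (E ++ r) (O ++ s).
  apply: (@eq_hs_perm n) => t; rewrite !big_cat /=.
  by have := h1 t; have := h2 t; lia.
have hd x : count_mem x s = 0 \/ count_mem x r = 0.
  by have [/dis/count_memPn|/count_memPn] := boolP (x \in s); auto.
have hx x : (count_mem x E + count_mem x r = count_mem x O + count_mem x s)%N.
  by have := hp (pred1 x); rewrite !count_cat.
have e x : (count_mem x E - count_mem x O)%N = count_mem x s /\
    (count_mem x O - count_mem x E)%N = count_mem x r.
  by case: (hd x) (hx x) => ->; lia.
by split; apply: sort_geq_perm; apply/allP => x _ /=; apply/eqP;
  rewrite count_mset_diff; case: (e x).
Qed.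

Lemma bin_upper t k : 'C(t + k, k) <= t.+1 ^ k.
Proof.
elim: k => [|k IH]; first by rewrite bin0.
have := mul_bin_diag (t + k.+1) k; rewrite addnS /= => e.
rewrite -(@leq_pmul2l k.+1) // -e expnS mulnA.
by apply: leq_mul => //; nia.
Qed.

Lemma bin_lower t k : t.+1 ^ k <= k`! * 'C(t + k, k).
Proof.
elim: k => [|k IH]; first by rewrite bin0.
have := mul_bin_diag (t + k.+1) k; rewrite addnS /= => e.
rewrite factS [(_ * k`!)%N]mulnC -mulnA -e expnS mulnCA.
by apply: leq_mul => //; rewrite ltnS leq_addr.
Qed.

Lemma bin_not_small n C D : exists t, C * 'C(t + n, n) + D * t.+1 ^ n < 'C(t + n.+1, n.+1).
Proof.
(* The leading coefficient of the right-hand side is 1 / (n+1)!, so at this t the left-hand side, at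
   most (C + D) (t+1)^n, falls short. *)
exists (n.+1`! * (C + D)); set t := (X in 'C(X + _, _)).
rewrite ltnNge; apply/negP => h.
have h1 := bin_lower t n.+1; have h2 := bin_upper t n.
have : t.+1 ^ n.+1 <= n.+1`! * (C + D) * t.+1 ^ n.
  apply: leq_trans h1 _; rewrite -mulnA leq_mul2l; apply/orP; right.
  apply: leq_trans h _; rewrite mulnDl leq_add2r leq_mul2l h2 orbT //.
by rewrite expnS leq_pmul2r ?expn_gt0 // -/t ltnn.
Qed.

Lemma hs_big x t : x <= t -> hs 0 x t = 1 /\ hs 1 x t = t.+1 - x.
Proof. by move=> h; rewrite /hs h bin0 bin1; split=> //; lia. Qed.

Lemma sum_hs_big (P : seq nat) t : (forall x, x \in P -> x <= t) ->
  \sum_(x <- P) hs 1 x t + \sum_(x <- P) x = size P * t.+1.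
Proof.
elim: P => [|x P IH] h; first by rewrite !big_nil.
rewrite !big_cons (hs_big (h x _)).2 ?mem_head //= mulSn -IH; last first.
  by move=> y yP; apply: h; rewrite inE yP orbT.
by have := h x (mem_head _ _); lia.
Qed.

Local Open Scope ring_scope.

Lemma Posz_sum (T : Type) (r : seq T) (P : pred T) (F : T -> nat) :
  (\sum_(x <- r | P x) F x)%N%:Z = \sum_(x <- r | P x) (F x)%:Z.
Proof. exact: (big_morph Posz PoszD). Qed.

(* In terms of E = sum of z^x over P minus sum of z^y over Q, the hypotheses bound
   the coefficients of E / (1 - z)^(n + 2) by a polynomial of degree n - 1, which
   forces (1 - z)^2 to divide E. *)
Lemma balanced_shifts n (P Q : seq nat) C :
  (0 < n)%N ->
  (forall t, \sum_(x <- Q) hs n.+1 x t <= \sum_(x <- P) hs n.+1 x t)%N ->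
  (forall t, \sum_(x <- P) hs n.+1 x t <= \sum_(x <- Q) hs n.+1 x t + C * t.+1 ^ n.-1)%N ->
  size P = size Q /\ (\sum_(x <- P) x = \sum_(x <- Q) x)%N.
Proof.
case: n => // n _ h1 h2.
(* The coefficient of z^t in the polynomial E over (1 - z)^(k+1). *)
pose D k t : int := (\sum_(x <- P) hs k x t)%N%:Z - (\sum_(x <- Q) hs k x t)%N%:Z.
have DS k t : \sum_(u < t.+1) D k u = D k.+1 t.
  have hS (S : seq nat) : (\sum_(u < t.+1) \sum_(x <- S) hs k x u =
      \sum_(x <- S) hs k.+1 x t)%N.
    by rewrite exchange_big /=; apply: eq_bigr => x _; exact: hsS.
  by rewrite /D sumrB -!Posz_sum !hS.
pose K := (\max_(x <- P ++ Q) x)%N.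
have hK x : x \in P ++ Q -> (x <= K)%N.
  by move=> xPQ; apply: (@leq_bigmax_seq _ _ xpredT id).
(* Beyond all shifts [D 1] is affine in t; the claim is that both of its coefficients vanish.
   Otherwise it is eventually at least 1 up to a sign [eps]. *)
have D1 t : (K <= t)%N -> D 1%N t =
    ((size P)%:Z - (size Q)%:Z) * t.+1%:Z - ((\sum_(x <- P) x)%N%:Z - (\sum_(x <- Q) x)%N%:Z).
  move=> Kt.
  have hP : forall x, x \in P -> (x <= t)%N.
    by move=> x xP; apply: leq_trans Kt; apply: hK; rewrite mem_cat xP.
  have hQ : forall x, x \in Q -> (x <= t)%N.
    by move=> x xQ; apply: leq_trans Kt; apply: hK; rewrite mem_cat xQ orbT.
  by rewrite /D; have := sum_hs_big hP; have := sum_hs_big hQ; lia.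
apply: NNPP => unb.
have [eps [K' [heps hD1]]] : exists (eps : int) K', (eps = 1 \/ eps = -1) /\
    forall t, (K' <= t)%N -> 1 <= eps * D 1%N t.
  set a := (size P)%:Z - (size Q)%:Z in D1.
  set b := (\sum_(x <- P) x)%N%:Z - (\sum_(x <- Q) x)%N%:Z in D1.
  have ab : a <> 0 \/ b <> 0.
    by apply: NNPP => h; apply: unb; rewrite /a /b in h; split; lia.
  pose K' := (K + `|b|)%N.
  have hK' t : (K' <= t)%N -> (K <= t)%N /\ (`|b| <= t)%N by rewrite /K'; lia.
  have [a0|[a0|a0]] : (0 < a) \/ (a < 0) \/ (a = 0) by lia.
  - by exists 1, K'; split; [auto|]; move=> t /hK'[/D1 -> hb]; nia.
  - by exists (-1), K'; split; [auto|]; move=> t /hK'[/D1 -> hb]; nia.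
  - have [b0|b0] : (0 < b) \/ (b < 0) by lia.
      by exists (-1), K'; split; [auto|]; move=> t /hK'[/D1 -> hb]; rewrite a0; lia.
    by exists 1, K'; split; [auto|]; move=> t /hK'[/D1 -> hb]; rewrite a0; lia.
pose E := (\sum_(u < K') (1 + `|D 1%N u|))%N.
(* The number [E] absorbs the values of [D 1] before [K']. Summing [eps * D 1 >= 1] repeatedly then
   yields growth of degree k + 1, against the assumed bound when k = n. *)
have hE k t : (hs k.+1 0 t)%:Z - E%:Z * (hs k 0 t)%:Z <= eps * D k.+2 t.
  elim: k t => [|k IH] t.
    have [-> ->] := @hs_big 0%N t (leq0n t); rewrite subn0 mulr1 -DS mulr_sumr.
    pose g u := (if (u < K')%N then (1 + `|D 1%N u|) else 0)%N.
    have step (u : nat) : 1 - (g u)%:Z <= eps * D 1%N u.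
      rewrite /g.
      case: ltnP => hu; last by rewrite subr0; exact: hD1.
      by case: heps => ->; lia.
    apply: (@le_trans _ _ (\sum_(u < t.+1) (1 - (g u)%:Z))); last first.
      by apply: ler_sum => u _; exact: step.
    rewrite sumrB sumr_const card_ord natz lerD2l lerN2 -Posz_sum lez_nat.
    rewrite (big_ord_widen _ g (leq_maxl t.+1 K')) /E.
    rewrite (big_ord_widen _ (fun u => (1 + `|D 1%N u|)%N) (leq_maxr t.+1 K')).
    rewrite big_mkcond [X in (_ <= X)%N]big_mkcond; apply: leq_sum => u _ /=.
    by rewrite /g; case: ifP; case: ifP.
  rewrite -DS mulr_sumr; apply: (@le_trans _ _ (\sum_(u < t.+1) ((hs k.+1 0 u)%:Z - E%:Z * (hs k 0 u)%:Z)));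
    last by apply: ler_sum => u _; exact: IH.
  by rewrite sumrB -mulr_sumr -!Posz_sum !hsS.
have [t ht] := bin_not_small n E C.
have := hE n t; have := h1 t; have := h2 t; rewrite /D /hs !subn0 /=.
by case: heps => ->; lia.
Qed.
End ShiftMultisets.

(** * Growth of quotients as a substitute for dimension theory *)

Section Growth.
Variables (K : fieldType) (n : nat).
Local Notation R := {mpoly K[n.+1]}.
Local Notation mon := 'X_{1..n.+1}.
Implicit Types (f g h : R) (I J P A B : R -> Prop).

Definition mulI f I : R -> Prop := fun h => exists2 g, I g & h = f * g.
Definition addI A B : R -> Prop := fun h => exists u v, [/\ A u, B v & h = u + v].
Definition fullI : R -> Prop := fun=> True.

Lemma fullI_ideal : is_ideal fullI. Proof. by []. Qed.

Lemma fullI_homogeneous : homogeneous fullI. Proof. by []. Qed.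

Lemma mulI_ideal f I : is_ideal I -> is_ideal (mulI f I).
Proof.
move=> hI; split=> [|_ _ [u Iu ->] [v Iv ->]|g _ [v Iv ->]].
- by exists 0; rewrite ?mulr0 //; exact: ideal0.
- by exists (u + v); [exact: idealD|rewrite mulrDr].
- by exists (g * v); [exact: idealM|rewrite mulrCA].
Qed.

Lemma addI_ideal A B : is_ideal A -> is_ideal B -> is_ideal (addI A B).
Proof.
move=> hA hB; split=> [|_ _ [u [v [Au Bv ->]]] [u' [v' [Au' Bv' ->]]]|g _ [u [v [Au Bv ->]]]].
- by exists 0, 0; rewrite addr0; split=> //; exact: ideal0.
- by exists (u + u'), (v + v'); rewrite addrACA; split=> //; exact: idealD.
- by exists (g * u), (g * v); rewrite mulrDr; split=> //; exact: idealM.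
Qed.

Lemma pihomogM d e f g :
  f \is d.-homog -> pihomog mdeg (d + e) (f * g) = f * pihomog mdeg e g.
Proof.
move=> hf; have := @hcompM K n 0 d (d + e) g f.
rewrite /hcomp leq0n leq_addr subn0 addKn mulrC => ->; first by rewrite mulrC.
by move=> m ms; rewrite addn0; apply: (dhomog_mf hf ms).
Qed.

Lemma pihomogM_small d e f g :
  f \is d.-homog -> (e < d)%N -> pihomog mdeg e (f * g) = 0.
Proof.
move=> hf ed; have := @hcompM K n 0 d e g f.
rewrite /hcomp leq0n leqNgt ed subn0 mulrC => ->; first by rewrite mul0r.
by move=> m ms; rewrite addn0; apply: (dhomog_mf hf ms).
Qed.

Lemma mulI_homogeneous d f I :
  is_ideal I -> homogeneous I -> f \is d.-homog -> homogeneous (mulI f I).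
Proof.
move=> hI gI hf _ e [g Ig ->]; have [ed|de] := ltnP e d.
  by rewrite (pihomogM_small _ hf) //; exact: (ideal0 (mulI_ideal f hI)).
rewrite -(subnKC de) (pihomogM _ _ hf).
by exists (pihomog mdeg (e - d) g) => //; apply: gI.
Qed.

Lemma addI_homogeneous A B : homogeneous A -> homogeneous B -> homogeneous (addI A B).
Proof.
move=> gA gB _ e [u [v [Au Bv ->]]]; rewrite pihomogD.
by exists (pihomog mdeg e u), (pihomog mdeg e v); split; [exact: gA|exact: gB|].
Qed.

Lemma idim_ext I J t : (forall f, I f <-> J f) -> idim I t = idim J t.
Proof. by move=> e; apply: dimv_ext => f; rewrite /hpart e. Qed.

Lemma idim_full t : idim fullI t = 'C(t + n, n).
Proof. by apply/dimvE/(has_dim_ext _ (has_dim_homog K n t)) => f; split=> [|[]]. Qed.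

Lemma idim_addI A B t :
  is_ideal A -> is_ideal B -> homogeneous A -> homogeneous B ->
  (idim (addI A B) t + idim (fun h => A h /\ B h) t = idim A t + idim B t)%N.
Proof.
move=> hA hB gA gB.
have [_ <-] := dimv_add (hpart_subspace t hA) (hpart_subspace t hB)
  (fin_dim_hpart t hA) (fin_dim_hpart t hB).
congr (_ + _)%N; apply: dimv_ext => h; split.
- move=> [[u [v [Au Bv ->]]] hh]; exists (pihomog mdeg t u), (pihomog mdeg t v).
  split; last by rewrite -pihomogD pihomog_dE.
    by split; [exact: gA|exact: pihomogP].
  by split; [exact: gB|exact: pihomogP].
- move=> [u [v [[Au hu] [Bv hv] ->]]]; split; last exact: rpredD.
  by exists u, v.
- by move=> [[Ah Bh] hh].
- by move=> [[Ah hh] [Bh _]].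
Qed.

Lemma idim_mulI d f I t : is_ideal I -> f != 0 -> f \is d.-homog ->
  idim (mulI f I) t = if (d <= t)%N then idim I (t - d) else 0%N.
Proof.
move=> hI nz hf; case: leqP => dt.
  rewrite /idim -(dimv_inj_image (hpart_subspace (t - d) hI) (lin_mull f)
     (fin_dim_hpart (t - d) hI)); last first.
    by move=> v _ /eqP; rewrite mulf_eq0 (negPf nz) => /eqP.
  apply: dimv_ext => h; split=> [[[g Ig ->] hg]|[g [Ig hg] ->]].
    exists g => //; split=> //; apply: (mulr_homog nz hf).
    by rewrite subnKC.
  split; first by exists g.
  by rewrite -(subnKC dt); apply: dhomogM.
apply: dimvE; exists 'I_0, (fun=> 0); split=> [|h|u _ []//]; first by rewrite card_ord.
split=> [[[g Ig ->] hg]|[u ->]]; last first.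
  by rewrite big_ord0; split; [exact: (ideal0 (mulI_ideal f hI))|exact: rpred0].
exists (fun=> 0); rewrite big_ord0 -(pihomog_dE hg).
exact: pihomogM_small hf dt.
Qed.

Definition deg_le t f := forall m, m \in msupp f -> (mdeg m <= t)%N.
Definition apart I t f := I f /\ deg_le t f.
(** The affine Hilbert function of R/I. Filtering by degree instead of grading covers inhomogeneous
    ideals, which occur in chains of primes. *)
Definition cod I t := (dimv (deg_le t) - dimv (apart I t))%N.

Lemma has_dim_deg_le t : exists d, has_dim (deg_le t) d.
Proof.
have := @has_dim_monomials K n [seq val m | m : 'X_{1..n.+1 < t.+1}].
move=> [|T [b [e hb fb]]]; first by rewrite map_inj_uniq ?enum_uniq //; exact: val_inj.
eexists; exists T, b; split; [exact: erefl| |exact: fb] => f; rewrite -hb.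
split=> [h m /h ms|h m /h /mapP[x _ ->]]; last by rewrite -ltnS bmdeg.
by apply/mapP; exists (BMultinom (ms : (mdeg m < t.+1)%N)); rewrite ?mem_enum.
Qed.

Lemma deg_le_subspace t : subspace (deg_le t).
Proof.
split=> [m|u v hu hv m|c v hv m]; first by rewrite msupp0.
  by move/msuppD_le; rewrite mem_cat => /orP[/hu|/hv].
by move/msuppZ_le/hv.
Qed.

Lemma deg_leM d e f g : deg_le d f -> deg_le e g -> deg_le (d + e) (f * g).
Proof.
move=> hf hg m /msuppM_le/allpairsP[[m1 m2] [/= h1 h2 ->]].
by rewrite mdegD leq_add ?hf ?hg.
Qed.

Lemma ex_deg_le f : exists e, deg_le e f.
Proof. by exists (msize f) => m /msize_mdeg_lt/ltnW. Qed.

Lemma deg_leW d e f : (d <= e)%N -> deg_le d f -> deg_le e f.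
Proof. by move=> de h m /h hm; apply: leq_trans de. Qed.

Lemma apart_subspace I t : is_ideal I -> subspace (apart I t).
Proof.
move=> hI; have [h0 hD hZ] := deg_le_subspace t.
split=> [|u v [? ?] [? ?]|c v [? ?]]; split; auto.
- exact: ideal0.
- exact: idealD.
- exact: idealZ.
Qed.

Lemma fin_dim_apart I t : is_ideal I -> fin_dim (apart I t).
Proof.
by move=> hI; apply: fin_dim_sub (has_dim_deg_le t); [exact: apart_subspace|move=> v []].
Qed.

Lemma cod_apart I t : is_ideal I -> (cod I t + dimv (apart I t) = dimv (deg_le t))%N.
Proof.
move=> hI; rewrite subnK //; apply: dimv_le; last exact: has_dim_deg_le.
  exact: apart_subspace.
by move=> v [].
Qed.

Lemma cod_sub I J t : is_ideal I -> is_ideal J -> sub_ideal I J -> (cod J t <= cod I t)%N.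
Proof.
move=> hI hJ sIJ; rewrite leq_sub2l //; apply: dimv_le.
- exact: apart_subspace.
- by move=> v [Iv ?]; split=> //; apply: sIJ.
- exact: fin_dim_apart.
Qed.

(** The polynomials of degree at most t meet [apart I t'] in [apart I t], so the smaller quotient
    embeds in the larger one. *)
Lemma cod_leq I t t' : is_ideal I -> (t <= t')%N -> (cod I t <= cod I t')%N.
Proof.
move=> hI tt'.
have [_ e] := dimv_add (deg_le_subspace t) (apart_subspace t' hI)
  (has_dim_deg_le t) (fin_dim_apart t' hI).
have e1 : dimv (fun v => deg_le t v /\ apart I t' v) = dimv (apart I t).
  apply: dimv_ext => v; split=> [[? [? ?]]//|[? h]]; split=> //; split=> //.
  exact: deg_leW h.
move: e; rewrite e1; set s := (X in (X + _)%N = _) => e.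
have : (s <= dimv (deg_le t'))%N.
  rewrite /s; apply: dimv_le; last exact: has_dim_deg_le.
    by apply: add_subspace; [exact: deg_le_subspace|exact: apart_subspace].
  move=> _ [u [v [hu [_ hv] ->]]]; have [_ hD _] := deg_le_subspace t'.
  by apply: hD => //; apply: deg_leW hu.
move: e; have := cod_apart t hI; have := cod_apart t' hI; lia.
Qed.

(** Modulo [I], multiplication by [f] is injective and maps polynomials of degree at most t - e into
    the part of [J] of degree at most t. If [f] is zero, regularity forces I = R. *)
Lemma cod_step I J f e t :
  is_ideal I -> is_ideal J -> sub_ideal I J -> J f -> (forall g, I (f * g) -> I g) ->
  deg_le e f -> (e <= t)%N -> (cod J t + cod I (t - e) <= cod I t)%N.
Proof.
move=> hI hJ sIJ Jf nzd hf et.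
have [f0|nz] := eqVneq f 0.
  have allI g : I g by apply: nzd; rewrite f0 mul0r; exact: ideal0.
  have c0 (J' : R -> Prop) s : (forall g, J' g) -> cod J' s = 0%N.
    move=> h; rewrite /cod (@dimv_ext _ _ (apart J' s) (deg_le s)) ?subnn // => v.
    by split=> [[]|].
  by rewrite !c0 // => g; apply: sIJ.
have lf := lin_mull f.
have sD := deg_le_subspace (t - e); have fD := has_dim_deg_le (t - e).
have [_ fim _] := rank_nullity sD lf fD.
have inj v : f * v = 0 -> v = 0.
  by move/eqP; rewrite mulf_eq0 (negPf nz) => /eqP.
have [_ eq1] := dimv_add (im_subspace sD lf) (apart_subspace t hI) fim (fin_dim_apart t hI).
have eq2 := dimv_inj_image sD lf fD (fun v _ => @inj v).
have eq3 := dimv_inj_image (apart_subspace (t - e) hI) lf (fin_dim_apart (t - e) hI)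
  (fun v _ => @inj v).
have eq4 : dimv (fun v => (exists2 u, deg_le (t - e) u & v = f * u) /\ apart I t v) =
    dimv (fun v => exists2 u, apart I (t - e) u & v = f * u).
  apply: dimv_ext => v; split=> [[[u hu ->] [Iu _]]|[u [Iu hu] ->]].
    by exists u => //; split=> //; apply: nzd.
  split; first by exists u.
  by split; [exact: idealM|rewrite -(subnKC et); exact: deg_leM].
move: eq1; rewrite eq2 eq4 eq3; set s := (X in (X + _)%N = _) => eq1.
have le : (s <= dimv (apart J t))%N.
  rewrite /s; apply: dimv_le; last exact: fin_dim_apart.
    by apply: add_subspace; [exact: im_subspace|exact: apart_subspace].
  move=> _ [_ [v [[u hu ->] [Iv hv] ->]]]; have [_ AD _] := apart_subspace t hJ.
  apply: AD; split=> //; last exact: sIJ.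
    by rewrite mulrC; exact: idealM.
  by rewrite -(subnKC et); exact: deg_leM.
move: eq1 le; have := cod_apart t hI; have := cod_apart (t - e) hI; have := cod_apart t hJ; lia.
Qed.

(* growth I k.+1 bounds the dimension of R/I by k, and growth I 0 means I = R. *)
Definition growth I k := exists C, forall t,
  (cod I t <= C * (if k is k'.+1 then t.+1 ^ k' else 0))%N.

Lemma growth_sub I J k :
  is_ideal I -> is_ideal J -> sub_ideal I J -> growth I k -> growth J k.
Proof.
move=> hI hJ sIJ [C hC]; exists C => t.
exact: leq_trans (cod_sub t hI hJ sIJ) (hC t).
Qed.

(** Telescoping [cod_step] bounds a sum of values of [cod J] by one value of [cod I]; since [cod J]
    is nondecreasing, about t terms of size [cod J t] fit in, which saves one power of t. *)
Lemma growth_step I J f k :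
  is_ideal I -> is_ideal J -> sub_ideal I J -> J f -> (forall g, I (f * g) -> I g) ->
  growth I k.+1 -> growth J k.
Proof.
move=> hI hJ sIJ Jf nzd [C hC].
(* The degree bound is made positive, so that j * e is at least j. *)
have [e0 /(deg_leW (leqnSn _))] := ex_deg_le f; set e := e0.+1 => he.
have tel M : (\sum_(j < M) cod J (j.+1 * e) <= cod I (M * e))%N.
  elim: M => [|M IH]; first by rewrite big_ord0.
  rewrite big_ord_recr /=; have := @cod_step I J f e (M.+1 * e)%N hI hJ sIJ Jf nzd he.
  rewrite mulSn leq_addr addKn => /(_ isT) h.
  by apply: leq_trans h; rewrite addnC leq_add2l.
(* Of the 2t + 1 terms the last t + 1 are values of [cod J] at arguments at least t. *)
have key t : (t.+1 * cod J t <= C * ((2 * e).+1 * t.+1) ^ k)%N.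
  apply: leq_trans (_ : cod I ((2 * t).+1 * e) <= _)%N; last first.
    apply: leq_trans (hC _) _; rewrite leq_mul2l; apply/orP; right.
    by case: k {hC} => // k; rewrite leq_exp2r //; nia.
  apply: leq_trans (tel _); rewrite (_ : (2 * t).+1 = t + t.+1)%N; last by lia.
  rewrite big_split_ord /=; apply: leq_trans (leq_addl _ _).
  rewrite -[X in (X * _ <= _)%N](card_ord t.+1) -sum_nat_const.
  by apply: leq_sum => j _; apply: cod_leq => //; rewrite /e; nia.
case: k key hC => [|k] key hC.
  (* Here (t+1) times [cod J t] stays below a constant C; at the maximum of t and C this leaves only
     the value 0. *)
  exists 0%N => t; rewrite mul0n leqn0; apply/eqP.
  have := key (maxn t C); have := cod_leq hI (leq_maxl t C).
  have := cod_leq hJ (leq_maxl t C); rewrite expn0 muln1.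
  by have := leq_maxr t C; nia.
exists (C * (2 * e).+1 ^ k.+1)%N => t.
rewrite -(@leq_pmul2l t.+1) //; apply: leq_trans (key t) _.
by rewrite expnMn mulnA [(t.+1 * _)%N]mulnCA -expnS.
Qed.

Lemma growth0 I : is_ideal I -> growth I 0 -> I 1.
Proof.
move=> hI [C /(_ 0%N)]; rewrite muln0 leqn0 => /eqP c0.
have := cod_apart 0 hI; rewrite c0 add0n => e.
have := dimv_eq (apart_subspace 0 hI) (fun v => @proj2 _ _) (has_dim_deg_le 0) e.
move/(_ 1) => [] // m; rewrite msupp1 inE => /eqP->; by rewrite mdeg0.
Qed.

Lemma growth_full I k : I 1 -> is_ideal I -> growth I k.
Proof.
move=> I1 hI; exists 0%N => t; rewrite mul0n leqn0 /cod.
rewrite (@dimv_ext _ _ (apart I t) (deg_le t)) ?subnn // => v.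
by split=> [[]//|hv]; split=> //; exact: ideal1.
Qed.

Lemma hpart_deg_le I t f : hpart I t f -> deg_le t f.
Proof. by move=> [_ /dhomogP hf] m /hf /= <-. Qed.

Lemma dimv_apart0 I : dimv (apart I 0) = idim I 0.
Proof.
apply: dimv_ext => f; split=> [[If hf]|[If hf]]; split=> //; last exact: hpart_deg_le (conj If hf).
by apply/dhomogP => m /hf /=; rewrite leqn0 => /eqP.
Qed.

Lemma dimv_apartS I t : is_ideal I -> homogeneous I ->
  dimv (apart I t.+1) = (dimv (apart I t) + idim I t.+1)%N.
Proof.
move=> hI gI.
have [_ <-] := dimv_add (apart_subspace t hI) (hpart_subspace t.+1 hI)
  (fin_dim_apart t hI) (fin_dim_hpart t.+1 hI).
rewrite [X in (_ + X)%N](_ : _ = 0%N) ?addn0.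
  apply: dimv_ext => f; split=> [[If hf]|[u [v [[Iu hu] [Iv hv] ->]]]].
    exists (f - pihomog mdeg t.+1 f), (pihomog mdeg t.+1 f); split; last by rewrite subrK.
      split=> [|m]; first by apply: idealB => //; apply: gI.
      rewrite mcoeff_msupp mcoeffB mcoeff_pihomog.
      case: ifP => h; first by rewrite subrr eqxx.
      by rewrite subr0 -mcoeff_msupp => /hf; rewrite leq_eqVlt h.
    by split; [exact: gI|exact: pihomogP].
  split; first exact: idealD.
  have [_ AD _] := deg_le_subspace t.+1; apply: AD; first exact: deg_leW hu.
  exact: hpart_deg_le (conj Iv hv).
apply: dimvE; exists 'I_0, (fun=> 0); split=> [|h|u _ []//]; first by rewrite card_ord.
split=> [[[_ h1] [_ /dhomogP h2]]|[u ->]]; last first.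
  rewrite big_ord0; case: (apart_subspace t hI) => h0 _ _.
  by case: (hpart_subspace t.+1 hI).
exists (fun=> 0); rewrite big_ord0; apply/eqP/negPn/negP => nz.
by have := h1 _ (mlead_supp nz); rewrite (h2 _ (mlead_supp nz)) ltnn.
Qed.

Lemma cod_homogeneous I t : is_ideal I -> homogeneous I ->
  (cod I t + \sum_(u < t.+1) idim I u = \sum_(u < t.+1) 'C(u + n, n))%N.
Proof.
move=> hI gI.
have sumE (J : R -> Prop) : is_ideal J -> homogeneous J ->
    dimv (apart J t) = (\sum_(u < t.+1) idim J u)%N.
  move=> hJ gJ; elim: t => [|s IH]; first by rewrite big_ord1 dimv_apart0.
  by rewrite dimv_apartS // IH [RHS]big_ord_recr.
rewrite -sumE // cod_apart // -(@dimv_ext _ _ (apart fullI t)); last by move=> v; split=> [[]|].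
rewrite (sumE _ fullI_ideal fullI_homogeneous).
by apply: eq_bigr => u _; rewrite idim_full.
Qed.

Lemma sum_delay (T d : nat) (F : nat -> nat) :
  (\sum_(u < T) (if d <= u then F (u - d) else 0) = \sum_(u < T - d) F u)%N.
Proof.
elim: T => [|s IH]; first by rewrite !big_ord0.
rewrite big_ord_recr /= IH; case: leqP => h; first by rewrite subSn // big_ord_recr.
have e1 : (s - d = 0)%N by apply/eqP; rewrite subn_eq0 ltnW.
have e2 : (s.+1 - d = 0)%N by apply/eqP; rewrite subn_eq0.
by rewrite e1 e2 addn0.
Qed.

Lemma sum_split_tail (T d : nat) (F : nat -> nat) :
  (\sum_(u < T) F u = \sum_(u < T - d) F u + \sum_(u < T | T - d <= u) F u)%N.
Proof.
rewrite (bigID (fun u : 'I_T => u < T - d)%N) /=; congr (_ + _)%N.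
  by rewrite -(big_ord_widen _ F) // leq_subr.
by apply: eq_bigl => u; rewrite -leqNgt.
Qed.

(** The exact sequence of multiplication by [f] from R/(P : f)(-d) to R/P with cokernel R/(P + (f));
    dropping the delay d only enlarges the term of the colon ideal. It is counted through the
    intersection of P and (f), which is f (P : f). *)
Lemma cod_colon P f d t : is_ideal P -> homogeneous P -> f \is d.-homog ->
  (cod P t <= cod (addI P (mulI f fullI)) t + cod (fun g => P (f * g)%R) t)%N.
Proof.
move=> hP gP hf.
have [->|nz] := eqVneq f 0.
  rewrite [X in (_ <= X + _)%N](_ : _ = cod P t) ?leq_addr //.
  rewrite /cod; congr (_ - _)%N; apply: dimv_ext => h; split=> [[[u [v [Pu [w _ ->] ->]]] hh]|[Ph hh]].
    by split=> //; rewrite mul0r addr0.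
  by split=> //; exists h, 0; rewrite addr0; split=> //; exists 0; rewrite ?mulr0.
set Q := addI _ _; set C := fun g => P (f * g).
have hC : is_ideal C.
  split=> [|u v|u v]; rewrite /C ?mulr0 ?mulrDr; [exact: ideal0|exact: idealD|].
  by rewrite mulrCA; exact: idealM.
have gC : homogeneous C.
  by move=> g e; rewrite /C -(pihomogM _ _ hf); apply: gP.
have hF := mulI_ideal f fullI_ideal; have gF := mulI_homogeneous fullI_ideal fullI_homogeneous hf.
have hQ : is_ideal Q by apply: addI_ideal.
have gQ : homogeneous Q by apply: addI_homogeneous.
have piece u : (idim Q u + (if d <= u then idim C (u - d) else 0) =
   (if d <= u then 'C(u - d + n, n) else 0) + idim P u)%N.
  have := idim_addI u hP hF gP gF; rewrite (idim_mulI _ fullI_ideal nz hf) idim_full.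
  rewrite [X in (_ + X)%N](@idim_ext _ (mulI f C)) => [|h].
    by rewrite (idim_mulI _ hC nz hf) -/Q => ->; rewrite addnC.
  by split=> [[Ph [g _ e]]|[g Cg ->]]; [exists g => //; rewrite /C -e|split=> //; exists g].
have := cod_homogeneous t hP gP; have := cod_homogeneous t hQ gQ.
have := cod_homogeneous t hC gC.
have s1 : (\sum_(u < t.+1) idim Q u + \sum_(u < t.+1) (if d <= u then idim C (u - d) else 0) =
  \sum_(u < t.+1) (if d <= u then 'C(u - d + n, n) else 0) + \sum_(u < t.+1) idim P u)%N.
  by rewrite -!big_split /=; apply: eq_bigr => u _; exact: piece.
have s2 : (\sum_(u < t.+1) (if d <= u then 'C(u - d + n, n) else 0) + \sum_(u < t.+1) idim C u
   <= \sum_(u < t.+1) (if d <= u then idim C (u - d) else 0) + \sum_(u < t.+1) 'C(u + n, n))%N.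
  rewrite (sum_delay _ _ (fun u => 'C(u + n, n))) (sum_delay _ _ (idim C)).
  rewrite (sum_split_tail t.+1 d (fun u => 'C(u + n, n))) (sum_split_tail t.+1 d (idim C)).
  rewrite addnCA leq_add2l leq_add2l.
  by apply: leq_sum => u _; exact: idim_le.
lia.
Qed.

(** Take the lowest components of f and g, of degrees i and j, outside [P]. In degree i + j of f g
    every other product contains a lower component of f or g, hence lies in [P]. *)
Lemma prime_of_homogeneous P :
  is_ideal P -> homogeneous P -> ~ P 1 ->
  (forall d e f g, f \is d.-homog -> g \is e.-homog -> P (f * g) -> P f \/ P g) ->
  is_prime P.
Proof.
move=> hP gP P1 prim; split=> // f g Pfg; apply: NNPP => nfg.
have ex_comp h : ~ P h -> exists k, ~ P (pihomog mdeg k h).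
  move=> nPh; apply: NNPP => nk; apply: nPh.
  rewrite (@pihomog_partitionE _ _ mdeg _ h (leqnn _)); apply: (ideal_sum _ hP) => i _.
  by apply: NNPP => hi; apply: nk; exists i.
have [i Pi mini] : exists2 k, ~ P (pihomog mdeg k f) &
    forall j, ~ P (pihomog mdeg j f) -> (k <= j)%N.
  by apply/ex_min_prop/ex_comp => h; apply: nfg; left.
have [j Pj minj] : exists2 k, ~ P (pihomog mdeg k g) &
    forall j, ~ P (pihomog mdeg j g) -> (k <= j)%N.
  by apply/ex_min_prop/ex_comp => h; apply: nfg; right.
suff : P (pihomog mdeg i f * pihomog mdeg j g).
  by move/(prim _ _ _ _ (pihomogP _ _ _) (pihomogP _ _ _)) => [].
have lo_f a : (a < i)%N -> P (pihomog mdeg a f).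
  by move=> ai; apply: NNPP => /mini; rewrite leqNgt ai.
have lo_g b : (b < j)%N -> P (pihomog mdeg b g).
  by move=> bj; apply: NNPP => /minj; rewrite leqNgt bj.
pose A := maxn (msize f) i.+1; pose B := maxn (msize g) j.+1.
pose T a b := if (a + b == i + j)%N then pihomog mdeg a f * pihomog mdeg b g else 0.
have PT a b : (a, b) != (i, j) -> P (T a b).
  rewrite /T => ab; case: ifP => [/eqP e|_]; last exact: (ideal0 hP).
  have [ai|ai] := ltnP a i; first by rewrite mulrC; apply: (idealM _ hP); exact: lo_f.
  apply: (idealM _ hP); apply: lo_g; move: ab; rewrite xpair_eqE negb_and.
  by move=> /orP[/eqP|/eqP]; lia.
have e : pihomog mdeg (i + j) (f * g) = \sum_(a < A) \sum_(b < B) T a b.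
  rewrite {1}(@pihomog_partitionE _ _ mdeg A f (leq_maxl _ _)) mulr_suml raddf_sum /=.
  apply: eq_bigr => a _.
  rewrite {1}(@pihomog_partitionE _ _ mdeg B g (leq_maxl _ _)) mulr_sumr raddf_sum /=.
  apply: eq_bigr => b _; rewrite /T.
  have hh : pihomog mdeg a f * pihomog mdeg b g \is (a + b).-homog.
    by apply: dhomogM; exact: pihomogP.
  by case: eqP => [<-|/eqP ab]; [rewrite pihomog_dE|rewrite (pihomog_ne0 ab hh)].
have iA : (i < A)%N by rewrite leq_maxr.
have jB : (j < B)%N by rewrite leq_maxr.
have := gP _ (i + j)%N Pfg; rewrite e (bigD1 (Ordinal iA)) //= (bigD1 (Ordinal jB)) //=.
rewrite {1}/T eqxx -addrA => h.
rewrite -[X in P X](addrK (\sum_(b < B | b != Ordinal jB) T i b +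
   \sum_(a < A | a != Ordinal iA) \sum_(b < B) T a b)).
apply: (idealB hP h); apply: (idealD hP).
  apply: (ideal_sum _ hP) => b bj; apply: PT; rewrite xpair_eqE eqxx /=.
  by apply: contra bj => /eqP bj; apply/eqP/val_inj.
apply: (ideal_sum _ hP) => a ai; apply: (ideal_sum _ hP) => b _; apply: PT.
rewrite xpair_eqE negb_and; apply/orP; left.
by apply: contra ai => /eqP ai; apply/eqP/val_inj.
Qed.

(** The monomials of degree at most t inject into a cube with n + 1 sides of t + 1 points. *)
Lemma growth_zero I : is_ideal I -> growth I n.+2.
Proof.
move=> hI.
have h : growth (@var_ideal K n 0) n.+2.
  exists 1%N => t; rewrite mul1n; apply: leq_trans (leq_subr _ _) _.
  pose L := [seq val m | m : 'X_{1..n.+1 < t.+1}].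
  have uL : uniq L by rewrite map_inj_uniq ?enum_uniq //; exact: val_inj.
  have -> : dimv (deg_le t) = size L.
    apply/dimvE/(has_dim_ext _ (has_dim_monomials K uL)) => f.
    split=> [h m /h /mapP[x _ ->]|h m /h ms]; first by rewrite -ltnS bmdeg.
    by apply/mapP; exists (BMultinom (ms : (mdeg m < t.+1)%N)); rewrite ?mem_enum.
  rewrite size_map -cardE.
  pose F (m : 'X_{1..n.+1 < t.+1}) : {ffun 'I_n.+1 -> 'I_t.+1} := [ffun i => inord ((m : mon) i)].
  have injF : injective F.
    move=> x y /ffunP e; apply/val_inj/mnmP => i; have := e i; rewrite !ffunE.
    have lt (z : 'X_{1..n.+1 < t.+1}) : ((z : mon) i < t.+1)%N.
      apply: leq_ltn_trans (bmdeg z); rewrite mdegE (bigD1 i) //=; exact: leq_addr.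
    by move/(congr1 val); rewrite /= !inordK.
  by have := leq_card F injF; rewrite card_ffun !card_ord.
apply: growth_sub h => //; first exact: var_ideal_ideal.
by move=> f /var_ideal0 ->; exact: ideal0.
Qed.

(** An element of the next prime outside the present one is regular modulo the latter, so each
    inclusion costs one exponent; properness keeps the exponent positive. *)
Lemma prime_chain_growth k (C : nat -> R -> Prop) d :
  prime_chain k C -> growth (C 0%N) d ->
  forall i, (i <= k)%N -> (i < d)%N /\ growth (C i) (d - i).
Proof.
move=> [pC sC] g0; elim=> [|i IH] hi.
  rewrite subn0; split=> //; case: d g0 => // /growth0 h.
  by have [h0 h1 _] := pC 0%N (leq0n _); case: h1; apply: h.
have [id gi] := IH (ltnW hi).
have [hI nI primI] := pC i (ltnW hi); have [hJ nJ _] := pC i.+1 hi.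
have [sIJ nJI] := sC i hi.
have [f [Jf nf]] : exists f, C i.+1 f /\ ~ C i f.
  by apply: NNPP => h; apply: nJI => f Jf; apply: NNPP => nf; apply: h; exists f.
have gs : growth (C i.+1) (d - i.+1).
  apply: (growth_step hI hJ sIJ Jf) => [g /primI[]//|].
  by rewrite -subSn // subSS.
split=> //; rewrite ltnNge; apply/negP => h; apply: nJ.
have e : (d - i.+1 = 0)%N by apply/eqP; rewrite subn_eq0.
by move: gs; rewrite e => /growth0; apply.
Qed.

(* A homogeneous ideal P containing I and maximal among those of growth larger
   than n is prime, because cod_colon bounds the growth of P by those of P + (f)
   and P : f; but a prime with a chain of length two below it has growth n. *)
Lemma height2_growth I : is_ideal I -> homogeneous I -> height_ge I 2 -> growth I n.
Proof.
move=> hI gI ht; apply: NNPP => ng.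
pose F P := [/\ is_ideal P, homogeneous P, sub_ideal I P & ~ growth P n].
have [P [hP gP sIP nP] maxP] : exists2 P, F P & forall Q, F Q -> sub_ideal P Q -> sub_ideal Q P.
  apply: ideal_maximal => [P []//|]; exists I; split=> // f.
have P1 : ~ P 1 by move=> h; apply: nP; exact: growth_full.
have bigger Q f : is_ideal Q -> homogeneous Q -> sub_ideal P Q -> Q f -> ~ P f -> growth Q n.
  move=> hQ gQ sPQ Qf nf; apply: NNPP => nQ; apply: nf; apply: (maxP Q) => //.
  by split=> // h Ih; apply/sPQ/sIP.
have pP : is_prime P.
  apply: prime_of_homogeneous => // d e f g hf hg Pfg; apply: NNPP => nfg.
  have [C1 h1] : growth (addI P (mulI f fullI)) n.
    apply: (bigger _ f).
    - exact: addI_ideal hP (mulI_ideal f fullI_ideal).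
    - exact: addI_homogeneous gP (mulI_homogeneous fullI_ideal fullI_homogeneous hf).
    - by move=> h Ph; exists h, 0; rewrite addr0; split=> //; exists 0; rewrite ?mulr0.
    - exists 0, f; rewrite add0r; split=> //; first exact: ideal0.
      by exists 1; rewrite ?mulr1.
    - by move=> h; apply: nfg; left.
  have [C2 h2] : growth (fun g => P (f * g)) n.
    apply: (bigger _ g) => //.
    - split=> [|u v|u v]; rewrite ?mulr0 ?mulrDr; [exact: ideal0|exact: idealD|].
      by rewrite mulrCA; exact: idealM.
    - by move=> h k; rewrite -(pihomogM _ _ hf); apply: gP.
    - by move=> h Ph; apply: idealM.
    - by move=> h; apply: nfg; right.
  apply: nP; exists (C1 + C2)%N => t; rewrite mulnDl.
  by apply: leq_trans (cod_colon t hP gP hf) (leq_add (h1 t) (h2 t)).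
have [C [pC sC] hC] := ht P pP sIP.
have hC0 : is_ideal (C 0%N) by case: (pC 0%N isT).
have [_] := prime_chain_growth (conj pC sC) (growth_zero hC0) (leqnn 2).
rewrite !subSS subn0; apply: contra_not nP => g2.
have hC2 : is_ideal (C 2%N) by case: (pC 2%N isT).
by apply: growth_sub g2 => // f /hC.
Qed.
End Growth.

(** * General vectors avoid finitely many proper subspaces *)

Section Avoidance.
Variables (K : fieldType) (V : vectType K).

Lemma fin_dim_vect (W : V -> Prop) : subspace W -> fin_dim W.
Proof.
move=> sW; apply: (fin_dim_sub sW (fun v _ => I)).
exists (\dim {:V}), 'I_(\dim {:V}), (fun i : 'I_(\dim {:V}) => (vbasis {:V})`_i); split.
- by rewrite card_ord.
- move=> v; split=> // _; exists (fun i => coord (vbasis {:V}) i v).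
  by apply: coord_vbasis; exact: memvf.
- by move=> u hu; apply/freeP: hu; exact: basis_free (vbasisP _).
Qed.

Lemma subspace_vspace (W : V -> Prop) : subspace W ->
  exists2 U : {vspace V}, forall v, v \in U <-> W v & \dim U = dimv W.
Proof.
move=> sW; have [d [T [b [cT hW fb]]]] := fin_dim_vect sW.
pose X := in_tuple [seq b x | x <- enum T].
have hX v : v \in <<X>>%VS <-> W v.
  split=> [/coord_span->|/hW[u ->]].
    apply: subspace_sum => // i.
    have /mapP[x _ ->] : X`_i \in [seq b x | x <- enum T] by apply: mem_nth.
    exact: has_dim_mem hW.
  apply: memv_suml => x _; apply/memvZ/memv_span/map_f; exact: mem_enum.
exists <<X>>%VS => //; apply/esym/dimvE; set U := <<X>>%VS.
exists 'I_(\dim U), (fun i : 'I_(\dim U) => (vbasis U)`_i); split; first by rewrite card_ord.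
  move=> v; rewrite -hX -/U; split=> [vU|[u ->]].
    by exists (fun i => coord (vbasis U) i v); exact: coord_vbasis.
  by apply: memv_suml => i _; apply/memvZ/vbasis_mem/mem_nth; rewrite size_tuple.
by move=> u hu; apply/freeP: hu; exact: basis_free (vbasisP _).
Qed.

Local Notation N := (\dim {:V}).

Definition lform (c : 'I_N -> K) (v : V) : K := \sum_i c i * coord (vbasis {:V}) i v.

Lemma lformP c x u v : lform c (x *: u + v) = x * lform c u + lform c v.
Proof.
rewrite /lform mulr_sumr -big_split /=; apply: eq_bigr => i _.
by rewrite linearP /= mulrDr mulrCA.
Qed.

(** Projecting away from [W] leaves [w] nonzero; a coordinate of this projection that does not
    vanish at [w] is the required form. *)
Lemma ex_lform (W : V -> Prop) w : subspace W -> ~ W w ->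
  exists c, (forall v, W v -> lform c v = 0) /\ lform c w != 0.
Proof.
move=> sW nW; have [U hU _] := subspace_vspace sW.
have wU : w \notin U by apply/negP => /hU.
pose p v := v - projv U v.
have lp x u v : p (x *: u + v) = x *: p u + p v.
  by rewrite /p linearP /= opprD addrACA scalerBr.
have pw : p w != 0.
  by apply: contra wU; rewrite subr_eq0 => /eqP ->; exact: memv_proj.
have [i hi] : exists i, coord (vbasis {:V}) i (p w) != 0.
  apply: NNPP => h; case/eqP: pw; rewrite (coord_vbasis (memvf (p w))) big1 // => i _.
  have [->|nz] := eqVneq (coord (vbasis {:V}) i (p w)) 0; first by rewrite scale0r.
  by case: h; exists i.
pose l v := coord (vbasis {:V}) i (p v).
have lE v : lform (fun j => l (vbasis {:V})`_j) v = l v.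
  have p0 : p 0 = 0 by rewrite /p linear0 subrr.
  have l0 : l 0 = 0 by rewrite /l p0 linear0.
  have lD u u' : l (u + u') = l u + l u'.
    by have := lp 1 u u'; rewrite !scale1r /l => ->; rewrite linearD.
  have lZ x u : l (x *: u) = x * l u.
    by have := lp x u 0; rewrite p0 !addr0 /l => ->; rewrite linearZ.
  rewrite {2}(coord_vbasis (memvf v)) (big_morph l lD l0).
  by apply: eq_bigr => j _; rewrite lZ mulrC.
exists (fun j => l (vbasis {:V})`_j); split=> [v /hU vU|]; rewrite lE //.
by rewrite /l /p projv_id // subrr linear0.
Qed.

(** On the line x v + w a form not vanishing at v has one root, so finitely many x are excluded. If
    the new form vanishes at v, it is constant and nonzero on the line by the choice of w. *)
Lemma avoid_lforms k (c : nat -> 'I_N -> K) : infinite_type K ->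
  (forall i, (i < k)%N -> exists w, lform (c i) w != 0) ->
  exists v, forall i, (i < k)%N -> lform (c i) v != 0.
Proof.
move=> infK; elim: k => [|k IH] h; first by exists 0.
have [v hv] : exists v, forall i, (i < k)%N -> lform (c i) v != 0.
  by apply: IH => i ik; apply: h; apply: ltnW.
have [w hw] := h k (ltnSn k).
have [x hx] := infK [seq - lform (c i) w / lform (c i) v | i <- iota 0 k.+1].
exists (x *: v + w) => i ik; rewrite lformP.
have [e|nz] := eqVneq (lform (c i) v) 0.
  rewrite e mulr0 add0r; move: ik; rewrite ltnS leq_eqVlt => /orP[/eqP->//|/hv].
  by rewrite e eqxx.
apply: contra hx => /eqP e; apply/mapP; exists i; first by rewrite mem_iota.
by move/eqP: e; rewrite addr_eq0 => /eqP <-; rewrite mulfK.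
Qed.

(** Each subspace lies in a hyperplane; the product of the linear forms cuts out the open set. *)
Lemma general_avoid k (W : 'I_k -> V -> Prop) (Q : V -> Prop) : infinite_type K ->
  (forall i, subspace (W i)) -> (forall i, exists w, ~ W i w) ->
  (forall v, (forall i, ~ W i v) -> Q v) -> general Q.
Proof.
move=> infK sW pW hQ.
have /choice_fun[c hc] : forall i : nat, exists c : 'I_N -> K,
    forall ik : (i < k)%N, (forall v, W (Ordinal ik) v -> lform c v = 0) /\
       exists w, lform c w != 0.
  move=> i; have [ik|ik] := classic (i < k)%N; last by exists (fun=> 0).
  have [w nw] := pW (Ordinal ik); have [c [h1 h2]] := ex_lform (sW _) nw.
  exists c => ik'; rewrite (_ : Ordinal ik' = Ordinal ik); last exact: val_inj.
  by split=> //; exists w.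
pose phi : {mpoly K[N]} := \prod_(i < k) \sum_j c i j *: 'X_j.
have phiE v : phi.@[fun i => coord (vbasis {:V}) i v] = \prod_(i < k) lform (c i) v.
  rewrite rmorph_prod; apply: eq_bigr => i _; rewrite raddf_sum /=.
  by apply: eq_bigr => j _; rewrite mevalZ mevalXU.
have [v hv] : exists v, forall i, (i < k)%N -> lform (c i) v != 0.
  by apply: avoid_lforms => // i ik; case: (hc i ik).
exists (fun v => \prod_(i < k) lform (c i) v != 0); split.
- exists (fun p => p = phi) => u; split=> [nz|[_ -> ]]; last by rewrite phiE.
  by exists phi; rewrite // phiE.
- by exists v; apply/prodf_neq0 => i _; apply: hv.
- move=> u /prodf_neq0 nz; apply: hQ => i Wi.
  have [h _] := hc i (ltn_ord i).
  have := nz i isT; rewrite h ?eqxx //.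
  by rewrite (_ : Ordinal _ = i) //; apply: val_inj.
Qed.
End Avoidance.

(** * Nonzero divisors modulo a form and basic double links *)

Section Links.
Variables (K : fieldType) (n : nat).
Local Notation R := {mpoly K[n.+1]}.
Local Notation mon := 'X_{1..n.+1}.
Implicit Types (f g h F G : R) (I J P B : R -> Prop).

Definition colon B h : R -> Prop := fun g => B (g * h).

Lemma colon_ideal B h : is_ideal B -> is_ideal (colon B h).
Proof.
move=> hB; split=> [|u v|u v]; rewrite /colon ?mul0r ?mulrDl; first exact: ideal0.
  exact: idealD.
by rewrite -mulrA; exact: idealM.
Qed.

(* The maximal ideals of the form (B : h) are the maximal associated primes of B;
   finitely many of the h generate, modulo B, all of them. *)
Lemma zero_divisors_cover B : is_ideal B ->
  exists k (h : 'I_k -> R), (forall i, ~ B (h i)) /\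
    forall f g, B (f * g) -> ~ B g -> exists i, B (f * h i).
Proof.
move=> hB.
pose top h := ~ B h /\ forall h', ~ B h' -> sub_ideal (colon B h) (colon B h') ->
  sub_ideal (colon B h') (colon B h).
pose F P := exists k (h : 'I_k -> R), (forall i, top (h i)) /\ forall f, P f <-> addI B (spanp h) f.
have [P [k [h [th hP]]] maxP] : exists2 P, F P & forall Q, F Q -> sub_ideal P Q -> sub_ideal Q P.
  apply: ideal_maximal => [P [k [h [_ hP]]]|].
    have [h0 hD hM] := addI_ideal hB (spanp_ideal h).
    by split=> [|u v /hP hu /hP hv|u v /hP hv]; apply/hP; [|exact: hD|exact: hM].
  by exists (addI B (spanp (fun _ : 'I_0 => 0))), 0%N, (fun=> 0); split=> [[]|].
(* Adjoining g to the finite list stays within the family, so maximality absorbs it. *)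
have topP g : top g -> P g.
  move=> tg.
  pose h' (i : 'I_k.+1) := oapp h g (unlift ord_max i).
  have h'l i : h' (lift ord_max i) = h i by rewrite /h' liftK.
  have h'm : h' ord_max = g by rewrite /h' unlift_none.
  have FQ : F (addI B (spanp h')).
    exists k.+1, h'; split=> // i.
    by rewrite /h'; case: unliftP => [j _|_] /=.
  apply: (maxP _ FQ).
    move=> f /hP[u [v [Bu [w ->] ->]]]; exists u, (\sum_i w i * h i); split=> //.
    exists (fun i => oapp w 0 (unlift ord_max i)).
    rewrite (bigD1_ord ord_max) //= unlift_none mul0r add0r.
    by apply: eq_bigr => i _; rewrite liftK h'l.
  by exists 0, g; rewrite add0r; split; [exact: ideal0|rewrite -h'm; exact: mem_spanp|].
exists k, h; split=> [i|f g Bfg nBg]; first by case: (th i).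
have [g' tg' sg] : exists2 g', top g' & sub_ideal (colon B g) (colon B g').
  pose F' P := exists h', [/\ ~ B h', sub_ideal (colon B g) (colon B h')
    & forall f, P f <-> colon B h' f].
  have [Q [g' [ng' sg hQ]] maxQ] :
      exists2 P, F' P & forall Q, F' Q -> sub_ideal P Q -> sub_ideal Q P.
    apply: ideal_maximal => [Q [h' [_ _ hQ]]|]; last by exists (colon B g), g; split.
    have [h0 hD hM] := colon_ideal h' hB.
    by split=> [|u v /hQ hu /hQ hv|u v /hQ hv]; apply/hQ; [|exact: hD|exact: hM].
  exists g' => //; split=> // h' nh' s f' hf'; apply/hQ; apply: (maxQ (colon B h')) => //.
    by exists h'; split=> // u /sg/s.
  by move=> u /hQ/s.
have [ng' mg'] := tg'.
(* Primality of (B : g'): it is contained in (B : v g'), hence equal to it by maximality. *)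
have prime' u v : ~ B (u * g') -> ~ B (v * g') -> ~ B (u * v * g').
  move=> nu nv huv; apply: nu; apply: (mg' (v * g')) => //; last by rewrite /colon mulrA.
  by move=> w; rewrite /colon mulrCA => hw; apply: idealM.
(* Otherwise each (B : h_i) has an element outside (B : g'). The product of these elements kills all
   h_i modulo B, hence also g', which is generated by them modulo B; this contradicts primality. *)
have [i si] : exists i, sub_ideal (colon B (h i)) (colon B g').
  apply: NNPP => ni.
  have /choice_fun[x hx] : forall i, exists x, B (x * h i) /\ ~ B (x * g').
    move=> i; apply: NNPP => nx; apply: ni; exists i => x hx.
    by apply: NNPP => nx'; apply: nx; exists x.
  pose y := \prod_i x i.
  have : ~ B (y * g').
    apply: (big_ind (fun y => ~ B (y * g'))) => [|u v|i _]; first by rewrite mul1r.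
      exact: prime'.
    by case: (hx i).
  apply; have /hP[u [v [Bu [w ->] ->]]] := topP _ tg'.
  rewrite mulrDr; apply: (idealD hB); first exact: idealM.
  rewrite mulr_sumr; apply: (ideal_sum _ hB) => i _.
  rewrite mulrCA; apply: (idealM _ hB); rewrite /y (bigD1 i) //= mulrAC mulrC.
  by apply: (idealM _ hB); case: (hx i).
exists i; have [_ mi] := th i; apply: (mi g') => //.
by apply: sg.
Qed.

Definition principal F : R -> Prop := mulI F (@fullI K n).

Lemma mono_multiple m f : mono (fun m' => (m <= m')%MM) f -> exists g, f = 'X_[m] * g.
Proof.
move=> hf; exists (\sum_(m' <- msupp f) f@_m' *: 'X_[(m' - m)]).
rewrite mulr_sumr {1}(mpolyE f) big_seq [RHS]big_seq; apply: eq_bigr => m' ms.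
by rewrite -scalerAr -mpolyXD addmC submK //; apply: hf.
Qed.

(* As x_i and x_j are coprime, they cannot both kill h modulo F. *)
Lemma principal_vars F h (i j : 'I_n.+1) a : F != 0 -> i != j ->
  principal F ('X_[(U_(i) *+ a)] * h) -> principal F ('X_[(U_(j) *+ a)] * h) ->
  principal F h.
Proof.
move=> nz ij [u _ hu] [v _ hv].
set xi : R := 'X_[_] in hu; set xj : R := 'X_[_] in hv.
have e : xj * u = xi * v.
  apply: (mulfI nz); rewrite mulrCA -hu [RHS]mulrCA -hv mulrCA //.
have [w hw] : exists w, u = xi * w.
  apply: mono_multiple => m ms.
  have : (m + U_(j) *+ a)%MM \in msupp (xi * v).
    by rewrite -e mcoeff_msupp mcoeff_XM -mcoeff_msupp.
  move/msuppM_le/allpairsP => [[m1 m2] [/= /mem_msuppXP <- _ em]].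
  apply/mnm_lepP => x; rewrite mulmnE mnm1E; case: eqP => [<-|]; last by rewrite mul0n.
  move/mnmP/(_ i): em; rewrite !mnmDE !mulmnE !mnm1E eqxx eq_sym (negPf ij) mul1n mul0n addn0.
  by move=> ->; exact: leq_addr.
exists w => //; apply: (@mulfI _ xi); first by rewrite -msize_poly_eq0 msizeX.
by rewrite hu hw mulrCA.
Qed.

(** The forms G that send a given h_i into (F) make up a linear subspace. It is proper, since the
    a-th powers of x_0 and x_n cannot both belong to it; n > 0 makes these variables distinct. *)
Lemma general_nzd F a (Q : dhomog n.+1 K a -> Prop) : infinite_type K -> (0 < n)%N -> F != 0 ->
  (forall G : dhomog n.+1 K a, (forall g, principal F (val G * g) -> principal F g) -> Q G) ->
  general Q.
Proof.
move=> infK n0 nz hQ.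
have hB : is_ideal (principal F) by apply/mulI_ideal/fullI_ideal.
have [k [h [nh cover]]] := zero_divisors_cover hB.
apply: (@general_avoid K (dhomog n.+1 K a) k
  (fun i (G : dhomog n.+1 K a) => principal F (val G * h i))) => //.
- move=> i; split=> [|u v hu hv|c v hv].
  + by rewrite mul0r; exact: ideal0.
  + by rewrite mulrDl; exact: idealD.
  + by rewrite -scalerAl; exact: idealZ.
- move=> i; apply: NNPP => nw; apply: (nh i).
  have hX (j : 'I_n.+1) : principal F ('X_[(U_(j) *+ a)] * h i).
    have hj : ('X_[(U_(j) *+ a)] : R) \is (a).-homog.
      by rewrite dhomogX /= mdegMn mdeg1 mul1n.
    by apply: NNPP => nX; apply: nw; exists (DHomog hj).
  apply: (principal_vars nz _ (hX ord0) (hX ord_max)).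
  by apply/eqP => /(congr1 val) /= e; rewrite -e in n0.
- move=> G hG; apply: hQ => g hg; apply: NNPP => ng.
  by have [i] := cover _ _ hg ng; exact: hG.
Qed.

Lemma link_addI I F G h :
  basic_double_link I F G h <-> addI (mulI G I) (principal F) h.
Proof.
split=> [[g [q [Ig ->]]]|[_ [_ [[g Ig ->] [q _ ->] ->]]]].
  by exists (G * g), (q * F); split=> //; [exists g|exists q; rewrite // mulrC].
by exists g, q; rewrite mulrC [F * q]mulrC.
Qed.

Lemma ideal_ext I J : (forall f, I f <-> J f) -> is_ideal I -> is_ideal J.
Proof.
move=> e [h0 hD hM]; split=> [|f g /e hf /e hg|f g /e hg]; apply/e => //.
  exact: hD.
exact: hM.
Qed.

Lemma link_ideal I F G : is_ideal I -> is_ideal (basic_double_link I F G).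
Proof.
move=> hI; apply: (@ideal_ext (addI (mulI G I) (principal F))).
  by move=> f; rewrite link_addI.
by apply: addI_ideal; [exact: mulI_ideal|exact: mulI_ideal].
Qed.

Lemma link_homogeneous I F G d a : is_ideal I -> homogeneous I ->
  F \is d.-homog -> G \is (a).-homog -> homogeneous (basic_double_link I F G).
Proof.
move=> hI gI hF hG f e /link_addI h; apply/link_addI; apply: addI_homogeneous h.
  exact: mulI_homogeneous hG.
exact: mulI_homogeneous (@fullI_homogeneous K n) hF.
Qed.

Lemma link_sub I F G : is_ideal I -> I F -> sub_ideal (basic_double_link I F G) I.
Proof.
by move=> hI IF _ [g [q [Ig ->]]]; apply: (idealD hI); exact: idealM.
Qed.

(** As F lies in I and G is regular modulo F, the intersection of G I and (F) is (F G), of degree d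
    + a; the rest is inclusion-exclusion. *)
Lemma link_idim I F G d a t : is_ideal I -> homogeneous I -> ~ I 1 -> form_in I d F ->
  G \is (a).-homog -> (forall g, principal F (G * g) -> principal F g) ->
  (idim (basic_double_link I F G) t + hs n (d + a) t =
   (if a <= t then idim I (t - a) else 0) + hs n d t)%N.
Proof.
move=> hI gI nI [IF nzF hF] hG nzd.
have nzG : G != 0.
  apply/eqP => G0; apply: nI.
  have [|g _ ->] := nzd 1; first by rewrite G0 mul0r; exact: ideal0 (mulI_ideal F (@fullI_ideal K n)).
  by rewrite mulrC; exact: idealM.
have hf := @fullI_ideal K n; have gf := @fullI_homogeneous K n.
have := idim_addI t (mulI_ideal G hI) (mulI_ideal F hf)
  (mulI_homogeneous hI gI hG) (mulI_homogeneous hf gf hF).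
rewrite (idim_mulI t hI nzG hG) (idim_mulI t hf nzF hF) idim_full -/(principal F).
rewrite -(@idim_ext _ _ (basic_double_link I F G)); last by move=> f; exact: link_addI.
rewrite (@idim_ext _ _ (fun h => mulI G I h /\ principal F h) (mulI (F * G) (@fullI K n))).
  by rewrite (idim_mulI t hf _ (dhomogM hF hG)) ?mulf_neq0 // idim_full.
move=> h; split=> [[[g Ig ->] /nzd[w _ ->]]|[w _ ->]].
  by exists w; rewrite // mulrA [G * F]mulrC.
split; last by exists (G * w); rewrite // mulrA.
by exists (F * w); [rewrite mulrC; exact: idealM|rewrite mulrCA mulrA].
Qed.

(** Subtraction-free form of the statement that the Hilbert series of R/I is (1 + sum z^s - sum z^r)
    / (1 - z)^(n+1). It mentions no resolution and can therefore be carried through links. *)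
Definition hilb I (s r : seq nat) := forall t,
  (idim I t + \sum_(x <- s) hs n x t = \sum_(x <- r) hs n x t)%N.

Lemma hs_shift x a t : hs n (x + a) t = if (a <= t)%N then hs n x (t - a) else 0%N.
Proof.
rewrite /hs; have [le|lt] := leqP a t; first by rewrite leq_subRL // [(x + a)%N]addnC subnDA.
by rewrite leqNgt (leq_trans lt) // leq_addl.
Qed.

(* The shifts y + (y - x) produced by the generator G * (degree y) and by the
   syzygy of the link cancel, and so do the new generator y and the shifted syzygy
   x + (y - x): the link removes the pair (x, y) and shifts all other degrees. *)
Lemma link_hilb I F G (s r : seq nat) x y : is_ideal I -> homogeneous I -> ~ I 1 ->
  (x <= y)%N -> hilb I (x :: s) (y :: r) -> form_in I y F -> G \is (y - x).-homog ->
  (forall g, principal F (G * g) -> principal F g) ->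
  hilb (basic_double_link I F G) [seq (z + (y - x))%N | z <- s] [seq (z + (y - x))%N | z <- r].
Proof.
move=> hI gI nI xy hil hF hG nzd t.
have := link_idim t hI gI nI hF hG nzd; have := hil (t - (y - x))%N.
set a := (y - x)%N; rewrite !big_cons !big_map.
have sE (S : seq nat) : (\sum_(z <- S) hs n (z + a) t =
    if (a <= t)%N then \sum_(z <- S) hs n z (t - a) else 0)%N.
  under eq_bigr => z _ do rewrite hs_shift.
  by case: ifP => _ //; rewrite big1.
rewrite !sE hs_shift.
have -> : hs n y t = if (a <= t)%N then hs n x (t - a) else 0%N.
  by rewrite -hs_shift /a subnKC.
by case: ifP => _; lia.
Qed.

(** If [I] had no form of degree d, multiplication by powers of x_0 would exclude forms of all
    smaller degrees too. The series of [s] and [r] would then agree up to degree d, and d would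
    occur equally often in both. *)
Lemma ex_form I (s r : seq nat) d : is_ideal I -> hilb I s r -> d \in r -> d \notin s ->
  exists F, form_in I d F.
Proof.
move=> hI hil dr ds; apply: NNPP => nF.
have zero t : (t <= d)%N -> idim I t = 0%N.
  move=> td; apply: dimvE; exists 'I_0, (fun=> 0); split=> [|f|u _ []//]; first by rewrite card_ord.
  split=> [[If hf]|[u ->]]; last by rewrite big_ord0; case: (hpart_subspace t hI).
  exists (fun=> 0); rewrite big_ord0; apply/eqP/negPn/negP => nz; apply: nF.
  exists ('X_[(U_(ord0) *+ (d - t))] * f); split; first exact: idealM.
    by rewrite mulf_neq0 // -msize_poly_eq0 msizeX.
  rewrite -{2}(subnK td); apply: dhomogM => //.
  by rewrite dhomogX /= mdegMn mdeg1 mul1n.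
have := @eq_hs_count n d s r _ d (leqnn d).
rewrite (count_memPn ds) => /(_ _)/esym h.
have /count_memPn : count_mem d r = 0%N.
  by apply: h => t td; have := hil t; rewrite zero // add0n.
by rewrite dr.
Qed.
End Links.

(** * Primes generated by variables, and regular sequences *)

Section VariableIdeals.
Variables (K : fieldType) (n : nat).
Local Notation R := {mpoly K[n.+1]}.
Local Notation mon := 'X_{1..n.+1}.
Implicit Types (f g : R) (I J P : R -> Prop).

(** Modulo the ideal, f and g may be replaced by parts free of the first k variables. The product of
    these parts is free of them as well, so it lies in the ideal only if it is zero. *)
Lemma var_ideal_prime k : is_prime (@var_ideal K n k).
Proof.
have hI := var_ideal_ideal K n k.
split=> //.
  move=> h; have /h/existsP[x] : (0%MM : mon) \in msupp (1 : R) by rewrite msupp1 inE.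
  by rewrite mnm0E andbF.
have split_var f : exists f0 f1, [/\ f = f0 + f1, var_ideal k f1
    & forall m, m \in msupp f0 -> ~~ vset k m].
  exists (\sum_(m <- msupp f | ~~ vset k m) f@_m *: 'X_[m]).
  exists (\sum_(m <- msupp f | vset k m) f@_m *: 'X_[m]); split.
  - by rewrite {1}(mpolyE f) (bigID (vset k)) addrC.
  - apply: (ideal_sum _ hI) => m hm; apply: (idealZ _ hI); exact/mono_X.
  - move=> m; apply: contraLR => /negPn hm; rewrite mcoeff_msupp negbK raddf_sum /=.
    rewrite big1 // => m' hm'; rewrite mcoeffZ mcoeffX.
    case: (m' =P m) => [e|]; last by rewrite mulr0.
    by move: hm'; rewrite e hm.
move=> f g; have [f0 [f1 [-> hf1 af]]] := split_var f.
have [g0 [g1 [-> hg1 ag]]] := split_var g => hfg.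
have hfg0 : var_ideal k (f0 * g0).
  have -> : f0 * g0 = (f0 + f1) * (g0 + g1) - ((f0 + f1) * g1 + g0 * f1) by ring.
  by apply: (idealB hI hfg); apply: (idealD hI); exact: (idealM _ hI).
have /eqP : f0 * g0 = 0.
  apply/eqP/negPn/negP => nz; have ms := mlead_supp nz; have := hfg0 _ ms.
  have [[m1 m2] [/= h1 h2 ->]] := allpairsP (msuppM_le ms).
  move=> /existsP[x /andP[xk]]; rewrite mnmDE addn_eq0 negb_and => /orP[nx|nx].
    by move: (af _ h1) => /existsP; apply; exists x; rewrite xk.
  by move: (ag _ h2) => /existsP; apply; exists x; rewrite xk.
by rewrite mulf_eq0 => /orP[/eqP->|/eqP->]; rewrite add0r; auto.
Qed.

Lemma var_ideal_strict k : (k < n.+1)%N ->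
  sub_ideal (@var_ideal K n k) (var_ideal k.+1) /\ ~ sub_ideal (@var_ideal K n k.+1) (var_ideal k).
Proof.
move=> hk; split=> [f|h]; first exact/var_ideal_leq/leqnSn.
have : var_ideal k ('X_(Ordinal hk) : R) by apply/h/var_idealX/ltnSn.
by move/var_idealX; rewrite ltnn.
Qed.

Lemma add_principal_ideal I f : is_ideal I -> is_ideal (add_principal I f).
Proof.
move=> hI; split=> [|_ _ [g [q [Ig ->]]] [g' [q' [Ig' ->]]]|h _ [g [q [Ig ->]]]].
- by exists 0, 0; rewrite mul0r addr0; split=> //; exact: ideal0.
- by exists (g + g'), (q + q'); split; [exact: idealD|rewrite mulrDl addrACA].
- by exists (h * g), (h * q); split; [exact: idealM|rewrite mulrDr mulrA].
Qed.

Lemma regular_sequence_ext I J rs : (forall f, I f <-> J f) ->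
  regular_sequence I rs -> regular_sequence J rs.
Proof.
elim: rs I J => [|f rs IH] I J e /=; first by move=> h /e.
move=> [nzd reg]; split=> [g /e/nzd/e//|]; apply: IH reg => h.
by split=> -[g [q [/e ? ?]]]; exists g, q.
Qed.

Lemma regular_sequence_growth I d rs : is_ideal I -> growth I d ->
  regular_sequence I rs -> (size rs < d)%N.
Proof.
elim: rs I d => [|f rs IH] I d hI gI /=.
  by case: d gI => // /growth0 h /(_ (h hI)).
(* Exponent 0 means I = R, which persists along the sequence and contradicts the properness required
   at its end. *)
move=> [nzd reg]; case: d gI => [|d] gI.
  have hJ := add_principal_ideal f hI.
  suff /growth_full/(_ hJ) h : add_principal I f 1 by have := IH _ 0%N hJ (h 0%N) reg.
  by exists 1, 0; rewrite mul0r addr0; split=> //; exact: growth0.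
rewrite ltnS; apply: IH reg; first exact: add_principal_ideal.
apply: (growth_step (f := f) hI) => //; first exact: add_principal_ideal.
  by move=> g Ig; exists g, 0; rewrite mul0r addr0.
by exists 0, 1; rewrite mul1r add0r; split=> //; exact: ideal0.
Qed.

Lemma prime_X P m (i : 'I_n.+1) : is_prime P -> P 'X_[(U_(i) *+ m)] -> P 'X_i.
Proof.
move=> [hP nP primP]; rewrite -mpolyXn; elim: m => [|m IH]; first by rewrite expr0.
by rewrite exprS => /primP[].
Qed.

Lemma hilbert_function_idim I t : is_ideal I ->
  hilbert_function I t (\dim {: dhomog n.+1 K t} - idim I t)%N.
Proof.
move=> hI; pose W (f : dhomog n.+1 K t) := I (val f).
have sW : subspace W.
  split=> [|u v|c v]; rewrite /W; [exact: ideal0|exact: idealD|exact: idealZ].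
have lv : is_lin (fun f : dhomog n.+1 K t => val f) by [].
have fW := fin_dim_vect sW.
have [U hU dU] := subspace_vspace sW; exists U => //.
congr (_ - _)%N; rewrite dU -(dimv_inj_image sW lv fW) => [|v _ v0]; last exact: val_inj.
apply: dimv_ext => f; split=> [[If hf]|[v Wv ->]]; last by split=> //; exact: dhomog_is_dhomog.
by exists (DHomog hf).
Qed.
End VariableIdeals.

(** * The monomial ideal with the prescribed Hilbert function *)

Section Staircase.
Variables (K : fieldType) (n : nat).
Local Notation R := {mpoly K[n.+1]}.
Local Notation mon := 'X_{1..n.+1}.
Hypothesis n_gt0 : (0 < n)%N.
Variables (s r : seq nat).
Hypothesis size_r : size r = (size s).+1.
Hypothesis sum_rs : (\sum_(x <- s) x = \sum_(x <- r) x)%N.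
Hypothesis r_gt0 : forall j, (j <= size s)%N -> (0 < nth 0 r j)%N.
Hypothesis diag_gt : forall i, (i < size s)%N -> (nth 0 r i < nth 0 s i)%N.
Hypothesis offdiag_gt : forall i, (i < size s)%N -> (nth 0 r i.+1 < nth 0 s i)%N.

Let i0 : 'I_n.+1 := ord0.
Let i1 : 'I_n.+1 := Ordinal (n_gt0 : (1 < n.+1)%N).

(* The maximal minors of the bidiagonal Hilbert-Burch matrix with entries
   x_0 ^ (s_i - r_i) and x_1 ^ (s_i - r_(i+1)) are x_0 ^ stA j * x_1 ^ stB j. *)
Definition stA j := (\sum_(i < j) (nth 0 s i - nth 0 r i))%N.
Definition stB j := (\sum_(j <= i < size s) (nth 0 s i - nth 0 r i.+1))%N.

Lemma stAS j : stA j.+1 = (stA j + (nth 0 s j - nth 0 r j))%N.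
Proof. by rewrite /stA big_ord_recr. Qed.

Lemma stBS j : (j < size s)%N -> stB j = (nth 0 s j - nth 0 r j.+1 + stB j.+1)%N.
Proof. by move=> h; rewrite /stB big_ltn. Qed.

(** For j = 0 this is the equality of sums. Passing from j to j + 1 trades s_j - r_(j+1) factors x_1
    for s_j - r_j factors x_0. *)
Lemma st_deg j : (j <= size s)%N -> (stA j + stB j = nth 0 r j)%N.
Proof.
elim: j => [_|j IH h].
  rewrite /stA big_ord0 add0n /stB.
  have e : (\sum_(0 <= i < size s) (nth 0 s i - nth 0 r i.+1)
      + \sum_(0 <= i < size s) nth 0 r i.+1 = \sum_(0 <= i < size s) nth 0 s i)%N.
    rewrite -big_split /= big_nat [RHS]big_nat; apply: eq_bigr => i /andP[_ hi].
    by rewrite subnK // ltnW // offdiag_gt.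
  move: sum_rs; rewrite (big_nth 0%N) [RHS](big_nth 0%N) size_r big_nat_recl // -e.
  by lia.
have := IH (ltnW h); rewrite stAS (stBS h).
by have := diag_gt h; have := offdiag_gt h; lia.
Qed.

(** The left-hand side is the degree of the least common multiple of the consecutive generators j
    and j + 1. *)
Lemma st_lcm j : (j < size s)%N -> (stA j.+1 + stB j = nth 0 s j)%N.
Proof.
by move=> h; have := st_deg (ltnW h); rewrite stAS; have := diag_gt h; lia.
Qed.

Definition st_gen j (m : mon) := (stA j <= m i0)%N && (stB j <= m i1)%N.
Definition st_syz j (m : mon) := (stA j.+1 <= m i0)%N && (stB j <= m i1)%N.
Definition stair (m : mon) := has (fun j => st_gen j m) (iota 0 (size s).+1).

Lemma stB_anti j k : (j <= k)%N -> (k <= size s)%N -> (stB k <= stB j)%N.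
Proof.
move=> jk ks; rewrite /stB (big_cat_nat jk ks) /=; exact: leq_addl.
Qed.

Lemma stA_mono j k : (j <= k)%N -> (stA j <= stA k)%N.
Proof. by move/subnK <-; elim: (k - j)%N => // d IH; rewrite addSn stAS (leq_trans IH) // leq_addr. Qed.

(** The indices of the generators dividing [m] form an interval, because the exponents of x_0
    increase and those of x_1 decrease weakly. A nonempty interval has one element more than it has
    consecutive pairs. *)
Lemma stair_count m :
  (stair m + \sum_(j < size s) st_syz j m = \sum_(j < (size s).+1) st_gen j m)%N.
Proof.
suff h k : (k <= size s)%N -> (has (fun j => st_gen j m) (iota 0 k.+1)
   + \sum_(0 <= j < k) st_syz j m = \sum_(0 <= j < k.+1) st_gen j m)%N.
  by rewrite -!(big_mkord xpredT (fun j => nat_of_bool (_ j m))) h.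
elim: k => [_|k IH hk]; first by rewrite big_geq // big_nat1 /= orbF addn0.
have -> : has (fun j => st_gen j m) (iota 0 k.+2) =
    has (fun j => st_gen j m) (iota 0 k.+1) || st_gen k.+1 m.
  by rewrite -[k.+2]addn1 iotaD has_cat [X in _ || X]/= orbF.
rewrite big_nat_recr // [RHS]big_nat_recr // -(IH (ltnW hk)).
(* Inclusion-exclusion for one more generator: it shares [m] with some earlier generator exactly
   when it shares it with its neighbour. *)
have e : st_syz k m = has (fun j => st_gen j m) (iota 0 k.+1) && st_gen k.+1 m.
  apply/andP/andP => [[hA hB]|[/hasP[j]]].
    split; last by rewrite /st_gen hA (leq_trans (stB_anti (leqnSn k) hk)).
    apply/hasP; exists k; first by rewrite mem_iota add0n ltnSn.
    by rewrite /st_gen hB (leq_trans (stA_mono (leqnSn k))).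
  rewrite mem_iota add0n ltnS => jk /andP[_ hB] /andP[hA _]; split=> //.
  by apply: leq_trans hB; apply: stB_anti => //; apply: ltnW.
rewrite e; move: (\sum_(0 <= i < k) _)%N (has _ _) (st_gen _ _) => S [] [];
  by rewrite /= ?addn0 ?add0n // !add1n !addn1 ?addSn.
Qed.

Lemma count_corner a b t :
  count (fun m : mon => (a <= m i0)%N && (b <= m i1)%N) (mons n t) = hs n (a + b) t.
Proof.
pose g : mon := (U_(i0) *+ a + U_(i1) *+ b)%MM.
have -> : (a + b)%N = mdeg g by rewrite mdegD !mdegMn !mdeg1 !mul1n.
rewrite -count_multiples; apply: eq_count => m /=.
have gE x : g x = ((i0 == x) * a + (i1 == x) * b)%N by rewrite mnmDE !mulmnE !mnm1E.
apply/andP/mnm_lepP => [[ha hb] x|h].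
  rewrite gE; case: (eqVneq i0 x) => [<-|_]; first by rewrite mul1n addn0.
  by case: (eqVneq i1 x) => [<-|_] //; rewrite mul1n.
have := h i0; have := h i1; rewrite !gE /= mul1n mul0n mul1n addn0 //.
Qed.

Lemma stair_hilb : hilb (@mono K n stair) s r.
Proof.
move=> t; rewrite idim_mono (big_nth 0%N) [RHS](big_nth 0%N) size_r !big_mkord.
have cnt (p : pred mon) : count p (mons n t) = (\sum_(m <- mons n t) p m)%N.
  by rewrite -sum1_count big_mkcond; apply: eq_bigr => m _; case: (p m).
have -> : (\sum_(j < size s) hs n (nth 0 s j) t =
    \sum_(m <- mons n t) \sum_(j < size s) st_syz j m)%N.
  rewrite exchange_big; apply: eq_bigr => j _.
  by rewrite -(st_lcm (ltn_ord j)) -count_corner -cnt.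
have -> : (\sum_(j < (size s).+1) hs n (nth 0 r j) t =
    \sum_(m <- mons n t) \sum_(j < (size s).+1) st_gen j m)%N.
  rewrite exchange_big; apply: eq_bigr => j _.
  have jm : (j <= size s)%N by rewrite -ltnS.
  by rewrite -(st_deg jm) -count_corner -cnt.
by rewrite cnt -big_split; apply: eq_bigr => m _; exact: stair_count.
Qed.

Lemma stair_upset : upset stair.
Proof.
move=> m m' /hasP[j hj /andP[h1 h2]]; apply/hasP; exists j => //.
by rewrite /st_gen !mnmDE (leq_trans h1) ?(leq_trans h2) // leq_addr.
Qed.

Lemma stair_ideal : is_ideal (@mono K n stair).
Proof. exact/mono_ideal/stair_upset. Qed.

(** The last generator is a pure power of x_0; dually, the first is a pure power of x_1. *)
Lemma stair_x0 (m : mon) : (stA (size s) <= m i0)%N -> stair m.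
Proof.
move=> h; apply/hasP; exists (size s); first by rewrite mem_iota /= add0n ltnSn.
by rewrite /st_gen h /stB big_geq.
Qed.

Lemma stair_x1 (m : mon) : (stB 0 <= m i1)%N -> stair m.
Proof.
by move=> h; apply/hasP; exists 0%N; rewrite ?mem_iota // /st_gen h /stA big_ord0.
Qed.

Lemma stair_local (m m' : mon) : m i0 = m' i0 -> m i1 = m' i1 -> stair m = stair m'.
Proof. by move=> e0 e1; apply: eq_has => j; rewrite /st_gen e0 e1. Qed.

Lemma stair_vset m : stair m -> vset 2 m.
Proof.
move=> /hasP[j]; rewrite mem_iota add0n ltnS => /= js /andP[h0 h1].
have := r_gt0 js; rewrite -st_deg //; rewrite addn_gt0 => /orP[h|h]; apply/existsP.
  by exists i0; rewrite -lt0n (leq_trans h).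
by exists i1; rewrite -lt0n (leq_trans h).
Qed.

(** The pure powers of x_0 and x_1 form a regular sequence in the ideal, so the exponent n + 2 of
    the zero ideal drops twice. *)
Lemma stair_growth : growth (@mono K n stair) n.
Proof.
have hZ := var_ideal_ideal K n 0.
pose U (m : mon) := (stA (size s) <= m i0)%N.
have uU : upset U by move=> m m' h; rewrite /U mnmDE (leq_trans h) ?leq_addr.
have hU : is_ideal (@mono K n U) by exact: mono_ideal.
have gU : growth (@mono K n U) n.+1.
  apply: (growth_step (f := 'X_[(U_(i0) *+ stA (size s))]) hZ hU _ _ _ (growth_zero hZ)).
  - by move=> f /var_ideal0 ->; exact: ideal0.
  - by apply/mono_X; rewrite /U mulmnE mnm1E eqxx mul1n.
  - move=> g /var_ideal0/eqP; rewrite mulf_eq0 -msize_poly_eq0 msizeX /= => /eqP ->.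
    exact: ideal0.
apply: (growth_step (f := 'X_[(U_(i1) *+ stB 0)]) hU stair_ideal _ _ _ gU).
- by move=> f hf m /hf; exact: stair_x0.
- by apply/mono_X/stair_x1; rewrite mulmnE mnm1E eqxx mul1n.
- by move=> g; apply: mono_Xmul => m; rewrite /U mnmDE mulmnE mnm1E /= mul0n addn0.
Qed.

Lemma stair_sub_var : sub_ideal (@mono K n stair) (var_ideal 2).
Proof. by move=> f hf m /hf/stair_vset. Qed.

Lemma stair_height_ge2 : height_ge (@mono K n stair) 2.
Proof.
move=> P pP sP; have [hP nP primP] := pP.
have P0 : P 'X_i0.
  apply: (prime_X (m := stA (size s)) pP); apply/sP/mono_X/stair_x0.
  by rewrite mulmnE mnm1E eqxx mul1n.
have P1 : P 'X_i1.
  apply: (prime_X (m := stB 0) pP); apply/sP/mono_X/stair_x1.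
  by rewrite mulmnE mnm1E eqxx mul1n.
(* The chain is 0, (x_0), P; the second inclusion is strict because P contains x_1. *)
exists (fun i => if i is i'.+2 then P else @var_ideal K n i) => //.
split=> [[|[|[|i]]] // _|[|[|i]] // _].
- exact: var_ideal_prime.
- exact: var_ideal_prime.
- exact: var_ideal_strict.
split.
  move=> f /(var_idealS (ltn0Sn n))[g [q [/var_ideal0 -> ->]]]; rewrite add0r.
  apply: idealM => //; rewrite (_ : Ordinal _ = i0) //; exact: val_inj.
by move=> h; have /var_idealX := h _ P1.
Qed.

Lemma var_chain_above : prime_chain n.-1 (fun i => @var_ideal K n i.+2).
Proof.
by split=> i hi; [exact: var_ideal_prime|apply: var_ideal_strict; lia].
Qed.

(** Height three of (x_0, x_1) would leave it the growth exponent n - 1, too small for the chain of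
    n - 1 inclusions from it up to (x_0, ..., x_n). *)
Lemma stair_not_height3 : ~ height_ge (@mono K n stair) 3.
Proof.
move=> /(_ _ (var_ideal_prime K n 2) stair_sub_var)[C hC e].
have hC0 : is_ideal (C 0%N) by case: hC => /(_ 0%N isT)[].
have [_ g3] := prime_chain_growth hC (growth_zero hC0) (leqnn 3).
have hC3 : is_ideal (C 3) by case: hC => /(_ 3 isT)[].
have g2 : growth (@var_ideal K n 2) n.-1.
  apply: (growth_sub hC3 (var_ideal_ideal K n 2)) => [f /e//|].
  by move: g3; rewrite (_ : (n.+2 - 3 = n.-1)%N) //; lia.
by have [] := prime_chain_growth var_chain_above g2 (leqnn n.-1); rewrite ltnn.
Qed.

(** The monomials of the ideal enlarged by x_2, ..., x_(k-1). *)
Definition stair_mod k (m : mon) := stair m || [exists x : 'I_n.+1, (1 < x < k)%N && (m x != 0%N)].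

Lemma stair_mod_upset k : upset (stair_mod k).
Proof.
move=> m m' /orP[h|/existsP[x /andP[h nz]]]; first by rewrite /stair_mod stair_upset.
apply/orP; right; apply/existsP; exists x.
by rewrite h mnmDE addn_eq0 negb_and nz.
Qed.

Lemma stair_regular d k : (1 < k)%N -> (k + d = n.+1)%N ->
  regular_sequence (@mono K n (stair_mod k)) [seq 'X_(inord j) | j <- iota k d].
Proof.
elim: d k => [|d IH] k k1 kd /=.
  move=> h; have : stair_mod k 0%MM by apply: h; rewrite msupp1 inE.
  case/orP => [/stair_vset/existsP[x]|/existsP[x]]; by rewrite mnm0E andbF.
have kn : (k < n.+1)%N by lia.
pose x : 'I_n.+1 := inord k; have xk : x = k :> nat by rewrite /x inordK.
split=> [g|].
  apply: mono_Xmul => m /orP[h|/existsP[y /andP[hy]]].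
    apply/orP; left; rewrite -(stair_local (m := m + U_(x))%MM) // mnmDE mnm1E.
      by rewrite (_ : (x == i0) = false) ?addn0 //; apply/eqP => /(congr1 val) /=; lia.
    by rewrite (_ : (x == i1) = false) ?addn0 //; apply/eqP => /(congr1 val) /=; lia.
  rewrite mnmDE mnm1E (_ : (x == y) = false) ?addn0 => [nz|].
    by apply/orP; right; apply/existsP; exists y; rewrite hy.
  by apply/eqP => /(congr1 val) /=; lia.
apply: regular_sequence_ext (IH k.+1 _ _) => //; last by lia.
  move=> f; rewrite (mono_add_principal _ _ (@stair_mod_upset k)) -/x.
  suff e m : stair_mod k.+1 m = stair_mod k m || (m x != 0%N).
    by split=> h m /h; rewrite e.
  rewrite /stair_mod -orbA; congr orb; apply/existsP/orP => [[y /andP[hy nz]]|[/existsP[y /andP[hy nz]]|nz]].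
  - have [yk|yk] := eqVneq y x; first by right; rewrite -yk.
    left; apply/existsP; exists y; rewrite nz andbT.
    by have : (y : nat) != k; [rewrite -xk; apply: contra yk => /eqP/val_inj->|lia].
  - by exists y; rewrite nz andbT; lia.
  - by exists x; rewrite nz andbT xk; lia.
by lia.
Qed.

(** Growth exponent n bounds chains of primes and regular sequences alike by n - 1. The primes
    generated by initial variables attain the first bound, x_2, ..., x_n the second. *)
Lemma stair_cohen_macaulay : cohen_macaulay (@mono K n stair).
Proof.
exists n.-1; split; first split.
- exists (fun i => @var_ideal K n i.+2); first exact: var_chain_above.
  exact: stair_sub_var.
- rewrite prednK // => -[C hC sC].
  have hC0 : is_ideal (C 0%N) by case: hC => /(_ 0%N isT)[].
  have g0 := growth_sub stair_ideal hC0 sC stair_growth.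
  by have [] := prime_chain_growth hC g0 (leqnn n); rewrite ltnn.
split.
  exists [seq 'X_(inord j) | j <- iota 2 n.-1]; split.
  - by rewrite size_map size_iota.
  - by move=> f /mapP[j _ ->]; rewrite mcoeffX mnm1_eq0.
  - have h2 : (2 + n.-1 = n.+1)%N by lia.
    apply: regular_sequence_ext (stair_regular (ltnSn 1) h2) => f.
    suff e m : stair_mod 2 m = stair m by split=> h m /h; rewrite e.
    rewrite /stair_mod orbC; case: existsP => // -[x /andP[]]; lia.
move=> l [rs [<- _ reg]].
by have := regular_sequence_growth stair_ideal stair_growth reg; lia.
Qed.

(** A power of x_2 is a form of the given degree, and it cancels modulo the ideal because x_2 occurs
    in no generator. *)
Lemma stair_saturated : (1 < n)%N -> saturated (@mono K n stair).
Proof.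
move=> n1 f [k hk]; pose i2 : 'I_n.+1 := Ordinal (n1 : (2 < n.+1)%N).
have h2 : ('X_[(U_(i2) *+ k)] : R) \is k.-homog by rewrite dhomogX /= mdegMn mdeg1 mul1n.
apply: mono_Xmul (hk _ h2) => m; rewrite -(stair_local (m := (m + U_(i2) *+ k)%MM)) //.
  by rewrite mnmDE mulmnE mnm1E /= mul0n addn0.
by rewrite mnmDE mulmnE mnm1E /= mul0n addn0.
Qed.

Lemma stair_acm : acm_codim2_ideal (@mono K n stair).
Proof.
split.
- exact: stair_ideal.
- exact: mono_homogeneous.
- by split; [exact: stair_height_ge2|exact: stair_not_height3].
- exact: stair_cohen_macaulay.
- exact: stair_saturated.
Qed.
End Staircase.

(** * Induction along the algorithm *)

Section Algorithm.
Variables (K : fieldType) (n : nat).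
Local Notation R := {mpoly K[n.+1]}.
Implicit Types (I : R -> Prop).

Lemma hilb_perm I (s s' r r' : seq nat) :
  perm_eq s s' -> perm_eq r r' -> hilb I s r -> hilb I s' r'.
Proof.
by move=> ps pr h t; rewrite -(perm_big _ ps) -(perm_big _ pr); exact: h.
Qed.

Lemma hilb_disjoint I (E O : seq nat) : hilb I E O ->
  hilb I (mset_diff E O) (mset_diff O E) /\
  forall x, x \in mset_diff E O -> x \notin mset_diff O E.
Proof.
move=> h; split=> [t|x]; last first.
  by rewrite -!has_pred1 !has_count !count_mset_diff; lia.
have p : perm_eq (E ++ mset_diff O E) (O ++ mset_diff E O).
  by apply/allP => x _; apply/eqP; rewrite !count_cat !count_mset_diff; lia.
have := h t; move: (mset_diff E O) (mset_diff O E) p => s r p.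
have e : (\sum_(x <- E ++ r) hs n x t = \sum_(x <- O ++ s) hs n x t)%N by exact: perm_big.
by move: e; rewrite !big_cat /=; lia.
Qed.

(** Summing the Hilbert function up to t turns the coefficients of E / (1 - z)^(n+2) into [cod I t],
    which the growth of [I] bounds. The extra shift 0 is that of R itself. *)
Lemma balanced_hilb I (s r : seq nat) : (0 < n)%N -> is_ideal I -> homogeneous I ->
  growth I n -> hilb I s r ->
  size r = (size s).+1 /\ (\sum_(x <- s) x = \sum_(x <- r) x)%N.
Proof.
move=> n0 hI gI [C hC] hil.
have hS (S : seq nat) t : (\sum_(x <- S) hs n.+1 x t =
    \sum_(u < t.+1) \sum_(x <- S) hs n x u)%N.
  by rewrite exchange_big /=; apply: eq_bigr => x _; rewrite hsS.
have key t : (\sum_(x <- 0%N :: s) hs n.+1 x t = \sum_(x <- r) hs n.+1 x t + cod I t)%N.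
  rewrite !hS; have := cod_homogeneous t hI gI.
  have -> : (\sum_(u < t.+1) 'C(u + n, n) = \sum_(u < t.+1) hs n 0 u)%N.
    by apply: eq_bigr => u _; rewrite /hs subn0.
  have -> : (\sum_(u < t.+1) \sum_(x <- r) hs n x u =
     \sum_(u < t.+1) idim I u + \sum_(u < t.+1) \sum_(x <- s) hs n x u)%N.
    by rewrite -big_split; apply: eq_bigr => u _; rewrite -(hil u).
  under [in X in _ -> X]eq_bigr => u _ do rewrite big_cons.
  by rewrite big_split /=; lia.
have [||h1 h2] := @balanced_shifts n (0%N :: s) r C n0.
- by move=> t; rewrite key leq_addr.
- move=> t; rewrite key leq_add2l; apply: leq_trans (hC t) _.
  by rewrite leq_mul2l; apply/orP; right; case: (n) n0.
by split; [rewrite -h1|rewrite -h2 big_cons add0n].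
Qed.

(** A proper homogeneous ideal contains no nonzero constant, so 0 occurs equally often in [s] and
    [r]; disjointness excludes it from both. *)
Lemma shifts_gt0 I (s r : seq nat) : is_ideal I -> homogeneous I -> ~ I 1 -> hilb I s r ->
  (forall x, x \in s -> x \notin r) -> 0%N \notin r.
Proof.
move=> hI gI nI hil dis.
have idim0 : idim I 0 = 0%N.
  apply: dimvE; exists 'I_0, (fun=> 0); split=> [|f|u _ []//]; first by rewrite card_ord.
  split=> [[If /dhomogP hf]|[u ->]]; last by rewrite big_ord0; case: (hpart_subspace 0 hI).
  exists (fun=> 0); rewrite big_ord0; apply/eqP/negPn/negP => nz.
  have ms := mlead_supp nz; have /eqP := hf _ ms; rewrite mdeg_eq0 => /eqP e.
  by move: ms; rewrite e mcoeff_msupp (proper_const0 hI gI nI If) eqxx.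
have e : count_mem 0%N s = count_mem 0%N r.
  apply: (@eq_hs_count n 0) => // t; rewrite leqn0 => /eqP->.
  by have := hil 0%N; rewrite idim0.
apply/negP => r0; have : 0%N \in s by rewrite -has_pred1 has_count e -has_count has_pred1.
by move/dis; rewrite r0.
Qed.

Lemma next_link_None (s r : seq nat) : negative_diagonal s r = [::] ->
  forall i, (i < size s)%N -> (nth 0 r i <= nth 0 s i)%N.
Proof.
move=> h i hi; rewrite leqNgt; apply/negP => lt.
have : i \in negative_diagonal s r.
  by rewrite mem_filter mem_rev mem_iota add0n hi andbT /degree_matrix; lia.
by rewrite h.
Qed.

(** Induction on the size of [s], which every link lowers by one. A link stays inside [I], so it
    remains proper. *)
Lemma algorithm_terminates I (s r : seq nat) : infinite_type K -> (0 < n)%N ->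
  is_ideal I -> homogeneous I -> ~ I 1 -> hilb I s r ->
  (forall x, x \in s -> x \notin r) ->
  size r = (size s).+1 -> (\sum_(x <- s) x = \sum_(x <- r) x)%N ->
  algorithm_terminates_with (@numerically_ACM K n) I.
Proof.
move=> infK n0; elim: {s}(size s) {-2}s (erefl (size s)) r I => [|m IH] s sm r I.
  move=> hI gI nI hil dis sr sumE.
  (* With no s left, equality of sums would make [r] the single shift 0, which a proper ideal does
     not have. *)
  have := shifts_gt0 hI gI nI hil dis.
  move: sumE sr; rewrite (size0nil sm) big_nil /=; case: r {hil dis} => [|y []] //.
  by rewrite big_seq1 => <-; rewrite inE.
move=> hI gI nI hil dis sr sumE.
have red c : resolution_shifts I c ->
    reduced_s n c = sort geq s /\ reduced_r n c = sort geq r.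
  move=> hc; apply: (@reduced_shifts n (idim I)) => // t.
  exact: resolution_dim.
have mem_s i : (i < size s)%N -> nth 0%N (sort geq s) i \in s.
  by move=> hi; rewrite -(mem_sort geq) mem_nth ?size_sort.
have mem_r i : (i <= size s)%N -> nth 0%N (sort geq r) i \in r.
  by move=> hi; rewrite -(mem_sort geq) mem_nth ?size_sort ?sr.
have link c d a : resolution_shifts I c -> next_link_type n c = Some (d, a) ->
    exists x, [/\ x \in s, d \in r, (x <= d)%N & a = (d - x)%N].
  move=> /red[e1 e2]; rewrite /next_link_type e1 e2.
  case neg : (negative_diagonal _ _) => [|i l] // [<- <-].
  have : i \in negative_diagonal (sort geq s) (sort geq r) by rewrite neg mem_head.
  rewrite mem_filter mem_rev mem_iota add0n size_sort => /andP[lt /andP[_ hi]].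
  exists (nth 0%N (sort geq s) i); split; [exact: mem_s|exact/mem_r/ltnW| |].
    by move: lt; rewrite /degree_matrix; lia.
  by move: lt; rewrite /degree_matrix; lia.
constructor.
- exact: ex_resolution.
- move=> c /red[e1 e2]; rewrite /next_link_type e1 e2.
  case neg : (negative_diagonal _ _) => // _.
  (* Absence of negative entries gives the weak inequality, disjointness the strict one. As [r] is
     non-increasing, the entries next to the diagonal are positive too. *)
  have diag i : (i < size (sort geq s))%N ->
      (nth 0 (sort geq r) i < nth 0 (sort geq s) i)%N.
    move=> hi; rewrite ltn_neqAle (next_link_None neg hi) andbT.
    rewrite size_sort in hi; apply/eqP => e; have := dis _ (mem_s _ hi).
    by rewrite -e mem_r // ltnW.
  have offdiag i : (i < size (sort geq s))%N ->
      (nth 0 (sort geq r) i.+1 < nth 0 (sort geq s) i)%N.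
    move=> hi; apply: leq_ltn_trans (diag i hi).
    have srt : sorted geq (sort geq r) by apply: sort_sorted => x y; exact: leq_total.
    have := @sorted_ltn_nth _ geq _ 0%N _ srt i i.+1; apply => //.
    + by move=> x y z /= h1 h2; apply: leq_trans h2 h1.
    + by rewrite inE size_sort sr; move: hi; rewrite size_sort; lia.
    + by rewrite inE size_sort sr; move: hi; rewrite size_sort; lia.
  have sz : size (sort geq r) = (size (sort geq s)).+1 by rewrite !size_sort.
  have sm' : (\sum_(x <- sort geq s) x = \sum_(x <- sort geq r) x)%N.
    have ps : perm_eq (sort geq s) s by rewrite perm_sort.
    have pr : perm_eq (sort geq r) r by rewrite perm_sort.
    by rewrite (perm_big _ ps) (perm_big _ pr).
  have r0 j : (j <= size (sort geq s))%N -> (0 < nth 0 (sort geq r) j)%N.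
    rewrite size_sort => hj; rewrite lt0n; apply/eqP => e.
    by have := shifts_gt0 hI gI nI hil dis; rewrite -e mem_r.
  split=> //; exists (mono (stair n0 (sort geq s) (sort geq r))).
    exact: stair_acm.
  move=> t; exists (\dim {: dhomog n.+1 K t} - idim I t)%N; first exact: hilbert_function_idim.
  have <- : idim (mono (K := K) (stair n0 (sort geq s) (sort geq r))) t = idim I t.
    have := stair_hilb K n0 sz sm' diag offdiag t.
    have ps : perm_eq s (sort geq s) by rewrite perm_sym perm_sort.
    have pr : perm_eq r (sort geq r) by rewrite perm_sym perm_sort.
    by have := hilb_perm ps pr hil t; lia.
  by apply: hilbert_function_idim; exact: stair_ideal.
- move=> c d a hc /(link _ _ _ hc)[x [xs dr _ _]]; apply: (ex_form hI hil dr).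
  by apply/negP => /dis; rewrite dr.
move=> c d a hc /(link _ _ _ hc)[x [xs dr xd ->]] F hF; have [IF nzF homF] := hF.
apply: (general_nzd infK n0 nzF) => G nzd.
have homG : val G \is (d - x).-homog by exact: dhomog_is_dhomog.
have hil' := hilb_perm (perm_to_rem xs) (perm_to_rem dr) hil.
have hilJ := link_hilb hI gI nI xd hil' hF homG nzd.
have szs := size_rem xs; have szr := size_rem dr.
apply: (IH _ _ _ _ _ _ _ hilJ).
- by rewrite size_map szs sm.
- exact: link_ideal.
- exact: link_homogeneous homF homG.
- by move=> /(link_sub hI IF).
- move=> z /mapP[w ws ->]; apply/mapP => -[w' w'r /addIn e].
  by have := dis w (mem_rem ws); rewrite e (mem_rem w'r).
- by rewrite !size_map szs szr sr sm.
have shift (S : seq nat) (b : nat) : (\sum_(z <- [seq w + b | w <- S]) z =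
    \sum_(w <- S) w + size S * b)%N.
  by rewrite big_map big_split /= big_const_seq count_predT iter_addn_0 mulnC.
(* The remaining part of [r] has one element more and thus gains one more d - x, which offsets the
   removal of d from one sum and of x from the other. *)
rewrite !shift szs szr sr sm /=.
have := sumE; rewrite (perm_big _ (perm_to_rem xs)) [X in _ = X](perm_big _ (perm_to_rem dr)).
by rewrite /= !big_cons mulSn; lia.
Qed.
End Algorithm.

Theorem proposition4p4 (K : fieldType) (n : nat)
    (I : {mpoly K[n.+1]} -> Prop) :
  infinite_type K ->
  is_ideal I -> homogeneous I -> ~ I 1%R -> height_ge I 2 ->
  algorithm_terminates_with (@numerically_ACM K n) I.
Proof.
move=> infK hI gI nI ht; have gr := height2_growth hI gI ht.
(* For n = 0 the growth bound reads [growth I 0], that is, I = R. *)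
have n0 : (0 < n)%N.
  rewrite lt0n; apply/eqP => e; apply/nI/(growth0 hI); have [C hC] := gr.
  exists C => t; apply: leq_trans (hC t) _.
  by rewrite leq_mul2l; apply/orP; right; case: (n) e.
have [c hc] := ex_resolution hI gI nI.
have [hil dis] := hilb_disjoint (fun t => resolution_dim t hI hc).
have [sz sumE] := balanced_hilb n0 hI gI gr hil.
exact: algorithm_terminates hil dis sz sumE.
Qed.
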